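(* Let $\alpha>2$ and let $Z=Z^{(n)}$ be the sparse random matrix $Z_{ij}=X_{ij}Y_{ij}$, where $X$ is the adjacency matrix of the Erdős–Rényi graph $\mathcal G_{n,d/n}$ and $Y$ has i.i.d. Weibull entries with shape parameter $\alpha$ (all as described in the context). Put $$\lambda^{\mathrm{light}}_{\alpha}:=2^{\frac1\alpha}\,\alpha^{-\frac12}\,(\alpha-2)^{\frac12-\frac1\alpha}\,\frac{(\log n)^{\frac12}}{(\log\log n)^{\frac12-\frac1\alpha}}.$$ Then for any $\delta>0$, $$\lim_{n\to\infty}-\frac{\log \mathbb P\left(\lambda_1(Z)\ge(1+\delta)\lambda^{\mathrm{light}}_{\alpha}\right)}{\log n}=(1+\delta)^2-1.$$
   Context: $d>0$ is a fixed constant. $X=(X_{ij})_{i,j\in[n]}$ is the adjacency matrix of the Erdős–Rényi graph $\mathcal G_{n,p}$ on vertex set $[n]=\{1,\dots,n\}$ with $p=d/n$. $Y=(Y_{ij})_{i,j\in[n]}$ is a random symmetric matrix, independent of $X$, with $Y_{ii}=0$, $Y_{ij}=Y_{ji}$ and $\{Y_{ij}\}_{1\le i<j\le n}$ i.i.d. with a Weibull distribution with shape parameter $\alpha$ (whose law does not depend on $n$). A random variable $W$ has a Weibull distribution with shape parameter $\alpha>0$ if there exist constants $C_1,C_2>0$ such that for all $t>1$, $\frac{C_1}{2}e^{-t^\alpha}\le \mathbb P(W\ge t)\le\frac{C_2}{2}e^{-t^\alpha}$ and $\frac{C_1}{2}e^{-t^\alpha}\le\mathbb P(W\le -t)\le\frac{C_2}{2}e^{-t^\alpha}$.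 $Z$ is the entrywise product, $Z_{ij}=X_{ij}Y_{ij}$. $\lambda_1(Z)$ denotes the largest eigenvalue of the symmetric matrix $Z$. *)

(* Defs.v *)
From HB Require Import structures.
From mathcomp Require Import all_boot all_order all_algebra.
From mathcomp Require Import all_classical all_reals all_analysis.

Set Implicit Arguments.
Unset Strict Implicit.
Unset Printing Implicit Defensive.

Import Order.TTheory GRing.Theory Num.Theory.
Import numFieldNormedType.Exports.

Local Open Scope classical_set_scope.
Local Open Scope ring_scope.

Definition mutually_independent (R : realType) (d : measure_display)
    (T : measurableType d) (P : probability T R) (d' : measure_display)
    (T' : measurableType d') (I : finType) (D : {set I})
    (X : I -> {RV P >-> T'}) : Prop :=
  forall (J : {set I}) (B : I -> set T'),
    J \subset D -> (forall i, measurable (B i)) ->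
    P (\bigcap_(i in [set` J]) (X i @^-1` B i)) =
    (\prod_(i in J) P (X i @^-1` B i))%E.

Definition sigma_of (R : realType) (d : measure_display)
    (T : measurableType d) (P : probability T R) (d' : measure_display)
    (T' : measurableType d') (I : finType) (X : I -> {RV P >-> T'}) :
    set (set T) :=
  <<s \bigcup_i preimage_set_system [set: T] (X i) measurable >>.

Definition independent_families (R : realType) (d : measure_display)
    (T : measurableType d) (P : probability T R)
    (d1 : measure_display) (T1 : measurableType d1) (I1 : finType)
    (X : I1 -> {RV P >-> T1})
    (d2 : measure_display) (T2 : measurableType d2) (I2 : finType)
    (Y : I2 -> {RV P >-> T2}) : Prop :=
  forall A B : set T, sigma_of X A -> sigma_of Y B ->
    P (A `&` B) = (P A * P B)%E.

(* A random variable is Weibull with shape parameter alpha when its law mu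
   satisfies this two-sided tail estimate. *)
Definition weibull_law (R : realType) (alpha : R) (mu : probability R R) :
    Prop :=
  exists C1 C2 : R, [/\ 0 < C1, 0 < C2 & forall t : R, 1 < t ->
    [/\ ((C1 / 2 * expR (- (t `^ alpha)))%:E <= mu [set x | (t <= x)%R])%E,
        (mu [set x | (t <= x)%R] <= (C2 / 2 * expR (- (t `^ alpha)))%:E)%E,
        ((C1 / 2 * expR (- (t `^ alpha)))%:E <= mu [set x | (x <= - t)%R])%E
      & (mu [set x | (x <= - t)%R] <= (C2 / 2 * expR (- (t `^ alpha)))%:E)%E]].

Definition upper_pairs (n : nat) : {set 'I_n * 'I_n} :=
  [set ij : 'I_n * 'I_n | (ij.1 < ij.2)%N]%SET.

(* [G i j w] says that {i, j} is an edge of the random graph at outcome w. *)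
Definition erdos_renyi (R : realType) (d : measure_display)
    (T : measurableType d) (P : probability T R) (n : nat) (p : R)
    (G : 'I_n -> 'I_n -> {RV P >-> bool}) : Prop :=
  [/\ forall i w, G i i w = false,
      forall i j w, G i j w = G j i w,
      forall i j : 'I_n, (i < j)%N ->
        distribution P (G i j) = bernoulli_prob p :> (set bool -> \bar R)
    & mutually_independent (upper_pairs n) (fun ij => G ij.1 ij.2)].

Definition adjacency_matrix (R : realType) (d : measure_display)
    (T : measurableType d) (P : probability T R) (n : nat)
    (G : 'I_n -> 'I_n -> {RV P >-> bool}) (w : T) : 'M[R]_n :=
  \matrix_(i, j) (G i j w)%:R.

Definition symmetric_iid (R : realType) (d : measure_display)
    (T : measurableType d) (P : probability T R) (n : nat)
    (mu : probability R R) (Y : 'I_n -> 'I_n -> {RV P >-> R}) : Prop :=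
  [/\ forall i w, Y i i w = 0,
      forall i j w, Y i j w = Y j i w,
      forall i j : 'I_n, (i < j)%N ->
        distribution P (Y i j) = mu :> (set R -> \bar R)
    & mutually_independent (upper_pairs n) (fun ij => Y ij.1 ij.2)].

Definition sparse_matrix (R : realType) (d : measure_display)
    (T : measurableType d) (P : probability T R) (n : nat)
    (G : 'I_n -> 'I_n -> {RV P >-> bool}) (Y : 'I_n -> 'I_n -> {RV P >-> R})
    (w : T) : 'M[R]_n :=
  \matrix_(i, j) (adjacency_matrix G w i j * Y i j w).

(* For symmetric A of size n > 0 the set of eigenvalues is finite and nonempty,
   so this supremum is attained. *)
Definition lambda1 (R : realType) (n : nat) (A : 'M[R]_n) : R :=
  sup [set a : R | eigenvalue A a].

(* Meaningful from n = 3 on, where ln (ln n) > 0. *)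
Definition lambda_light (R : realType) (alpha : R) (n : nat) : R :=
  2 `^ alpha^-1 * alpha `^ (- 2^-1) * (alpha - 2) `^ (2^-1 - alpha^-1) *
  (ln n%:R `^ 2^-1 / ln (ln n%:R) `^ (2^-1 - alpha^-1)).

(* Main.v *)
Require Import Defs.
From HB Require Import structures.
From mathcomp Require Import all_boot all_order all_algebra.
From mathcomp Require Import all_classical all_reals all_analysis.
From mathcomp Require Import measurable_realfun.
From mathcomp Require Import ring lra zify.

Set Implicit Arguments.
Unset Strict Implicit.
Unset Printing Implicit Defensive.

Import Order.TTheory GRing.Theory Num.Theory.
Import numFieldNormedType.Exports.

(** Write [x = ln n], [l = ln x] and [L = x / l], the order of the maximal
    degree, so that [lambda_light] equals [c0 * x ^ (1/alpha) * L ^ (1/2 - 1/alpha)].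
    A vertex with [k] neighbours costs a factor of about [k! ~ exp (k l)] in
    probability, and giving its [k] labels squared length [t ^ 2] costs least when
    they are all equal, namely [exp (k (t ^ 2 / k) ^ (alpha / 2))].  With
    [t = tau * lambda_light] and [k = kap * L] both costs are powers of [n]
    ([even_cost]), and minimising their product over [kap] gives [n ^ (tau ^ 2)]
    ([tradeoff]).  As there are [n] vertices, a star with row norm at least
    [tau * lambda_light] exists with probability [n ^ (1 - tau ^ 2 + o(1))], and
    the theorem says that such a star is the only efficient way to make [lambda1]
    large.

    Upper bound.  Call a vertex a hub if its degree exceeds a small multiple of
    [L].  The edges split into three kinds ([qform_stars_bound]).  Edges from a
    hub to a vertex with no other hub neighbour form disjoint stars, whose norm
    is the largest row norm; [row_bound] controls it with the sharp exponent.
    Edges between two non-hubs have small norm: the graph is degenerate with a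
    constant, so the norm is at most a constant times the largest row norm
    outside the hubs, and short rows are extremely unlikely to be long vectors.
    The remaining crossing edges have bounded degree, because many of them at
    one vertex would force a small connected set with a long boundary or with
    many cycles ([crossing_or_dense]); as a single label is at most a multiple
    of [x ^ (1/alpha)], which is of smaller order than [lambda_light] because
    [alpha > 2], they do not matter either.  All the exceptional subgraphs have
    the shape of [dense_spot] and are excluded by one union bound,
    [dense_spot_bound].

    Lower bound.  Centres are taken in one half of the vertices and leaves in
    the other.  A star with the optimal number of equally large labels, made
    clean by removing the outcomes on which another star is present or two
    leaves are adjacent, forces [lambda1] to be large through a test vector; the
    clean stars are disjoint events, so their probabilities add up.

    The quantity [lambda1] is handled through Rayleigh quotients, using that the
    maximum of the quadratic form on the unit sphere is an eigenvalue. *)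

Local Open Scope ring_scope.

(** * Quadratic forms of sparse graphs *)

Section Decomposition.
Variables (R : realType) (n : nat).
Variable w : 'I_n -> 'I_n -> R.
Hypothesis symw : forall i j, w i j = w j i.
Implicit Types (x : 'I_n -> R) (B : {set 'I_n}).

Lemma weighted_young (a b c t : R) : 0 < c -> t * a * b *+ 2 <= t ^+ 2 / c * a ^+ 2 + c * b ^+ 2.
Proof.
move=> c0; rewrite -subr_ge0.
have -> : t ^+ 2 / c * a ^+ 2 + c * b ^+ 2 - t * a * b *+ 2 = (t * a - c * b) ^+ 2 / c.
  by field; rewrite gt_eqF.
by rewrite divr_ge0 ?sqr_ge0// ltW.
Qed.

(** Charging each edge [2 w a b <= w ^ 2 / rho * a ^ 2 + rho * b ^ 2] costs a
    centre its squared row norm over [rho], and a leaf [rho] once. *)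
Lemma stars_qform (E : rel 'I_n) (rho : R) x :
  0 < rho -> (forall i, \sum_j w i j ^+ 2 <= rho ^+ 2) ->
  (forall i i' j, E i j -> E i' j -> i = i') ->
  (forall i j k, E i j -> E j k -> false) ->
  (\sum_i \sum_(j | E i j) w i j * x i * x j) *+ 2 <= rho * \sum_i x i ^+ 2.
Proof.
move=> rho0 row inE out.
apply: (@le_trans _ _ (\sum_i (\sum_(j | E i j) w i j ^+ 2 / rho * x i ^+ 2 +
   \sum_(j | E j i) rho * x i ^+ 2))).
  rewrite big_split /= [X in _ <= _ + X](exchange_big_dep predT)//=.
  rewrite -big_split /= -sumrMnl; apply: ler_sum => i _.
  rewrite -big_split /= -sumrMnl; apply: ler_sum => j _; exact: weighted_young.
rewrite mulr_sumr; apply: ler_sum => i _; rewrite -mulr_suml -mulr_suml.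
have [/existsP[k Eki]|/existsPn nE] := boolP [exists k, E k i].
  rewrite big_pred0 ?mul0r ?add0r; last first.
    by move=> j; apply/negP => Eij; have := out _ _ _ Eki Eij.
  rewrite (big_pred1 k) // => j /=; apply/idP/eqP => [Eji|->//].
  exact: inE Eji Eki.
rewrite [X in _ + X]big_pred0 ?addr0; last by move=> j; apply/negbTE/nE.
rewrite ler_wpM2r ?sqr_ge0// ler_pdivrMr// -expr2.
apply: le_trans (row i); rewrite [leRHS](bigID (E i)) /= lerDl.
by apply: sumr_ge0 => j _; exact: sqr_ge0.
Qed.

(** Peeling off vertices of small degree one at a time orients the graph so
    that each vertex pays for boundedly many edges. *)
Lemma degenerate_qform (g : rel 'I_n) (q : nat) (sigma : R) x B :
  0 < sigma -> (forall i, g i i = false) -> (forall i j, ~~ g i j -> w i j = 0) ->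
  (forall B', B' \subset B -> B' != finset.set0 ->
     exists2 v, v \in B' & (#|[set u in B' | g v u]| <= q)%N) ->
  \sum_(i in B) \sum_(j in B) w i j * x i * x j <=
  \sum_(i in B) (sigma * q%:R + (\sum_(j in B) w i j ^+ 2) / sigma) * x i ^+ 2.
Proof.
move=> s0 irr wg; have [m] := ubnP #|B|; elim: m B => // m IH B Bm deg.
have [->|B0] := eqVneq B finset.set0; first by rewrite !big_set0.
have [v vB Nv] := deg B (subxx _) B0.
have wvv : w v v = 0 by apply: wg; rewrite irr.
pose C := B :\ v.
have CB : C \subset B by rewrite subD1set.
rewrite (cardsD1 v B) vB in Bm; move/(_ C Bm) in IH.
have {}IH := IH (fun B' B'C => deg B' (fintype.subset_trans B'C CB)).
rewrite (big_setD1 v)//= (big_setD1 v vB) /= wvv !mul0r add0r.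
rewrite [X in _ + X <= _](_ : _ = \sum_(i in C) (w v i * x v * x i) +
    \sum_(i in C) \sum_(j in C) w i j * x i * x j); last first.
  rewrite -big_split /=; apply: eq_bigr => i iC.
  by rewrite (big_setD1 v vB) /= symw; congr (_ + _); rewrite mulrAC.
rewrite addrA -mulr2n (big_setD1 v vB) /=.
have key : (\sum_(i in C) w v i * x v * x i) *+ 2 <=
    sigma * q%:R * x v ^+ 2 + \sum_(i in C) w v i ^+ 2 / sigma * x i ^+ 2.
  apply: (@le_trans _ _ (\sum_(i in C) ((if g v i then sigma * x v ^+ 2 else 0)
       + w v i ^+ 2 / sigma * x i ^+ 2))).
    rewrite -sumrMnl; apply: ler_sum => i _; case: ifP => gvi.
      by rewrite mulrAC addrC weighted_young.
    by rewrite wg ?gvi// expr0n !mul0r mul0rn addr0.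
  rewrite big_split /= lerD2r -big_mkcondr /= sumr_const -[leLHS]mulr_natr.
  rewrite [leRHS]mulrAC; apply: ler_wpM2l.
    by rewrite mulr_ge0 ?sqr_ge0// ltW.
  rewrite ler_nat.
  apply: leq_trans Nv; apply: subset_leq_card; apply/fintype.subsetP => i.
  by rewrite !inE => /andP[/(fintype.subsetP CB) -> ->].
apply: le_trans (lerD key IH) _.
rewrite mulrDl -!addrA; apply: lerD => //.
apply: (@le_trans _ _ (\sum_(i in C) (sigma * q%:R + (\sum_(j in B) w i j ^+ 2) / sigma) * x i ^+ 2)).
  rewrite -big_split /=; apply: ler_sum => i iC.
  rewrite [in leRHS](big_setD1 v vB) /= (symw i v) -/C.
  by rewrite le_eqVlt; apply/orP; left; apply/eqP; ring.
rewrite lerDr mulr_ge0 ?sqr_ge0// divr_ge0 ?(ltW s0)//.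
by apply: sumr_ge0 => j _; exact: sqr_ge0.
Qed.

Lemma bounded_degree_qform (F : rel 'I_n) (K : nat) (M : R) x :
  symmetric F -> (forall i, (#|[set j | F i j]| <= K)%N) ->
  (forall i j, F i j -> w i j <= M) -> 0 <= M -> (forall i, 0 <= x i) ->
  \sum_i \sum_(j | F i j) w i j * x i * x j <= K%:R * M * \sum_i x i ^+ 2.
Proof.
move=> symF degF wM M0 x0.
apply: (@le_trans _ _ (\sum_i \sum_(j | F i j) (M / 2 * x i ^+ 2 + M / 2 * x j ^+ 2))).
  apply: ler_sum => i _; apply: ler_sum => j Fij.
  apply: (@le_trans _ _ (M * (x i * x j))).
    by rewrite -mulrA ler_wpM2r ?mulr_ge0// wM.
  have : 0 <= (x i - x j) ^+ 2 by exact: sqr_ge0.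
  nra.
under eq_bigr do rewrite big_split /=.
rewrite big_split /= [X in _ + X](exchange_big_dep predT)//=.
rewrite -big_split mulr_sumr; apply: ler_sum => i _ /=.
rewrite [X in _ + X](eq_bigl (F i)) => [|j]; last exact: symF.
rewrite sumr_const -mulr2n -mulrnA -[leLHS]mulr_natr.
have -> : K%:R * M * x i ^+ 2 = (M / 2 * x i ^+ 2) * (K * 2)%:R.
  by rewrite natrM; field.
apply: ler_wpM2l; first by rewrite mulr_ge0 ?sqr_ge0// divr_ge0.
rewrite ler_nat leq_mul2r /=.
by apply: leq_trans (degF i); rewrite cardsE.
Qed.

End Decomposition.

(** * The star decomposition *)

Section Combinatorics.
Import mathcomp.boot.fintype mathcomp.boot.finset.

Definition star_edge n (g : rel 'I_n) (H : {set 'I_n}) : rel 'I_n :=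
  fun h u => [&& g h u, h \in H, u \notin H &
                [forall h' in H, g h' u ==> (h' == h)]].

Definition crossing_edge n (g : rel 'I_n) (H : {set 'I_n}) : rel 'I_n :=
  fun i j => [&& g i j, (i \in H) || (j \in H),
                 ~~ star_edge g H i j & ~~ star_edge g H j i].

(** With [H] the hubs, every edge joins two non-hubs, is a star edge in one of
    its two directions, or is a crossing edge; each of the three parts has its
    own bound. *)
Lemma qform_stars_bound (R : realType) n (w : 'I_n -> 'I_n -> R) (g : rel 'I_n)
    (H : {set 'I_n}) (q K : nat) (rho sigma M : R) (x : 'I_n -> R) :
  (forall i j, 0 <= w i j) -> (forall i j, w i j = w j i) ->
  symmetric g -> (forall i, g i i = false) ->
  (forall i j, ~~ g i j -> w i j = 0) -> (forall i j, w i j <= M) ->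
  0 < rho -> 0 < sigma -> 0 <= M ->
  (forall B, B != set0 ->
     exists2 v, v \in B & (#|[set u in B | g v u]| <= q)%N) ->
  (forall i, \sum_j w i j ^+ 2 <= rho ^+ 2) ->
  (forall i, i \notin H -> \sum_j w i j ^+ 2 <= sigma ^+ 2) ->
  (forall i, (#|[set j | crossing_edge g H i j]| <= K)%N) ->
  (forall i, 0 <= x i) ->
  \sum_i \sum_j w i j * x i * x j <=
  (rho + sigma * (q.+1)%:R + K%:R * M) * \sum_i x i ^+ 2.
Proof.
move=> w0 symw symg irr wg wM rho0 sigma0 M0 degen row rowH degF x0.
pose S := star_edge g H; pose F := crossing_edge g H; pose B := ~: H.
have symF : symmetric F.
  move=> i j; rewrite /F /crossing_edge symg orbC; congr (_ && _).
  by congr (_ && _); rewrite andbC.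
have wxx0 i j : 0 <= w i j * x i * x j by rewrite !mulr_ge0.
have split_w i : \sum_j w i j * x i * x j <=
    (if i \in B then \sum_(j in B) w i j * x i * x j else 0) +
    (\sum_(j | S i j) w i j * x i * x j + \sum_(j | S j i) w i j * x i * x j) +
    \sum_(j | F i j) w i j * x i * x j.
  have -> : (if i \in B then \sum_(j in B) w i j * x i * x j else 0) =
     \sum_(j | (i \in B) && (j \in B)) w i j * x i * x j.
    by case: (i \in B) => //=; rewrite big_pred0.
  rewrite [X in _ <= X + _ + _]big_mkcond [X in _ <= _ + (X + _) + _]big_mkcond.
  rewrite [X in _ <= _ + (_ + X) + _]big_mkcond [X in _ <= _ + X]big_mkcond.
  rewrite -!big_split; apply: ler_sum => j _ /=.
  have nn (b : bool) : 0 <= if b then w i j * x i * x j else 0 by case: b.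
  have [gij|/wg ->] := boolP (g i j); last first.
    by rewrite !mul0r !if_same !addr0.
  have := nn ((i \in B) && (j \in B)); have := nn (S i j).
  have := nn (S j i); have := nn (F i j); have := wxx0 i j.
  have [iBj|iBj] := boolP ((i \in B) && (j \in B)); first by move=> /=; lra.
  have [Sij|Sij] := boolP (S i j); first by move=> /=; lra.
  have [Sji|Sji] := boolP (S j i); first by move=> /=; lra.
  suff -> : F i j by move=> /=; lra.
  rewrite /F /crossing_edge gij Sij Sji !andbT /=.
  by move: iBj; rewrite !inE negb_and !negbK.
apply: le_trans (ler_sum _ (fun i _ => split_w i)) _.
rewrite !big_split /= !mulrDl.
apply: lerD; last exact: bounded_degree_qform.
rewrite addrC; apply: lerD.
  have -> : \sum_i \sum_(j | S j i) w i j * x i * x j =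
            \sum_i \sum_(j | S i j) w i j * x i * x j.
    rewrite (exchange_big_dep predT)//=; apply: eq_bigr => i _.
    by apply: eq_bigr => j _; rewrite symw mulrAC.
  rewrite -mulr2n; apply: stars_qform => //.
    move=> i i' j /and4P[_ _ _ /forall_inP h] /and4P[gi'j i'H _ _].
    by apply/esym/eqP/(implyP (h _ i'H)).
  by move=> i j k /and4P[_ _ /negbTE jH _] /and4P[_]; rewrite jH.
rewrite -big_mkcond /=.
have low := degenerate_qform (B := B) symw x sigma0 irr wg (fun B' _ => degen B').
apply: le_trans low _.
apply: (@le_trans _ _ (\sum_(i in B) sigma * q.+1%:R * x i ^+ 2)).
  apply: ler_sum => i; rewrite inE => iH; rewrite ler_wpM2r ?sqr_ge0//.
  rewrite -natr1 mulrDr mulr1 lerD2l ler_pdivrMr// -expr2.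
  apply: le_trans (rowH _ iH).
  rewrite [leRHS](bigID [in B]) /= lerDl.
  by apply: sumr_ge0 => j _; exact: sqr_ge0.
rewrite -mulr_sumr; apply: ler_wpM2l; first by rewrite mulr_ge0// ltW.
rewrite [leRHS](bigID [in B]) /= lerDl.
by apply: sumr_ge0 => j _; exact: sqr_ge0.
Qed.

(** An oriented set of pairs contains no pair together with its reverse, so it
    names each of its edges once. *)
Definition oriented n (X : {set 'I_n * 'I_n}) :=
  [forall p in X, (p.2, p.1) \notin X].

(** Both [X] and [X'] must be exhibited, rather than edges merely counted, so
    that a union bound can run over the triples [(B, X, X')]. *)
Definition dense_spot n (g : rel 'I_n) (s a b : nat) : Prop :=
  exists B : {set 'I_n}, exists X X' : {set 'I_n * 'I_n},
    [/\ #|B| = s, X \subset setX B B, oriented X, #|X| = a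
      & [/\ X' \subset setX B (~: B), #|X'| = b
          & forall p, p \in X :|: X' -> g p.1 p.2]].

Lemma card_subset (T : finType) (A : {set T}) k :
  (k <= #|A|)%N -> exists2 C : {set T}, C \subset A & #|C| = k.
Proof.
elim: k => [|k IH] kA; first by exists set0; rewrite ?sub0set ?cards0.
have [C CA Ck] := IH (ltnW kA).
have : A :\: C != set0.
  by rewrite -card_gt0 cardsD (setIidPr CA) subn_gt0 Ck.
case/set0Pn => z /setDP[zA zC]; exists (z |: C).
  by rewrite subUset sub1set zA.
by rewrite cardsU1 zC Ck.
Qed.

Lemma oriented_subset n (X Y : {set 'I_n * 'I_n}) :
  Y \subset X -> oriented X -> oriented Y.
Proof.
move=> /subsetP YX /forall_inP oX; apply/forall_inP => p pY.
by apply: contra (oX p (YX _ pY)); exact: YX.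
Qed.

(** A set in which every vertex has more than [2 q] neighbours contains more
    than [q] edges per vertex. *)
Lemma degenerate_or_dense n (g : rel 'I_n) (q : nat) :
  symmetric g -> (forall i, g i i = false) ->
  (forall B : {set 'I_n}, B != set0 ->
     exists2 v, v \in B & (#|[set u in B | g v u]| <= q.*2)%N) \/
  exists2 s, (0 < s <= n)%N & dense_spot g s (q * s) 0.
Proof.
move=> symg irr.
have [|nd] := EM (forall B : {set 'I_n}, B != set0 ->
     exists2 v, v \in B & (#|[set u in B | g v u]| <= q.*2)%N); first by left.
right; move/existsNP: nd => [B /not_implyP[B0 nv]].
have dB v : v \in B -> (q.*2 < #|[set u in B | g v u]|)%N.
  by move=> vB; rewrite ltnNge; apply/negP => h; apply: nv; exists v.
pose X := [set p in setX B B | (p.1 < p.2)%N && g p.1 p.2].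
pose Y := [set p in setX B B | (p.2 < p.1)%N && g p.1 p.2].
have oX : oriented X.
  apply/forall_inP => -[i j]; rewrite !inE /= => /andP[_ /andP[ij _]].
  by rewrite ltnNge (ltnW ij) /= andbF.
have XY : #|X| = #|Y|.
  have sw : injective (fun p : 'I_n * 'I_n => (p.2, p.1)).
    by move=> [a b] [c d] [-> ->].
  rewrite -(card_imset _ sw); apply: eq_card => -[i j].
  rewrite !inE /=; apply/imsetP/andP => [[[a b]]|[/andP[iB jB] /andP[ij gij]]].
    by rewrite !inE /= => /andP[/andP[aB bB] /andP[ab gab]] [-> ->];
      rewrite aB bB ab symg.
  by exists (j, i); rewrite // !inE /= iB jB ij symg.
have tot : (q.*2 * #|B| <= #|X| + #|Y|)%N.
  have dXY : [disjoint X & Y].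
    rewrite -setI_eq0; apply/eqP/setP => -[i j]; rewrite !inE /=.
    by apply/negP => /andP[/andP[_ /andP[ij _]] /andP[_ /andP[ji _]]]; lia.
  rewrite -cardsUI (disjoint_setI0 dXY) cards0 addn0.
  have -> : #|X :|: Y| = (\sum_(i in B) #|[set u in B | g i u]|)%N.
    rewrite -sum1_card (partition_big (fun p => p.1) [in B]) /=.
      apply: eq_bigr => i iB; rewrite -sum1_card.
      rewrite (reindex_onto (fun u => (i, u)) (fun p => p.2)) /=.
        apply: eq_bigl => u; rewrite !inE /= iB !eqxx !andbT /=.
        case: (ltngtP i u) => [_|_|/val_inj ->]; rewrite ?andbF ?orbF //=.
        by rewrite irr andbF.
      by move=> [a b] /andP[_ /eqP <-].
    by move=> [i j]; rewrite !inE /= => /orP[] /andP[/andP[]].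
  rewrite mulnC -sum_nat_const; apply: leq_sum => i iB; exact/ltnW/dB.
have aX : (q * #|B| <= #|X|)%N by move: tot; rewrite -XY; lia.
have [X' X'X cX'] := card_subset aX.
exists #|B|; first by rewrite card_gt0 B0 -[leqRHS]card_ord max_card.
exists B, X', set0; split => //.
- apply: subset_trans X'X _; apply/subsetP => p.
  by rewrite inE => /andP[].
- exact: oriented_subset X'X oX.
split; rewrite ?sub0set ?cards0// => p; rewrite setU0 => /(subsetP X'X).
by rewrite inE => /and3P[].
Qed.

End Combinatorics.

Section Combinatorics.
Import mathcomp.boot.fintype mathcomp.boot.finset.

Lemma card_pairs (I J : finType) (A : {set I}) (f : I -> {set J}) :
  #|[set p : I * J | (p.1 \in A) && (p.2 \in f p.1)]| = (\sum_(i in A) #|f i|)%N.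
Proof.
rewrite -sum1_card (partition_big (fun p => p.1) [in A]) /=; last first.
  by move=> p; rewrite inE => /andP[].
apply: eq_bigr => i iA; rewrite -sum1_card.
rewrite (reindex_onto (fun u => (i, u)) (fun p => p.2)) /=; last first.
  by move=> [a b] /andP[_ /eqP <-].
by apply: eq_bigl => u; rewrite inE /= iA !eqxx !andbT.
Qed.

(** If some vertex carries many crossing edges, then choosing for each crossing
    neighbour a second hub explored from it yields a connected set [B]; it
    either has many more edges than a tree, or contains many hubs and hence has
    many edges leaving it. *)
Lemma crossing_or_dense n (g : rel 'I_n) (m m' K r a : nat) :
  symmetric g -> (forall i, g i i = false) ->
  let H := [set v | m <= #|[set u | g v u]|]%N in
  (m' + K.*2.+1 <= m)%N -> (r.*2 + a <= K)%N ->
  (forall i, (#|[set j | crossing_edge g H i j]| <= K)%N) \/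
  exists2 s, (0 < s <= K.*2.+1)%N &
    dense_spot g s (s.-1 + a) 0 \/ dense_spot g s s.-1 (r * m').
Proof.
move=> symg irr H mm' rK.
have [|nd] := EM (forall i, (#|[set j | crossing_edge g H i j]| <= K)%N); first by left.
right; move/existsNP: nd => [v /negP]; rewrite -ltnNge => /ltnW /card_subset.
case=> U UF cU.
pose phi u := if u \in H then u
              else odflt u [pick h | [&& h \in H, h != v & g h u]].
have FU u : u \in U -> g v u /\
    (u \in H \/ [/\ v \in H, u \notin H, phi u \in H, phi u != v & g (phi u) u]).
  move=> /(subsetP UF); rewrite inE => /and4P[gvu vuH nS _]; split=> //.
  have [uH|uH] := boolP (u \in H); [by left|right].
  have vH : v \in H by move: vuH; rewrite (negbTE uH) orbF.
  rewrite /phi (negbTE uH); case: pickP => [h /and3P[hH hv ghu]|no] //=.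
  move: nS; rewrite /star_edge gvu vH uH /= => /negP[]; apply/forall_inP => h hH.
  by apply/implyP => ghu; apply: contraFT (no h) => hv; rewrite hH hv ghu.
pose U' := U :\: H; pose W := phi @: U'.
have HU' u : u \in U' ->
    [/\ g v u, v \in H, u \notin H, phi u \in H & phi u != v /\ g (phi u) u].
  move=> /setDP[uU uH]; have [gvu [|[]]] := FU u uU; first by rewrite (negbTE uH).
  by [].
pose B := v |: (U :|: W).
have vU : v \notin U by apply/negP => /FU[]; rewrite irr.
pose X1 := [set (v, u) | u in U]; pose X2 := [set (u, phi u) | u in U'].
have cX1 : #|X1| = K by rewrite card_imset// => a1 b1 [].
have cX2 : #|X2| = #|U'| by rewrite card_imset// => a1 b1 [].
have U'U : {subset U' <= U} by move=> u /setDP[].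
have vX2 u : (v, u) \notin X2.
  by apply/negP => /imsetP[u' /U'U u'U [vu' _]]; rewrite vu' u'U in vU.
have X12 : [disjoint X1 & X2].
  rewrite -setI_eq0; apply/eqP/setP => -[i j]; rewrite !inE.
  by apply/negP => /andP[/imsetP[u uU [-> ->]]]; apply/negP/vX2.
have cX : #|X1 :|: X2| = (K + #|U'|)%N.
  by rewrite -cX1 -cX2 -cardsUI (disjoint_setI0 X12) cards0 addn0.
have oX : oriented (X1 :|: X2).
  apply/forall_inP => -[i j]; rewrite !inE /= => /orP[].
    move=> /imsetP[u uU [-> ->]]; rewrite negb_or; apply/andP; split.
      by apply/negP => /imsetP[u' u'U [uv _]]; rewrite -uv uU in vU.
    apply/negP => /imsetP[u' u'U' [uu' vphi]].
    by have [_ _ _ _ [/eqP]] := HU' _ u'U'; rewrite -vphi.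
  move=> /imsetP[u uU' [-> ->]]; have [_ _ uH _ [pv _]] := HU' _ uU'.
  rewrite negb_or; apply/andP; split.
    by apply/negP => /imsetP[u' u'U [pv' _]]; rewrite pv' eqxx in pv.
  apply/negP => /imsetP[u' u'U' [_ uu']].
  by have [_ _ _ pH _] := HU' _ u'U'; rewrite -uu' (negbTE uH) in pH.
have gX p : p \in X1 :|: X2 -> g p.1 p.2.
  rewrite inE => /orP[] /imsetP[u uU ->] /=; first by have [] := FU u uU.
  by rewrite symg; have [_ _ _ _ []] := HU' u uU.
have XB : X1 :|: X2 \subset setX B B.
  apply/subsetP => p; rewrite inE => /orP[] /imsetP[u uU ->]; rewrite !inE.
    by rewrite eqxx uU orbT.
  by rewrite (U'U _ uU) orbT /= (_ : phi u \in W) ?orbT// imset_f.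
have cW : (#|W| <= #|U'|)%N by exact: leq_imset_card.
have cU' : (#|U'| <= K)%N by rewrite -cU subset_leq_card// subsetDl.
have cB : (#|B| <= 1 + K + #|W|)%N.
  rewrite cardsU1 -addnA leq_add ?leq_b1//.
  by rewrite -cU -cardsUI leq_addr.
have B0 : (0 < #|B|)%N by rewrite card_gt0; apply/set0Pn; exists v; rewrite setU11.
have cB2 : (#|B| <= K.*2.+1)%N.
  apply: leq_trans cB _.
  by rewrite -addnn -[leqRHS]add1n addnA leq_add2l (leq_trans cW cU').
exists #|B|; first by rewrite B0 cB2.
have [exc|nexc] := leqP (#|W| + a) #|U'|.
  left.
  have [|X XX cX'] := @card_subset _ (X1 :|: X2) (#|B|.-1 + a)%N.
    by rewrite cX; lia.
  exists B, X, set0; split => //.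
  - exact: subset_trans XX XB.
  - exact: oriented_subset XX oX.
  by rewrite sub0set cards0; split=> // p; rewrite setU0 => /(subsetP XX)/gX.
right.
have [|X XX cX'] := @card_subset _ (X1 :|: X2) #|B|.-1; first by rewrite cX; lia.
pose X' := [set p in setX B (~: B) | g p.1 p.2].
have rH : (r <= #|B :&: H|)%N.
  have h1 : (#|U :&: H| <= #|B :&: H|)%N.
    by apply: subset_leq_card; rewrite setSI// subsetU// subsetUl orbT.
  have h2 : (#|W| <= #|B :&: H|)%N.
    apply: subset_leq_card; apply/subsetP => p pW; rewrite !inE pW !orbT /=.
    by case/imsetP: pW => u /HU'[_ _ _ pH _] ->; rewrite inE in pH.
  have := cardsID H U; rewrite cU -/U'; lia.
have cX'' : (r * m' <= #|X'|)%N.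
  have -> : #|X'| = (\sum_(i in B) #|[set u | g i u] :\: B|)%N.
    rewrite -card_pairs; apply: eq_card => -[i j] /=.
    by rewrite 2![in LHS]in_set [in RHS]in_set /= in_setD [in RHS]in_set in_setC andbA.
  rewrite (big_setID H) /=.
  apply: leq_trans (leq_addr _ _).
  apply: (@leq_trans (#|B :&: H| * m')%N); first by rewrite leq_mul2r rH orbT.
  rewrite -sum_nat_const; apply: leq_sum => i /setIP[_]; rewrite inE => iH.
  have := cardsID B [set u | g i u].
  have : (#|[set u | g i u] :&: B| <= #|B|)%N.
    by apply: subset_leq_card; exact: subsetIr.
  move: iH mm' cB2; clear; move: #|_| #|_| #|_| #|_| => a1 a2 a3 a4. lia.
have [Y YX cY] := card_subset cX''.
exists B, X, Y; split => //.
- exact: subset_trans XX XB.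
- exact: oriented_subset XX oX.
split=> //.
  apply: subset_trans YX _; apply/subsetP => p.
  by rewrite inE => /andP[].
move=> p /setUP[/(subsetP XX)/gX//|/(subsetP YX)].
by rewrite inE => /andP[].
Qed.

End Combinatorics.

Local Open Scope classical_set_scope.
Local Open Scope ring_scope.

(** * Rayleigh quotients and the largest eigenvalue *)

Definition qform (R : realType) (n : nat) (A : 'M[R]_n) (x : 'I_n -> R) : R :=
  \sum_i \sum_j A i j * x i * x j.

Lemma continuous_sumr (R : realType) (T : topologicalType) (I : finType) (f : I -> T -> R) :
  (forall i, continuous (f i)) -> continuous (fun x => \sum_i f i x).
Proof. by move=> fc; apply: continuous_big => //; exact: add_continuous. Qed.

Lemma qform_continuous (R : realType) n (A : 'M[R]_n) :
  continuous (fun x : 'rV[R]_n => qform A (x ord0)).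
Proof.
apply: continuous_sumr => i; apply: continuous_sumr => j x.
have h k : {for x, continuous (fun y : 'rV[R]_n => y ord0 k)}.
  exact: coord_continuous.
exact: (cvgM (cvgM (cvg_cst (A i j)) (h i)) (h j)).
Qed.

Lemma compact_sphere (R : realType) n :
  compact [set x : 'rV[R]_n | \sum_i x ord0 i ^+ 2 = 1].
Proof.
apply: bounded_closed_compact.
  exists 1; split => // M M1 x /= x1.
  rewrite /Num.norm /= mx_normrE; apply/bigmax_leP => /=; split.
    exact: ltW (lt_trans ltr01 M1).
  move=> [i j] _ /=; rewrite (ord1 i) (le_trans _ (ltW M1))//.
  rewrite -(@expr_le1 _ 2)// real_normK ?num_real// -x1 (bigD1 j)//= lerDl.
  by apply: sumr_ge0 => k _; rewrite sqr_ge0.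
pose f (x : 'rV[R]_n) := \sum_i x ord0 i ^+ 2.
have cf : continuous f.
  apply: continuous_sumr => i y.
  have h : {for y, continuous (fun y : 'rV[R]_n => y ord0 i)}.
    exact: coord_continuous.
  exact: (cvgM h h).
have -> : [set x : 'rV[R]_n | \sum_i x ord0 i ^+ 2 = 1] = f @^-1` [set x | x = 1] by [].
by apply: preimage_closed (@closed_eq R 1) => y _; exact: cf.
Qed.

Lemma qformD (R : realType) n (A : 'M[R]_n) (x z : 'I_n -> R) (e : R) :
  (forall i j, A i j = A j i) ->
  qform A (fun i => x i + e * z i) =
  qform A x + e * 2 * (\sum_j (\sum_i A i j * x i) * z j) + e ^+ 2 * qform A z.
Proof.
move=> symA.
have -> : e * 2 * (\sum_j (\sum_i A i j * x i) * z j) =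
    \sum_i \sum_j e * (A i j * x i * z j + A i j * z i * x j).
  under [RHS]eq_bigr do rewrite -mulr_sumr.
  rewrite -mulr_sumr -mulrA; congr (_ * _).
  under [RHS]eq_bigr do rewrite big_split.
  rewrite big_split /= exchange_big /=.
  under eq_bigr do rewrite mulr_suml.
  rewrite mulr_natl mulr2n; congr (_ + _).
  apply: eq_bigr => i _; apply: eq_bigr => j _.
  by rewrite symA mulrAC.
rewrite /qform mulr_sumr -!big_split /=; apply: eq_bigr => i _.
rewrite mulr_sumr -!big_split /=; apply: eq_bigr => j _; ring.
Qed.

Lemma qform_scale (R : realType) n (A : 'M[R]_n) (x : 'I_n -> R) (c : R) :
  qform A (fun i => c * x i) = c ^+ 2 * qform A x.
Proof.
rewrite /qform mulr_sumr; apply: eq_bigr => i _.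
by rewrite mulr_sumr; apply: eq_bigr => j _; ring.
Qed.

Lemma sqnorm_scale (R : realType) n (x : 'I_n -> R) (c : R) :
  \sum_i (c * x i) ^+ 2 = c ^+ 2 * \sum_i x i ^+ 2.
Proof. by rewrite mulr_sumr; apply: eq_bigr => i _; rewrite exprMn. Qed.

Lemma sqnorm_ge0 (R : realType) n (x : 'I_n -> R) : 0 <= \sum_i x i ^+ 2.
Proof. by apply: sumr_ge0 => i _; exact: sqr_ge0. Qed.

Lemma sqnorm_eq0 (R : realType) n (x : 'I_n -> R) :
  \sum_i x i ^+ 2 = 0 -> forall i, x i = 0.
Proof.
move=> /eqP; rewrite psumr_eq0 => [/allP h i|i _]; last exact: sqr_ge0.
by have := h i (mem_index_enum _); rewrite sqrf_eq0 => /eqP.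
Qed.

(** A maximiser of the quadratic form on the compact unit sphere is a critical
    point of the Rayleigh quotient, hence an eigenvector. *)
Lemma rayleigh_max (R : realType) n (A : 'M[R]_n) :
  (0 < n)%N -> (forall i j, A i j = A j i) ->
  exists2 M : R, eigenvalue A M &
    forall z : 'I_n -> R, qform A z <= M * \sum_i z i ^+ 2.
Proof.
case: n A => // n A _ symA.
have S0 : [set x : 'rV[R]_n.+1 | \sum_i x ord0 i ^+ 2 = 1] !=set0.
  exists (delta_mx ord0 ord0) => /=; rewrite big_ord_recl !mxE eqxx expr1n.
  by rewrite big1 ?addr0// => i _; rewrite !mxE /= expr0n.
have [u u1 maxu] := EVT_max_rV S0 (@compact_sphere R n.+1)
  (continuous_subspaceT (@qform_continuous R _ A)).
move: u1; rewrite inE /= => u1.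
set M := qform A (u ord0) in maxu.
have qM z : qform A z <= M * \sum_i z i ^+ 2.
  have [z0|z0] := eqVneq (\sum_i z i ^+ 2) 0.
    rewrite z0 mulr0 /qform big1// => i _; rewrite big1// => j _.
    by rewrite (sqnorm_eq0 z0 i) mulr0 mul0r.
  have zp : 0 < \sum_i z i ^+ 2 by rewrite lt0r z0 sqnorm_ge0.
  pose c := (Num.sqrt (\sum_i z i ^+ 2))^-1.
  have c2 : c ^+ 2 = (\sum_i z i ^+ 2)^-1 by rewrite exprVn sqr_sqrtr// ltW.
  have := maxu (\row_i (c * z i)).
  rewrite inE /= => /(_ _).
  have -> : qform A ((\row_i (c * z i)) ord0) = qform A (fun i => c * z i).
    by rewrite /qform; apply: eq_bigr => i _; apply: eq_bigr => j _; rewrite !mxE.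
  rewrite qform_scale c2 mulrC ler_pdivrMr//; apply.
  under eq_bigr do rewrite mxE.
  by rewrite sqnorm_scale c2 mulVf.
exists M => //.
pose r j := \sum_i A i j * u ord0 i - M * u ord0 j.
have rE e : 0 < e -> 2 * (\sum_j r j ^+ 2) <= e * (M * (\sum_j r j ^+ 2) - qform A r).
  move=> e0; have := qM (fun i => u ord0 i + e * r i).
  rewrite qformD// -/M.
  have -> : \sum_i (u ord0 i + e * r i) ^+ 2 =
     1 + e * 2 * (\sum_i u ord0 i * r i) + e ^+ 2 * \sum_i r i ^+ 2.
    rewrite -[X in _ = X + _ + _]u1 !mulr_sumr -!big_split /=; apply: eq_bigr => i _; ring.
  have -> : \sum_j r j ^+ 2 =
     \sum_j (\sum_i A i j * u ord0 i) * r j - M * \sum_j u ord0 j * r j.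
    by rewrite mulr_sumr -sumrB; apply: eq_bigr => j _; rewrite /r; ring.
  rewrite -subr_ge0 => h; rewrite -subr_ge0 -(pmulr_rge0 _ e0).
  by apply: le_trans h _; rewrite le_eqVlt; apply/orP; left; apply/eqP; ring.
have r0 : \sum_j r j ^+ 2 = 0.
  apply/eqP; rewrite eq_le sqnorm_ge0 andbT leNgt; apply/negP => a0.
  set a := \sum_j _ in a0 rE.
  pose C := M * a - qform A r.
  have C0 : 0 <= C by rewrite subr_ge0; exact: qM.
  have C1 : 0 < C + 1 by rewrite ltr_wpDl.
  have := rE _ (divr_gt0 a0 C1); rewrite -/C leNgt => /negP; apply.
  rewrite mulrAC ltr_pdivrMr//; nra.
apply/eigenvalueP; exists u.
  apply/rowP => j; rewrite !mxE.
  have /eqP := sqnorm_eq0 r0 j; rewrite subr_eq0 => /eqP <-.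
  by apply: eq_bigr => i _; rewrite (mulrC (A i j)); congr (_ * _).
apply: contra_eq_neq u1 => ->; rewrite big1 ?(eq_sym 0) ?oner_eq0// => i _.
by rewrite mxE expr0n.
Qed.

Lemma eigenvalue_le (R : realType) n (A : 'M[R]_n) (c a : R) :
  (forall x : 'I_n -> R, qform A x <= c * \sum_i x i ^+ 2) ->
  eigenvalue A a -> a <= c.
Proof.
move=> qc /eigenvalueP[v vA v0].
have vp : 0 < \sum_i v ord0 i ^+ 2.
  rewrite lt0r sqnorm_ge0 andbT; apply: contra_neq v0 => /sqnorm_eq0 v0.
  by apply/rowP => i; rewrite v0 mxE.
have := qc (v ord0); suff -> : qform A (v ord0) = a * \sum_i v ord0 i ^+ 2.
  by rewrite ler_pM2r.
rewrite /qform exchange_big /= mulr_sumr; apply: eq_bigr => j _.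
rewrite -mulr_suml expr2 mulrA; congr (_ * _).
have /matrixP /(_ ord0 j) := vA; rewrite !mxE => <-.
by apply: eq_bigr => i _; rewrite mulrC.
Qed.

Lemma lambda1_le (R : realType) n (A : 'M[R]_n) (c : R) :
  0 <= c -> (forall x : 'I_n -> R, qform A x <= c * \sum_i x i ^+ 2) ->
  lambda1 A <= c.
Proof.
move=> c0 qc; rewrite /lambda1.
have [->|/set0P E0] := eqVneq [set a : R | eigenvalue A a] set0.
  by rewrite sup0.
by apply: ge_sup => // a /=; exact: eigenvalue_le.
Qed.

Lemma qform_le_lambda1 (R : realType) n (A : 'M[R]_n) (x : 'I_n -> R) :
  (forall i j, A i j = A j i) -> qform A x <= lambda1 A * \sum_i x i ^+ 2.
Proof.
case: n A x => [|n] A x symA; first by rewrite /qform !big_ord0 mulr0.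
have [M MA qM] := rayleigh_max (ltn0Sn n) symA.
apply: le_trans (qM x) _; rewrite ler_wpM2r ?sqnorm_ge0//.
apply: ub_le_sup => //; exists M => a /=; exact: eigenvalue_le.
Qed.

Lemma lambda1_lip (R : realType) n (A B : 'M[R]_n) (e : R) :
  (0 < n)%N -> (forall i j, A i j = A j i) -> (forall i j, B i j = B j i) ->
  (forall i j, `|A i j - B i j| <= e) ->
  lambda1 A <= lambda1 B + n%:R * e.
Proof.
move=> n0 symA symB AB.
rewrite {1}/lambda1; apply: ge_sup.
  by have [M MA _] := rayleigh_max n0 symA; exists M.
move=> a /=; apply: eigenvalue_le => x.
have := qform_le_lambda1 x symB.
suff : qform A x - qform B x <= n%:R * e * \sum_i x i ^+ 2.
  by rewrite mulrDl; lra.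
rewrite /qform -sumrB.
apply: (@le_trans _ _ (\sum_i \sum_j e * ((x i ^+ 2 + x j ^+ 2) / 2))).
  apply: ler_sum => i _; rewrite -sumrB; apply: ler_sum => j _.
  have := AB i j; rewrite ler_norml => /andP[].
  have : 0 <= (x i - x j) ^+ 2 by exact: sqr_ge0.
  have : 0 <= (x i + x j) ^+ 2 by exact: sqr_ge0.
  set a1 := A i j; set b1 := B i j; nra.
set S := \sum_i x i ^+ 2.
have inner i : \sum_j e * ((x i ^+ 2 + x j ^+ 2) / 2) =
    e / 2 * n%:R * x i ^+ 2 + e / 2 * S.
  rewrite -mulr_sumr -mulr_suml big_split /= sumr_const card_ord -/S.
  by rewrite -[_ *+ n]mulr_natl; field.
under eq_bigr do rewrite inner.
rewrite big_split /= -mulr_sumr sumr_const card_ord -/S -[_ *+ n]mulr_natl.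
by rewrite le_eqVlt; apply/orP; left; apply/eqP; field.
Qed.

(** The largest eigenvalue is Lipschitz in the entries, so a superlevel set is
    a countable combination of events on the entries rounded to a grid. *)
Lemma measurable_lambda1_ge (R : realType) d (T : measurableType d) n
    (Z : T -> 'M[R]_n) (c : R) :
  (0 < n)%N -> (forall w i j, Z w i j = Z w j i) ->
  (forall i j, measurable_fun setT (fun w => Z w i j)) ->
  measurable [set w | c <= lambda1 (Z w)].
Proof.
move=> n0 symZ mZ.
pose N (k : nat) : R := k.+1%:R.
pose grid k (M : 'M[int]_n) : 'M[R]_n := \matrix_(i, j) ((M i j)%:~R / N k).
pose near k (M : 'M[int]_n) : set T :=
  \bigcap_(ij in [set: 'I_n * 'I_n])
    [set w | `|Z w ij.1 ij.2 - grid k M ij.1 ij.2| <= (N k)^-1].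
pose ok k (M : 'M[int]_n) :=
  (forall i j, M i j = M j i) /\ c <= lambda1 (grid k M) + n%:R * (N k)^-1.
have N0 k : 0 < N k by rewrite ltr0n.
have -> : [set w | c <= lambda1 (Z w)] =
    \bigcap_k \bigcup_(M in ok k) near k M.
  apply/seteqP; split => w /=.
    move=> cZ k _; pose M := \matrix_(i, j) Num.floor (N k * Z w i j) : 'M[int]_n.
    have symM i j : M i j = M j i by rewrite !mxE symZ.
    have nearM i j : `|Z w i j - grid k M i j| <= (N k)^-1.
      rewrite !mxE; set z := Z w i j.
      have -> : z - (Num.floor (N k * z))%:~R / N k =
          (N k * z - (Num.floor (N k * z))%:~R) / N k.
        by field; rewrite gt_eqF.
      have fl : (Num.floor (N k * z))%:~R <= N k * z by exact: floor_le.
      have fu : N k * z < (Num.floor (N k * z) + 1)%:~R by exact: floorD1_gt.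
      rewrite intrD in fu.
      have Ni : 0 <= (N k)^-1 by rewrite invr_ge0 ltW.
      rewrite normrM ger0_norm ?subr_ge0// ger0_norm//.
      by rewrite ler_piMl//; lra.
    exists M.
      split=> //; apply: le_trans cZ _.
      by apply: lambda1_lip => // i j; rewrite !mxE symZ.
    by move=> [i j] _ /=.
  move=> h.
  have {}h k : c <= lambda1 (Z w) + 2 * n%:R * (N k)^-1.
    have [M [symM cM] nM] := h k I.
    apply: le_trans cM _.
    have : lambda1 (grid k M) <= lambda1 (Z w) + n%:R * (N k)^-1.
      apply: lambda1_lip => // i j; first by rewrite !mxE symM.
      by rewrite distrC; exact: (nM (i, j)).
    move=> h'; apply: le_trans (lerD h' (lexx _)) _.
    by rewrite -addrA lerD2l -[2 * _ * _]mulrA [leRHS]mulr_natl mulr2n.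
  rewrite leNgt; apply/negP => lc.
  pose e := c - lambda1 (Z w).
  have e0 : 0 < e by rewrite subr_gt0.
  have := h (Num.truncn (2 * n%:R / e)).
  have : 2 * n%:R / e < N (Num.truncn (2 * n%:R / e)).
    by apply: truncnS_gt.
  rewrite ltr_pdivrMr// => h1 h2.
  have : e <= 2 * n%:R / N (Num.truncn (2 * n%:R / e)) by rewrite /e lerBlDl.
  by rewrite ler_pdivlMr//; lra.
apply: bigcapT_measurable => k; rewrite bigcup_mkcond.
apply: countable_bigcupT_measurable => [|M]; first exact: countableP.
case: ifP => _ //; apply: fin_bigcap_measurable => // -[i j] _ /=.
have mf : measurable_fun setT (fun w => `|Z w i j - grid k M i j|).
  apply: measurableT_comp; first exact: measurable_realfun.normr_measurable.
  by apply: measurable_funB; [exact: mZ|exact: measurable_cst].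
have := mf measurableT _ (measurable_itv `]-oo, (N k)^-1]).
by rewrite setTI (_ : _ @^-1` _ = [set w | `|Z w i j - grid k M i j| <= (N k)^-1])//;
  apply/seteqP; split => w /=; rewrite in_itv.
Qed.

(** * Independence of distinct edges *)

(** The representative of an edge in the index set of the independent families. *)
Definition upper_pair n (p : 'I_n * 'I_n) : 'I_n * 'I_n :=
  if (p.1 < p.2)%N then p else (p.2, p.1).

Lemma orientedP n (X : {set 'I_n * 'I_n}) :
  reflect (forall i j, (i, j) \in X -> (j, i) \notin X) (oriented X).
Proof.
apply: (iffP forall_inP) => [h i j ijX|h [i j] ijX]; first exact: h ijX.
exact: h ijX.
Qed.

Lemma upper_pair_inj n (X : {set 'I_n * 'I_n}) :
  oriented X -> {in X &, injective (@upper_pair n)}.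
Proof.
move=> /orientedP oX [i j] [k l] ijX klX; rewrite /upper_pair /=.
case: ifP => _; case: ifP => _ // [ki lj].
- by have := oX _ _ ijX; rewrite ki lj klX.
- by have := oX _ _ ijX; rewrite ki lj klX.
- by rewrite ki lj.
Qed.

Lemma upper_pairP n (X : {set 'I_n * 'I_n}) p :
  oriented X -> p \in X -> upper_pair p \in upper_pairs n.
Proof.
move=> /orientedP oX; case: p => i j ijX; rewrite /upper_pair inE /=.
case: ifP => //= /negbT; rewrite -leqNgt leq_eqVlt => /orP[/eqP/val_inj ji|//].
by have := oX _ _ ijX; rewrite -ji in ijX *; rewrite ijX.
Qed.

Section EdgeEvents.
Context (R : realType) (d : R) (mu : probability R R) (disp : measure_display)
  (T : measurableType disp) (P : probability T R) (n : nat)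
  (G : 'I_n -> 'I_n -> {RV P >-> bool}) (Y : 'I_n -> 'I_n -> {RV P >-> R}).
Hypothesis d0 : 0 < d.
Hypothesis dn : d <= n%:R.
Hypothesis hG : erdos_renyi (d / n%:R) G.
Hypothesis hY : symmetric_iid mu Y.
Hypothesis hGY : independent_families (fun ij : 'I_n * 'I_n => G ij.1 ij.2)
                                      (fun ij : 'I_n * 'I_n => Y ij.1 ij.2).

Definition edge_event (X : {set 'I_n * 'I_n}) (B : 'I_n * 'I_n -> set R) : set T :=
  [set w | forall p, p \in X -> G p.1 p.2 w /\ B p (Y p.1 p.2 w)].

Lemma edge_eventE X B : edge_event X B =
  \bigcap_(p in [set` X]) (G p.1 p.2 @^-1` [set true] `&` Y p.1 p.2 @^-1` B p).
Proof. by apply/seteqP; split => w h p /h. Qed.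

Lemma measurable_edge_event X B : (forall p, measurable (B p)) ->
  measurable (edge_event X B).
Proof.
move=> mB; rewrite edge_eventE; apply: fin_bigcap_measurable => // p _.
apply: measurableI; rewrite -[X in measurable X]setTI.
  exact: measurable_funPT.
exact: measurable_funPT.
Qed.

Lemma G_upper w p : G (upper_pair p).1 (upper_pair p).2 w = G p.1 p.2 w.
Proof. by case: hG => _ sG _ _; rewrite /upper_pair; case: ifP. Qed.

Lemma Y_upper w p : Y (upper_pair p).1 (upper_pair p).2 w = Y p.1 p.2 w.
Proof. by case: hY => _ sY _ _; rewrite /upper_pair; case: ifP. Qed.

Lemma sigma_of_bigcap (d' : measure_display) (T' : measurableType d')
    (X : 'I_n * 'I_n -> {RV P >-> T'}) (J : {set 'I_n * 'I_n})
    (B : 'I_n * 'I_n -> set T') : (forall p, measurable (B p)) ->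
  sigma_of X (\bigcap_(p in [set` J]) (X p @^-1` B p)).
Proof.
move=> mB; rewrite /sigma_of.
have : @measurable _ (g_sigma_algebraType
   (\bigcup_i preimage_set_system [set: T] (X i) measurable))
   (\bigcap_(p in [set` J]) (X p @^-1` B p)); last by [].
apply: fin_bigcap_measurable => // p _; apply: sub_sigma_algebra.
by exists p => //; exists (B p) => //; rewrite setTI.
Qed.

Lemma prob_edge (p : 'I_n * 'I_n) : p \in upper_pairs n ->
  P (G p.1 p.2 @^-1` [set true]) = (d / n%:R)%:E.
Proof.
rewrite inE => p12; case: hG => _ _ /(_ _ _ p12) lawG _.
transitivity (distribution P (G p.1 p.2) [set true]) => //; rewrite lawG.
rewrite bernoulli_probE.
  by rewrite /= !diracE mem_set//= memNset//= mule0 adde0 mule1.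
have n0 : 0 < n%:R :> R by exact: lt_le_trans d0 dn.
by rewrite divr_ge0 ?(ltW d0) ?(ltW n0)//= ler_pdivrMr// mul1r.
Qed.

Lemma prob_label (p : 'I_n * 'I_n) B : p \in upper_pairs n ->
  P (Y p.1 p.2 @^-1` B) = mu B.
Proof. by rewrite inE => p12; case: hY => _ _ /(_ _ _ p12) <-. Qed.

(** As [X] is oriented, [upper_pair] is injective on it, so its pairs name
    distinct members of the two independent families. *)
Lemma prob_edge_event (X : {set 'I_n * 'I_n}) B :
  oriented X -> (forall p, measurable (B p)) ->
  P (edge_event X B) = (\prod_(p in X) (d / n%:R * fine (mu (B p))))%:E.
Proof.
move=> oX mB.
pose X' := [set upper_pair p | p in X]%SET.
pose B' e := if e \in X then B e else B (e.2, e.1).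
have B'E p : p \in X -> B' (upper_pair p) = B p.
  move/orientedP in oX; case: p => i j ijX; rewrite /upper_pair /B' /=.
  by case: (i < j)%N; rewrite ?ijX//= (negbTE (oX _ _ ijX)).
have mB' e : measurable (B' e) by rewrite /B'; case: ifP.
have X'sub : X' \subset upper_pairs n.
  by apply/fintype.subsetP => e /imsetP[p pX ->]; exact: upper_pairP oX pX.
have -> : edge_event X B =
    (\bigcap_(e in [set` X']) (G e.1 e.2 @^-1` [set true])) `&`
    (\bigcap_(e in [set` X']) (Y e.1 e.2 @^-1` B' e)).
  apply/seteqP; split => w.
    move=> h; split => e /= /imsetP[p pX ->].
      by rewrite G_upper; have [] := h _ pX.
    by rewrite Y_upper B'E//; have [] := h _ pX.
  move=> [h1 h2] p pX; have pX' : upper_pair p \in X' by exact: imset_f.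
  split; first by rewrite -G_upper; exact: h1.
  by rewrite -Y_upper -(B'E _ pX); exact: h2.
rewrite hGY; last 2 first.
- exact: (@sigma_of_bigcap _ _ (fun ij => G ij.1 ij.2) X' (fun=> [set true])).
- exact: (@sigma_of_bigcap _ _ (fun ij => Y ij.1 ij.2) X' B').
case: hG => _ _ _ iG; case: hY => _ _ _ iY.
rewrite (iG X' (fun=> [set true]))// (iY X' B')//.
rewrite -big_split /= big_imset /=; last exact: upper_pair_inj.
rewrite -prodEFin; apply: eq_bigr => p pX.
have pU := upper_pairP oX pX.
rewrite prob_edge// prob_label// B'E// -[X in (_ * X)%E]fineK//.
by rewrite fin_num_measure.
Qed.

End EdgeEvents.

(** * Union bounds *)

Section OuterBound.
Context (R : realType) (disp : measure_display) (T : measurableType disp)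
  (P : probability T R).

(** Upper bounds on the outer probability of a set: union bounds then need no
    measurability bookkeeping. *)
Definition outer_le (S : set T) (c : R) : Prop :=
  exists S' : set T, [/\ measurable S', S `<=` S' & (P S' <= c%:E)%E].

Lemma outer_le_sub S S' c c' :
  outer_le S' c' -> S `<=` S' -> c' <= c -> outer_le S c.
Proof.
move=> [A [mA SA PA]] SS' cc'; exists A; split => //.
  exact: classical_sets.subset_trans SS' SA.
by apply: le_trans PA _; rewrite lee_fin.
Qed.

Lemma outer_le_set0 c : 0 <= c -> outer_le set0 c.
Proof. by move=> c0; exists set0; split => //; rewrite measure0 lee_fin. Qed.

Lemma outer_leU S1 S2 c1 c2 : outer_le S1 c1 -> outer_le S2 c2 ->
  outer_le (S1 `|` S2) (c1 + c2).
Proof.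
move=> [A1 [mA1 SA1 PA1]] [A2 [mA2 SA2 PA2]].
exists (A1 `|` A2); split; first exact: measurableU.
  exact: setUSS.
apply: le_trans (measureU2 _ mA1 mA2) _.
by rewrite EFinD leeD.
Qed.

Lemma outer_le_exists (I : finType) (A : pred I) (S : I -> set T) (c : I -> R) :
  (forall i, A i -> outer_le (S i) (c i)) ->
  outer_le [set w | exists2 i, A i & S i w] (\sum_(i | A i) c i).
Proof.
move=> h.
have hs (s : seq I) : outer_le [set w | exists2 i, (i \in s) && A i & S i w]
    (\sum_(i <- s | A i) c i).
  elim: s => [|a s IH].
    rewrite big_nil; apply: outer_le_sub (outer_le_set0 (lexx 0)) _ (lexx _).
    by move=> w [].
  rewrite big_cons; case: ifP => Aa.
    apply: outer_le_sub (outer_leU (h a Aa) IH) _ (lexx _) => w [i] + Si.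
    rewrite inE => /andP[/orP[/eqP <-|is_] Ai]; [by left|right].
    by exists i; rewrite ?is_.
  apply: outer_le_sub IH _ (lexx _) => w [i] + Si.
  rewrite inE => /andP[/orP[/eqP ia|is_] Ai]; first by rewrite -ia Ai in Aa.
  by exists i; rewrite ?is_.
apply: outer_le_sub (hs (index_enum I)) _ (lexx _) => w [i Ai Si].
by exists i; rewrite ?mem_index_enum.
Qed.

Lemma outer_le_exists_cst (I : finType) (A : pred I) (S : I -> set T) (N c : R) :
  0 <= c -> #|[set i | A i]%SET|%:R <= N -> (forall i, A i -> outer_le (S i) c) ->
  outer_le [set w | exists2 i, A i & S i w] (N * c).
Proof.
move=> c0 AN h; apply: outer_le_sub (outer_le_exists h) _ _ => //.
by rewrite sumr_const -mulr_natl ler_wpM2r// (le_trans _ AN)// cardsE.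
Qed.

Lemma outer_le_measurable S c : measurable S -> outer_le S c -> (P S <= c%:E)%E.
Proof. by move=> mS [A [mA SA PA]]; apply: le_trans PA; apply: le_measure; rewrite ?inE. Qed.

End OuterBound.

Lemma bin_le_pow (R : realType) (N k : nat) : 'C(N, k)%:R <= N%:R ^+ k / k`!%:R :> R.
Proof.
rewrite ler_pdivlMr ?ltr0n ?fact_gt0// -natrM bin_ffact -natrX ler_nat.
have -> : (N ^ k = \prod_(i < k) N)%N by rewrite prod_nat_const card_ord.
rewrite ffact_prod; apply: leq_prod => i _; exact: leq_subr.
Qed.

Lemma measurable_abs_powR_ge (R : realType) (alpha r : R) :
  measurable [set y : R | r <= `|y| `^ alpha].
Proof.
have mf : measurable_fun setT (fun y : R => `|y| `^ alpha).
  exact: (measurableT_comp (measurable_powR alpha) (@normr_measurable R setT)).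
have := mf measurableT _ (measurable_itv `[r, +oo[).
rewrite setTI (_ : _ @^-1` _ = [set y | r <= `|y| `^ alpha])//.
by apply/seteqP; split => x /=; rewrite in_itv/= andbT.
Qed.

Lemma weibull_tail (R : realType) (alpha : R) (mu : probability R R) :
  0 < alpha -> weibull_law alpha mu ->
  exists2 D0 : R, 0 < D0 & forall r, 0 <= r ->
    fine (mu [set y | r <= `|y| `^ alpha]) <= D0 * expR (- r).
Proof.
move=> a0 [C1 [C2 [C10 C20 tail]]]; exists (C2 + expR 1).
  by rewrite addr_gt0 ?expR_gt0.
have mge (t : R) : measurable [set x : R | t <= x].
  by rewrite (_ : [set x | _] = `[t, +oo[%classic) //;
    apply/seteqP; split => x /=; rewrite in_itv/= andbT.
have mle (t : R) : measurable [set x : R | x <= t].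
  by rewrite (_ : [set x | _] = `]-oo, t]%classic) //;
    apply/seteqP; split => x /=; rewrite in_itv.
have mabs r := measurable_abs_powR_ge alpha r.
move=> r r0; rewrite -lee_fin fineK ?fin_num_measure//.
have [r1|r1] := leP r 1.
  apply: le_trans (probability_le1 _ (mabs r)) _.
  rewrite lee_fin mulrDl -expRD (@le_trans _ _ (expR (1 - r)))//.
    by rewrite -[leLHS]expR0 ler_expR subr_ge0.
  by rewrite lerDr mulr_ge0 ?expR_ge0// ltW.
pose t := r `^ alpha^-1.
have ta : t `^ alpha = r by rewrite -powRrM mulVf ?gt_eqF// powRr1// ltW.
have t1 : 1 < t.
  have -> : 1 = 1 `^ alpha^-1 :> R by rewrite powR1.
  by rewrite gt0_ltr_powR ?invr_gt0 ?nnegrE// ltW.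
have [_ up _ lo] := tail t t1.
apply: (@le_trans _ _ (mu ([set x | t <= x] `|` [set x | x <= - t]))).
  apply: le_measure; [by rewrite inE|by rewrite inE; exact: measurableU|].
  move=> y /= ry; have : t <= `|y|.
    rewrite leNgt; apply/negP => yt; move: ry; rewrite leNgt => /negP; apply.
    by rewrite -ta gt0_ltr_powR// nnegrE// powR_ge0.
  by rewrite ler_normr => /orP[|]; [left|right; lra].
apply: le_trans (measureU2 _ (mge t) (mle (- t))) _.
apply: le_trans (leeD up lo) _; rewrite ta -EFinD lee_fin.
by rewrite -mulrDl -splitr mulrDl lerDl mulr_ge0 ?expR_ge0.
Qed.

Section EdgeUnionBounds.
Context (R : realType) (d : R) (mu : probability R R) (disp : measure_display)
  (T : measurableType disp) (P : probability T R) (n : nat)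
  (G : 'I_n -> 'I_n -> {RV P >-> bool}) (Y : 'I_n -> 'I_n -> {RV P >-> R}).
Hypothesis d0 : 0 < d.
Hypothesis dn : d <= n%:R.
Hypothesis hG : erdos_renyi (d / n%:R) G.
Hypothesis hY : symmetric_iid mu Y.
Hypothesis hGY : independent_families (fun ij : 'I_n * 'I_n => G ij.1 ij.2)
                                      (fun ij : 'I_n * 'I_n => Y ij.1 ij.2).
Let n0 : 0 < n%:R :> R. Proof. exact: lt_le_trans d0 dn. Qed.

Lemma outer_le_edge_event (X : {set 'I_n * 'I_n}) (B : 'I_n * 'I_n -> set R) (c : 'I_n * 'I_n -> R) :
  oriented X -> (forall p, measurable (B p)) ->
  (forall p, p \in X -> fine (mu (B p)) <= c p) ->
  outer_le P (edge_event G Y X B) (\prod_(p in X) (d / n%:R * c p)).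
Proof.
move=> oX mB Bc; exists (edge_event G Y X B); split => //.
  exact: measurable_edge_event.
rewrite (prob_edge_event d0 dn hG hY hGY)// lee_fin; apply: ler_prod => p pX.
have dn0 : 0 <= d / n%:R by rewrite divr_ge0// ltW.
by rewrite mulr_ge0 ?fine_ge0//= ler_wpM2l// Bc.
Qed.

(** The three factors count the sets [B], the inner edges [X] among [s ^ 2]
    pairs and the outer edges [X'] among [s * n] pairs; every edge contributes
    a further factor [d / n]. *)
Lemma dense_spot_bound (s a b : nat) :
  outer_le P [set w | dense_spot (fun i j => G i j w) s a b]
    (n%:R ^+ s / s`!%:R * (((s%:R ^+ 2 * d / n%:R) ^+ a / a`!%:R) *
                           ((s%:R * d) ^+ b / b`!%:R))).
Proof.
pose I := 'I_n; pose I2 : finType := (I * I)%type.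
have dn0 : 0 <= d / n%:R by rewrite divr_ge0// ltW.
have pos (x : R) k : 0 <= x -> 0 <= x ^+ k / k`!%:R.
  by move=> x0; rewrite divr_ge0 ?exprn_ge0.
have c0 : 0 <= (s%:R * n%:R) ^+ b / b`!%:R * (d / n%:R) ^+ (a + b) :> R.
  by apply: mulr_ge0; [apply: pos; rewrite mulr_ge0|exact: exprn_ge0].
have hBX (B : {set I}) (X : {set I2}) : #|B| == s -> [&& X \subset finset.setX B B, oriented X & #|X| == a] ->
    outer_le P [set w | exists2 X' : {set I2},
       (X' \subset finset.setX B (~: B)%SET) && (#|X'| == b) &
       edge_event G Y (X :|: X')%SET (fun=> setT) w]
     ((s%:R * n%:R) ^+ b / b`!%:R * (d / n%:R) ^+ (a + b)).
  move=> /eqP Bs /and3P[XB oX /eqP Xa]; apply: outer_le_exists_cst.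
  - exact: exprn_ge0.
  - apply: (@le_trans _ _ ('C(#|finset.setX B (~: B)%SET|, b)%:R)).
      by rewrite -cards_draws.
    apply: le_trans (bin_le_pow _ _ _) _; rewrite ler_wpM2r ?invr_ge0//.
    rewrite lerXn2r ?nnegrE// ?mulr_ge0// -natrM ler_nat cardsX Bs leq_mul2l.
    by rewrite -[X in (_ <= X)%N]card_ord max_card orbT.
  move=> X' /andP[X'B /eqP X'b].
  have dis : (X :&: X')%SET = finset.set0.
    apply/setP => -[p1 p2]; rewrite !inE.
    apply/negP => /andP[/(fintype.subsetP XB)/finset.setXP[_ p2B] /(fintype.subsetP X'B)].
    by move=> /finset.setXP[_]; rewrite inE p2B.
  have oXX' : oriented (X :|: X')%SET.
    apply/orientedP => i j; rewrite !inE => /orP[ijX|ijX'].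
      have [iB jB] := finset.setXP (fintype.subsetP XB _ ijX).
      rewrite negb_or (orientedP _ oX)//=; apply/negP => /(fintype.subsetP X'B).
      by move=> /finset.setXP[_]; rewrite inE iB.
    have [iB] := finset.setXP (fintype.subsetP X'B _ ijX'); rewrite inE => jB.
    rewrite negb_or; apply/andP; split; apply/negP.
      by move=> /(fintype.subsetP XB)/finset.setXP[]; rewrite (negbTE jB).
    by move=> /(fintype.subsetP X'B)/finset.setXP[]; rewrite (negbTE jB).
  have := @outer_le_edge_event (X :|: X')%SET (fun=> setT) (fun=> 1) oXX' (fun=> measurableT) _.
  rewrite prodr_const mulr1 (_ : #|_| = (a + b)%N); first by apply => p _; rewrite probability_setT.
  by rewrite -Xa -X'b -cardsUI dis cards0 addn0.
have hB (B : {set I}) : #|B| == s ->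
    outer_le P [set w | exists2 X : {set I2},
      [&& X \subset finset.setX B B, oriented X & #|X| == a] &
      exists2 X' : {set I2},
       (X' \subset finset.setX B (~: B)%SET) && (#|X'| == b) &
       edge_event G Y (X :|: X')%SET (fun=> setT) w]
     ((s%:R ^+ 2) ^+ a / a`!%:R * ((s%:R * n%:R) ^+ b / b`!%:R * (d / n%:R) ^+ (a + b))).
  move=> Bs; apply: outer_le_exists_cst.
  - exact: c0.
  - apply: (@le_trans _ _ ('C(#|finset.setX B B|, a)%:R)).
      rewrite -cards_draws ler_nat; apply: subset_leq_card.
      by apply/fintype.subsetP => X; rewrite !inE => /and3P[-> _ ->].
    by apply: le_trans (bin_le_pow _ _ _) _; rewrite cardsX (eqP Bs) natrM -expr2.
  by move=> X hX; exact: hBX.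
have {hBX}hB : outer_le P [set w | exists2 B : {set I}, #|B| == s & exists2 X : {set I2},
      [&& X \subset finset.setX B B, oriented X & #|X| == a] &
      exists2 X' : {set I2},
       (X' \subset finset.setX B (~: B)%SET) && (#|X'| == b) &
       edge_event G Y (X :|: X')%SET (fun=> setT) w]
     (n%:R ^+ s / s`!%:R * ((s%:R ^+ 2) ^+ a / a`!%:R * ((s%:R * n%:R) ^+ b / b`!%:R * (d / n%:R) ^+ (a + b)))).
  apply: outer_le_exists_cst => //.
  - by apply: mulr_ge0 => //; apply: pos; exact: sqr_ge0.
  - by rewrite card_draws card_ord; exact: bin_le_pow.
apply: outer_le_sub hB _ _.
  move=> w [B [X [X' [Bs XB oX Xa [X'B X'b h]]]]].
  exists B; first exact/eqP.
  exists X; first by rewrite XB oX Xa eqxx.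
  exists X'; first by rewrite X'B X'b eqxx.
  by move=> p /h.
rewrite le_eqVlt; apply/orP; left; apply/eqP; congr (_ * _).
have -> : s%:R ^+ 2 * d / n%:R = s%:R ^+ 2 * (d / n%:R) :> R by rewrite mulrA.
have -> : s%:R * d = s%:R * n%:R * (d / n%:R) :> R by field; rewrite gt_eqF.
have -> : (s%:R ^+ 2 * (d / n%:R)) ^+ a = (s%:R ^+ 2) ^+ a * (d / n%:R) ^+ a.
  exact: exprMn.
have -> : (s%:R * n%:R * (d / n%:R)) ^+ b = (s%:R * n%:R) ^+ b * (d / n%:R) ^+ b.
  exact: exprMn.
rewrite exprD; move: (_ ^+ a) (_ ^+ b) (_ ^+ a) (_ ^+ b) => x1 x2 x3 x4.
move: (_^-1) (_^-1) => u v; ring.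
Qed.

Lemma max_weight_bound (alpha D0 r : R) : 0 <= r -> 0 < D0 ->
  fine (mu [set y | r <= `|y| `^ alpha]) <= D0 * expR (- r) ->
  outer_le P [set w | exists i j, G i j w /\ r <= `|Y i j w| `^ alpha]
    (n%:R ^+ 2 * (d / n%:R * (D0 * expR (- r)))).
Proof.
move=> r0 D00 tail.
have mabs := measurable_abs_powR_ge alpha r.
have dn0 : 0 <= d / n%:R by rewrite divr_ge0// ltW.
apply: outer_le_sub (outer_le_exists_cst (I := ('I_n * 'I_n)%type) (A := fun p => p.1 != p.2)
  (S := fun p => edge_event G Y [set p]%SET (fun=> [set y | r <= `|y| `^ alpha]))
  (N := n%:R ^+ 2) (c := d / n%:R * (D0 * expR (- r))) _ _ _) _ (lexx _).
- by rewrite !mulr_ge0 ?expR_ge0// ltW.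
- rewrite -natrX ler_nat (leq_trans (max_card _))//.
  by rewrite card_prod card_ord mulnn.
- move=> p p12; have := @outer_le_edge_event [set p]%SET (fun=> [set y | r <= `|y| `^ alpha])
    (fun=> D0 * expR (- r)) _ (fun=> mabs) (fun _ _ => tail).
  rewrite big_set1; apply; apply/orientedP => i j.
  rewrite !inE => /eqP ijp; apply/negP => /eqP jip.
  by move: p12; rewrite -ijp in jip *; case: jip => -> _; rewrite eqxx.
move=> w [i [j [gij rij]]]; exists (i, j) => /=.
  by apply: contraTneq gij => ->; case: hG => ->.
by move=> p; rewrite inE => /eqP ->.
Qed.

End EdgeUnionBounds.

(** * Rows with a given number of entries *)

(** Sum the tangent inequality of [z `^ r] at the mean, which is an instance of
    Young's inequality. *)
Lemma power_mean (R : realType) (I : finType) (S : {set I}) (z : I -> R) (r t : R) :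
  1 < r -> (forall i, 0 <= z i) -> (0 < #|S|)%N -> 0 <= t ->
  t <= \sum_(i in S) z i ->
  #|S|%:R * (t / #|S|%:R) `^ r <= \sum_(i in S) z i `^ r.
Proof.
move=> r1 z0 S0 t0 tz; set k : R := #|S|%:R.
have k0 : 0 < k by rewrite ltr0n.
have r0 : 0 < r by lra.
set m := t / k.
have m0 : 0 <= m by rewrite divr_ge0// ltW.
have young1 i : z i * m `^ (r - 1) <= z i `^ r / r + m `^ r * (1 - r^-1).
  have qE : (r - 1) * (r / (r - 1)) = r by field; lra.
  have := @conjugate_powR R (z i) (m `^ (r - 1)) r (r / (r - 1)) (z0 i) (powR_ge0 _ _) r0 _ _.
  rewrite -powRrM qE invf_div.
  have -> : (r - 1) / r = 1 - r^-1 by field; lra.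
  by apply; [rewrite divr_gt0//; lra|ring].
have : t * m `^ (r - 1) <= \sum_(i in S) (z i `^ r / r + m `^ r * (1 - r^-1)).
  apply: (@le_trans _ _ (\sum_(i in S) z i * m `^ (r - 1))).
    by rewrite -mulr_suml ler_wpM2r ?powR_ge0.
  by apply: ler_sum => i _; exact: young1.
rewrite big_split /= sumr_const -mulr_suml -[_ *+ #|S|]mulr_natl -/k.
have -> : t * m `^ (r - 1) = k * m `^ r.
  have [->|mn0] := eqVneq m 0.
    by rewrite !powR0 ?mulr0//; lra.
  have -> : t = k * m by rewrite /m; field; rewrite gt_eqF.
  rewrite -mulrA; congr (_ * _); rewrite -{1}(powRr1 m0) -powRD.
    by congr (_ `^ _); ring.
  by rewrite mn0 implybT.
move=> h.
have : k * m `^ r / r <= (\sum_(i in S) z i `^ r) / r by lra.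
by rewrite ler_pM2r// invr_gt0.
Qed.

Lemma sum_expr_le (R : realType) (q : R) (m : nat) : 0 <= q -> q < 1 ->
  \sum_(j < m) q ^+ j <= (1 - q)^-1.
Proof.
move=> q0 q1; rewrite -[leRHS]mul1r ler_pdivlMr ?subr_gt0//.
have /= := subrX1 q m; have := exprn_ge0 m q0.
by set S := \sum_(j < m) _; nra.
Qed.

Section RowBound.
Context (R : realType) (d : R) (mu : probability R R) (disp : measure_display)
  (T : measurableType disp) (P : probability T R) (n : nat)
  (G : 'I_n -> 'I_n -> {RV P >-> bool}) (Y : 'I_n -> 'I_n -> {RV P >-> R}).
Hypothesis d0 : 0 < d.
Hypothesis dn : d <= n%:R.
Hypothesis hG : erdos_renyi (d / n%:R) G.
Hypothesis hY : symmetric_iid mu Y.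
Hypothesis hGY : independent_families (fun ij : 'I_n * 'I_n => G ij.1 ij.2)
                                      (fun ij : 'I_n * 'I_n => Y ij.1 ij.2).
Variables alpha D0 theta : R.
Hypothesis alpha2 : 2 < alpha.
Hypothesis D00 : 0 < D0.
Hypothesis tail : forall r, 0 <= r ->
  fine (mu [set y | r <= `|y| `^ alpha]) <= D0 * expR (- r).
Hypothesis theta0 : 0 < theta.
Hypothesis theta1 : theta < 1.

Let n0 : 0 < n%:R :> R. Proof. exact: lt_le_trans d0 dn. Qed.
Let dn0 : 0 <= d / n%:R. Proof. by rewrite divr_ge0// ltW. Qed.

Let C : R := (1 - expR (- (1 - theta)))^-1.

(** Exponential Markov inequality for the integer parts of the variables
    [|Y| `^ alpha], carried out as a finite sum over their possible values. *)
Lemma levels_bound (v : 'I_n) (S : {set 'I_n}) (M : nat) (s : R) :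
  v \notin S ->
  outer_le P [set w | exists2 f : {ffun 'I_n -> 'I_M.+1},
      (f \in pfamily ord0 (mem S) (fun=> predT)) && (s <= \sum_(u in S) (f u)%:R) &
      forall u, u \in S -> G v u w /\ (f u)%:R <= `|Y v u w| `^ alpha]
    (expR (- theta * s) * (d / n%:R * D0 * C) ^+ #|S|).
Proof.
move=> vS; pose X := [set (v, u) | u in S]%SET.
have pinj : {in S &, injective (fun u => (v, u))} by move=> a b _ _ [].
have oX : oriented X.
  apply/orientedP => i j /imsetP[u uS [-> ->]]; apply/negP => /imsetP[u' u'S [_ vu']].
  by rewrite vu' u'S in vS.
pose B (f : {ffun 'I_n -> 'I_M.+1}) (p : 'I_n * 'I_n) :=
  [set y : R | (f p.2)%:R <= `|y| `^ alpha].
have h1 (f : {ffun 'I_n -> 'I_M.+1}) : (f \in pfamily ord0 (mem S) (fun=> predT)) && (s <= \sum_(u in S) (f u)%:R) ->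
    outer_le P (edge_event G Y X (B f))
      (\prod_(u in S) (d / n%:R * (D0 * expR (- (f u)%:R)))).
  move=> _.
  have -> : \prod_(u in S) (d / n%:R * (D0 * expR (- (f u)%:R))) =
            \prod_(p in X) (d / n%:R * (D0 * expR (- (f p.2)%:R))).
    by rewrite big_imset.
  apply: (outer_le_edge_event d0 dn hG hY hGY (c := fun p => D0 * expR (- (f p.2)%:R))) => //.
    by move=> p; exact: measurable_abs_powR_ge.
  by move=> p _; apply: tail.
apply: outer_le_sub (outer_le_exists h1) _ _.
  move=> w [f hf h]; exists f => // p /imsetP[u uS ->] /=; exact: h.
apply: (@le_trans _ _ (expR (- theta * s) *
  \sum_(f in pfamily (ord0 : 'I_M.+1) (mem S) (fun=> predT))
     \prod_(u in S) (d / n%:R * D0 * expR (- (1 - theta)) ^+ (f u)))).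
  rewrite mulr_sumr big_mkcondr; apply: ler_sum => f _.
  have pr0 : 0 <= \prod_(u in S) (d / n%:R * D0 * expR (- (1 - theta)) ^+ (f u)).
    by apply: prodr_ge0 => u _; rewrite !mulr_ge0 ?exprn_ge0 ?expR_ge0// ltW.
  case: ifP => [sf|_]; last by rewrite mulr_ge0 ?expR_ge0.
  have -> : \prod_(u in S) (d / n%:R * (D0 * expR (- (f u)%:R))) =
    expR (- theta * \sum_(u in S) (f u)%:R) *
    \prod_(u in S) (d / n%:R * D0 * expR (- (1 - theta)) ^+ (f u)).
    rewrite mulr_sumr expR_sum -big_split /=; apply: eq_bigr => u _.
    have -> : expR (- (f u)%:R) =
        expR (- theta * (f u)%:R) * expR (- (1 - theta)) ^+ f u.
      by rewrite -expRM_natl -expRD; congr expR; ring.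
    ring.
  rewrite ler_wpM2r// ler_expR.
  by rewrite !mulNr lerN2 ler_wpM2l// ltW.
apply: ler_wpM2l; first exact: expR_ge0.
rewrite -(big_distr_big_dep _ (mem S) (fun=> predT)
  (fun u (j : 'I_M.+1) => d / n%:R * D0 * expR (- (1 - theta)) ^+ j)) /=.
rewrite -[leRHS]prodr_const; apply: ler_prod => u _.
have dD0 : 0 <= d / n%:R * D0 by rewrite mulr_ge0// ltW.
rewrite sumr_ge0/= => [|j _]; last by rewrite mulr_ge0 ?exprn_ge0 ?expR_ge0.
have q1 : expR (- (1 - theta)) < 1 by rewrite expR_lt1; move: theta1; lra.
by rewrite -mulr_sumr ler_wpM2l// sum_expr_le ?expR_ge0.
Qed.

Definition row_event (k : nat) (t : R) : set T :=
  [set w | exists v, #|[set u | G v u w]%SET| = k /\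
     t <= \sum_u (if G v u w then `|Y v u w| else 0) ^+ 2].

(** A choice of [k] neighbours costs [n ^ k / k`!] against [(d / n) ^ k]; by
    [power_mean] the labels must then satisfy a lower bound on the sum of
    [|Y| `^ alpha], whose tail is that of a sum of exponential variables.
    Rounding these down loses at most [k], which goes into the constant. *)
Lemma row_bound (k : nat) (t : R) : (0 < k)%N -> 0 <= t ->
  outer_le P (row_event k t)
   (n%:R * ((d * D0 * C * expR theta) ^+ k / k`!%:R *
      expR (- theta * (k%:R * (t / k%:R) `^ (alpha / 2))))).
Proof.
move=> k0 t0; set rhs := k%:R * _.
pose s := rhs - k%:R; pose M := (Num.truncn s).+1.
have sM : s <= M%:R by apply/ltW/truncnS_gt.
have C0 : 0 <= C by rewrite invr_ge0 subr_ge0 -[leRHS]expR0 ler_expR; move: theta1; lra.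
have dnC0 : 0 <= d / n%:R * D0 * C by rewrite !mulr_ge0// ltW.
have hv (v : 'I_n) : true -> outer_le P [set w | exists2 S : {set 'I_n}, (#|S| == k) && (v \notin S) &
    exists2 f : {ffun 'I_n -> 'I_M.+1},
      (f \in pfamily ord0 (mem S) (fun=> predT)) && (s <= \sum_(u in S) (f u)%:R) &
      forall u, u \in S -> G v u w /\ (f u)%:R <= `|Y v u w| `^ alpha]
    (n%:R ^+ k / k`!%:R * (expR (- theta * s) * (d / n%:R * D0 * C) ^+ k)).
  move=> _; apply: outer_le_exists_cst.
  - by rewrite mulr_ge0 ?expR_ge0 ?exprn_ge0.
  - apply: le_trans (bin_le_pow _ n k).
    have -> : 'C(n, k) = #|[set S : {set 'I_n} | #|S| == k]%SET|.
      by rewrite card_draws card_ord.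
    rewrite ler_nat.
    by apply: subset_leq_card; apply/fintype.subsetP => S; rewrite !inE => /andP[].
  by move=> S /andP[/eqP Sk vS]; rewrite -[X in _ ^+ X]Sk; exact: levels_bound.
apply: outer_le_sub (outer_le_exists_cst (N := n%:R) _ _ hv) _ _.
- by rewrite mulr_ge0 ?divr_ge0 ?exprn_ge0// mulr_ge0 ?expR_ge0 ?exprn_ge0.
- by rewrite -[X in _ <= X%:R](card_ord n) ler_nat max_card.
- move=> w [v [Sk row]]; exists v => //.
  set S := [set u | G v u w]%SET in Sk.
  have vS : v \notin S by rewrite inE; case: hG => ->.
  exists S; first by rewrite Sk eqxx vS.
  pose a u := minn (Num.truncn (`|Y v u w| `^ alpha)) M.
  have aM u : (a u < M.+1)%N by rewrite ltnS geq_minr.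
  pose f := [ffun u => if u \in S then Ordinal (aM u) else ord0].
  have fS u : u \in S -> f u = a u :> nat by move=> uS; rewrite ffunE uS.
  exists f; last first.
    move=> u uS; split; first by move: uS; rewrite inE.
    rewrite fS//; apply: (@le_trans _ _ (Num.truncn (`|Y v u w| `^ alpha))%:R).
      by rewrite ler_nat geq_minl.
    by rewrite truncn_le// powR_ge0.
  apply/andP; split.
    apply/pfamilyP; split => // ; apply/fintype.subsetP => u.
    by rewrite inE ffunE; case: ifP.
  have sumS : rhs <= \sum_(u in S) `|Y v u w| `^ alpha.
    rewrite /rhs -Sk.
    have -> : \sum_(u in S) `|Y v u w| `^ alpha =
        \sum_(u in S) (`|Y v u w| ^+ 2) `^ (alpha / 2).
      apply: eq_bigr => u _; rewrite -powR_mulrn// -powRrM.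
      by congr (_ `^ _); field.
    apply: power_mean => //; first by move: alpha2; lra.
    - by rewrite Sk.
    - apply: le_trans row _; rewrite le_eqVlt; apply/orP; left; apply/eqP.
      rewrite [RHS]big_mkcond; apply: eq_bigr => u _.
      by rewrite inE; case: ifP => // _; rewrite expr0n.
  have [/existsP[u /andP[uS uM]]|/existsPn small] :=
      boolP [exists u, (u \in S) && (M <= Num.truncn (`|Y v u w| `^ alpha))%N].
    apply: le_trans sM _; rewrite (bigD1 u)//= fS// /a (minn_idPr uM) lerDl.
    by apply: sumr_ge0.
  rewrite /s lerBlDr; apply: le_trans sumS _.
  rewrite -Sk -sumr_const -big_split /=; apply: ler_sum => u uS.
  have := small u; rewrite uS /= -ltnNge => um.
  by rewrite fS// /a (minn_idPl (ltnW um)) natr1 ltW// truncnS_gt.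
rewrite le_eqVlt; apply/orP; left; apply/eqP; congr (_ * _).
have -> : expR (- theta * s) = expR (- theta * rhs) * expR theta ^+ k.
  by rewrite -expRM_natl -expRD; congr expR; rewrite /s; ring.
have -> : d * D0 * C * expR theta = n%:R * (d / n%:R * D0 * C) * expR theta.
  by field; rewrite gt_eqF.
have -> : (n%:R * (d / n%:R * D0 * C) * expR theta) ^+ k =
   n%:R ^+ k * (d / n%:R * D0 * C) ^+ k * expR theta ^+ k.
  by rewrite -!exprMn.
move: (_ ^+ k) (_ ^+ k) (_ ^+ k) => x1 x2 x3; move: (k`!%:R^-1) => x4; ring.
Qed.

End RowBound.

(** * The optimal star *)

Definition light_const (R : realType) (alpha : R) : R :=
  2 `^ alpha^-1 * alpha `^ (- 2^-1) * (alpha - 2) `^ (2^-1 - alpha^-1).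

Section LightScale.
Context (R : realType) (alpha : R).
Hypothesis alpha2 : 2 < alpha.

Let alpha0 : 0 < alpha. Proof. by move: alpha2; lra. Qed.
Let c0 := light_const alpha.
Let gam := 2^-1 - alpha^-1 : R.

Lemma powR_expR (a y : R) : 0 < a -> a `^ y = expR (y * ln a).
Proof. by move=> a0; rewrite /powR gt_eqF. Qed.

Lemma light_const_gt0 : 0 < c0.
Proof. by rewrite !mulr_gt0 ?powR_gt0// subr_gt0. Qed.

Lemma gam_gt0 : 0 < gam.
Proof.
by rewrite subr_gt0 ltf_pV2 ?posrE.
Qed.

Lemma ln_light_const :
  ln c0 = alpha^-1 * ln 2 - 2^-1 * ln alpha + gam * ln (alpha - 2).
Proof.
have a2 : 0 < alpha - 2 by rewrite subr_gt0.
rewrite /c0 /light_const !lnM ?posrE ?mulr_gt0 ?powR_gt0//.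
by rewrite !ln_powR -/gam; ring.
Qed.

Lemma lambda_lightE (n : nat) (x l : R) : x = ln n%:R -> l = ln x ->
  0 < x -> 0 < l -> lambda_light alpha n = c0 * (x `^ alpha^-1 * (x / l) `^ gam).
Proof.
move=> xE lE x0 l0; rewrite /lambda_light -xE -lE -/gam -/c0; congr (_ * _).
rewrite !powR_expR ?divr_gt0// -expRN -!expRD; congr expR.
by rewrite lnM ?posrE ?invr_gt0// lnV ?posrE// /gam; field; rewrite gt_eqF.
Qed.

(** Spreading the squared length [(tau * lambda) ^ 2] evenly over [kap * L]
    labels costs [(tau * c0) ^ alpha * kap ^ (1 - alpha / 2)] in units of
    [ln n]. *)
Lemma even_cost (x l k tau : R) :
  0 < x -> 0 < l -> 0 < k -> 0 < tau ->
  k * ((tau * (c0 * (x `^ alpha^-1 * (x / l) `^ gam))) ^+ 2 / k) `^ (alpha / 2) =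
  (tau * c0) `^ alpha * (k / (x / l)) `^ (1 - alpha / 2) * x.
Proof.
move=> x0 l0 k0 tau0; have L0 : 0 < x / l by rewrite divr_gt0.
have c00 := light_const_gt0.
set lam := tau * _.
have lam0 : 0 < lam.
  by apply: mulr_gt0 => //; apply: mulr_gt0 => //; rewrite mulr_gt0 ?powR_gt0.
have lnlam : ln lam = ln tau + ln c0 + alpha^-1 * ln x + gam * ln (x / l).
  have xL0 : 0 < x `^ alpha^-1 * (x / l) `^ gam by rewrite mulr_gt0 ?powR_gt0.
  have cx0 : 0 < c0 * (x `^ alpha^-1 * (x / l) `^ gam) by apply: mulr_gt0.
  rewrite /lam (lnM tau0 cx0) (lnM c00 xL0) lnM ?posrE ?powR_gt0// !ln_powR.
  ring.
have lk0 : 0 < lam ^+ 2 / k by rewrite divr_gt0 ?exprn_gt0.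
have kL0 : 0 < k / (x / l) by rewrite divr_gt0.
have tc0 : 0 < tau * c0 by rewrite mulr_gt0.
rewrite -[LHS]lnK ?posrE ?mulr_gt0 ?powR_gt0//.
rewrite -[RHS]lnK ?posrE//; last first.
  by apply: mulr_gt0 => //; rewrite mulr_gt0 ?powR_gt0.
have l1 : ln (lam ^+ 2 / k) = 2 * ln lam - ln k.
  by rewrite ln_div ?posrE ?exprn_gt0// lnXn// mulr_natl.
have l2 : ln (k / (x / l)) = ln k - ln (x / l) by rewrite ln_div.
have l3 : ln (tau * c0) = ln tau + ln c0 by rewrite lnM.
congr expR; rewrite lnM ?posrE ?powR_gt0// ln_powR l1 lnlam.
have tcp : 0 < (tau * c0) `^ alpha by exact: powR_gt0.
have kp : 0 < (k / (x / l)) `^ (1 - alpha / 2) by exact: powR_gt0.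
rewrite (lnM (mulr_gt0 tcp kp) x0) (lnM tcp kp) !ln_powR l2 l3.
by rewrite (ln_div x0 l0) /gam; field; rewrite gt_eqF.
Qed.

(** The optimal trade-off between the number of labels and their sizes; the
    normalisation of [c0] makes the optimum equal to [1] when [tau = th = 1]. *)
Lemma tradeoff (kap tau th : R) : 0 < kap -> 0 < tau -> 0 < th ->
  th `^ (2 / alpha) * tau ^+ 2 <=
  kap + th * (tau * c0) `^ alpha * kap `^ (1 - alpha / 2).
Proof.
move=> kap0 tau0 th0; have c00 := light_const_gt0.
have a2 : 0 < alpha - 2 by rewrite subr_gt0.
set b := th * (tau * c0) `^ alpha.
have b0 : 0 < b by rewrite mulr_gt0// powR_gt0// mulr_gt0.
pose p := alpha / (alpha - 2); pose q := alpha / 2.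
have p0 : 0 < p by rewrite divr_gt0.
have q0 : 0 < q by rewrite divr_gt0.
have pq : p^-1 + q^-1 = 1 by rewrite /p /q; field; rewrite !gt_eqF.
have := @conjugate_powR R ((p * kap) `^ p^-1) ((q * (b * kap `^ (1 - q))) `^ q^-1)
   p q (powR_ge0 _ _) (powR_ge0 _ _) p0 q0 pq.
have kq0 : 0 < kap `^ (1 - q) by exact: powR_gt0.
have w1 : ((p * kap) `^ p^-1) `^ p = p * kap.
  by rewrite -powRrM mulVf ?gt_eqF// powRr1// ltW// mulr_gt0.
have w2 : ((q * (b * kap `^ (1 - q))) `^ q^-1) `^ q = q * (b * kap `^ (1 - q)).
  rewrite -powRrM mulVf ?gt_eqF// powRr1// ltW//.
  by apply: mulr_gt0 => //; exact: mulr_gt0.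
rewrite w1 w2.
have -> : p * kap / p = kap by field; rewrite gt_eqF.
have -> : q * (b * kap `^ (1 - q)) / q = b * kap `^ (1 - q) by field; rewrite gt_eqF.
move=> h; apply: le_trans h; rewrite le_eqVlt; apply/orP; left; apply/eqP.
have lp : ln p = ln alpha - ln (alpha - 2) by exact: (ln_div alpha0 a2).
have lq : ln q = ln alpha - ln 2 by exact: (ln_div alpha0 (ltr0n _ 2)).
have tc0 : 0 < tau * c0 by exact: mulr_gt0.
have lb : ln b = ln th + alpha * (ln tau + ln c0).
  by rewrite (lnM th0 (powR_gt0 _ tc0)) ln_powR (lnM tau0 c00).
have thp : 0 < th `^ (2 / alpha) by exact: powR_gt0.
have tau20 : 0 < tau ^+ 2 by exact: exprn_gt0.
have pk0 : 0 < p * kap by exact: mulr_gt0.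
have bk0 : 0 < b * kap `^ (1 - q) by exact: mulr_gt0.
have qb0 : 0 < q * (b * kap `^ (1 - q)) by exact: mulr_gt0.
rewrite -[LHS]lnK ?posrE; last exact: mulr_gt0.
rewrite -[RHS]lnK ?posrE; last by apply: mulr_gt0; exact: powR_gt0.
congr expR; rewrite (lnM thp tau20) (lnM (powR_gt0 _ pk0) (powR_gt0 _ qb0)).
rewrite lnXn// !ln_powR (lnM p0 kap0) (lnM q0 bk0) (lnM b0 kq0) ln_powR.
rewrite lp lq lb ln_light_const -[ln tau *+ 2]mulr_natl /gam /p /q.
by field; rewrite !gt_eqF.
Qed.

Lemma pow_fact_le_expR (y : R) (k : nat) : 0 <= y -> y ^+ k / k`!%:R <= expR y.
Proof.
case: k => [|k] y0.
  by rewrite expr0 fact0 divr1 -[leLHS]expR0 ler_expR.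
by apply: le_trans (expR_ge1Dxn k y0); rewrite lerDr.
Qed.

Lemma pow_fact_le (y : R) (k : nat) : 0 < y -> (0 < k)%N ->
  y ^+ k / k`!%:R <= expR (- (k%:R * (ln k%:R - 1 - ln y))).
Proof.
move=> y0 k0; have kR : 0 < k%:R :> R by rewrite ltr0n.
have := pow_fact_le_expR k (ltW kR).
rewrite -(@ler_pM2r _ ((y / k%:R) ^+ k)) ?exprn_gt0 ?divr_gt0//.
have -> : k%:R ^+ k / k`!%:R * (y / k%:R) ^+ k = y ^+ k / k`!%:R.
  rewrite mulrAC -exprMn; congr (_ ^+ _ / _).
  by field; rewrite gt_eqF.
move=> /le_trans; apply.
have -> : (y / k%:R) ^+ k = expR (k%:R * (ln y - ln k%:R)).
  by rewrite expRM_natl expRD expRN !lnK.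
by rewrite -expRD ler_expR le_eqVlt; apply/orP; left; apply/eqP; ring.
Qed.

(** Rows with few entries: an arbitrarily large exponent is reached once the
    number of entries is at most a small multiple of [ln n / ln (ln n)]. *)
Lemma low_row_exponent (D tau th E : R) : 0 < D -> 0 < tau -> 0 < th ->
  exists2 eps : R, 0 < eps & forall (x l lam : R) (k : nat),
    D <= x -> 0 < l -> (0 < k)%N -> k%:R <= eps * (x / l) ->
    lam = c0 * (x `^ alpha^-1 * (x / l) `^ gam) ->
    D ^+ k / k`!%:R * expR (- th * (k%:R * ((tau * lam) ^+ 2 / k%:R) `^ (alpha / 2)))
    <= expR (- (E * x)).
Proof.
move=> D0 tau0 th0; have c00 := light_const_gt0.
pose b := th * (tau * c0) `^ alpha.
have b0 : 0 < b by rewrite mulr_gt0// powR_gt0// mulr_gt0.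
pose E1 := `|E| + 1.
have E10 : 0 < E1 by rewrite ltr_wpDl.
pose r := alpha / 2 - 1.
have r0 : 0 < r by rewrite /r; move: alpha2; lra.
pose eps := (E1 / b) `^ (- r^-1).
have Eb : 0 < E1 / b by rewrite divr_gt0.
have eps0 : 0 < eps by rewrite powR_gt0.
exists eps => // x l lam k Dx l0 k0 kL ->.
have x0 : 0 < x by exact: lt_le_trans Dx.
have kR : 0 < k%:R :> R by rewrite ltr0n.
have L0 : 0 < x / l by rewrite divr_gt0.
rewrite even_cost//; set kap := k%:R / (x / l).
have kap0 : 0 < kap by rewrite divr_gt0.
have kape : kap <= eps by rewrite ler_pdivrMr.
have : E1 <= b * kap `^ (1 - alpha / 2).
  rewrite -ler_pdivrMl// mulrC.
  have -> : E1 / b = eps `^ (1 - alpha / 2).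
    rewrite /eps -powRrM.
    have -> : - r^-1 * (1 - alpha / 2) = 1 by rewrite /r; field; move: alpha2; lra.
    by rewrite powRr1// ltW.
  have -> : 1 - alpha / 2 = - r by rewrite /r; ring.
  rewrite !powRN lef_pV2 ?posrE ?powR_gt0//.
  by apply: ge0_ler_powR => //; rewrite ?nnegrE ltW.
move=> hE.
have h1 := pow_fact_le_expR k (ltW D0).
apply: (@le_trans _ _ (expR D * expR (- (E1 * x)))).
  apply: ler_pM; rewrite ?expR_ge0 ?divr_ge0 ?exprn_ge0 ?(ltW D0)//.
  rewrite ler_expR mulNr lerN2.
  have -> : th * ((tau * c0) `^ alpha * kap `^ (1 - alpha / 2) * x) =
            b * kap `^ (1 - alpha / 2) * x by rewrite /b; ring.
  by rewrite ler_wpM2r// ltW.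
rewrite -expRD ler_expR.
have : E * x <= `|E| * x by rewrite ler_wpM2r ?ler_norm// ltW.
by rewrite /E1; lra.
Qed.

(** Short rows are covered by [low_row_exponent].  For the others [ln k] is
    nearly [l], so that [1 / k`!] contributes [rho * kap * x] to the exponent and
    [tradeoff] applies. *)
Lemma row_exponent (D tau th rho E : R) :
  0 < D -> 0 < tau -> 0 < th -> 0 < rho -> rho < 1 ->
  E <= rho * (th `^ (2 / alpha) * tau ^+ 2) ->
  exists2 K : R, 0 < K & forall (x l lam : R) (k : nat),
    K <= x -> K <= l -> (0 < k)%N -> (1 + rho) / 2 * l <= ln (x / l) ->
    lam = c0 * (x `^ alpha^-1 * (x / l) `^ gam) ->
    D ^+ k / k`!%:R * expR (- th * (k%:R * ((tau * lam) ^+ 2 / k%:R) `^ (alpha / 2)))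
    <= expR (- (E * x)).
Proof.
move=> D0 tau0 th0 rho0 rho1 hE; have c00 := light_const_gt0.
have [eps eps0 low] := low_row_exponent E D0 tau0 th0.
pose K := D + 2 / (1 - rho) * (1 + `|ln D| + `|ln eps|) + 1.
have r1 : 0 < (1 - rho) by rewrite subr_gt0.
have q0 : 0 < 2 / (1 - rho) by rewrite divr_gt0.
have B0 : 0 <= 1 + `|ln D| + `|ln eps| by rewrite !addr_ge0.
have KD : D <= K by rewrite /K -addrA lerDl addr_ge0// mulr_ge0// ltW.
have K0 : 0 < K by exact: lt_le_trans KD.
exists K => // x l lam k Kx Kl k0 lnL lamE.
have x0 : 0 < x by exact: lt_le_trans Kx.
have l0 : 0 < l by exact: lt_le_trans Kl.
have kR : 0 < k%:R :> R by rewrite ltr0n.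
have L0 : 0 < x / l by rewrite divr_gt0.
have [kL|kL] := leP k%:R (eps * (x / l)).
  exact: (low x l lam k (le_trans KD Kx) l0 k0 kL lamE).
rewrite lamE even_cost//; set kap := k%:R / (x / l).
have kap0 : 0 < kap by rewrite divr_gt0.
have klE : k%:R * l = kap * x by rewrite /kap; field; rewrite !gt_eqF.
have lnk : rho * l <= ln k%:R - 1 - ln D.
  have : ln eps + ln (x / l) <= ln k%:R.
    have e0 : 0 < eps * (x / l) by exact: mulr_gt0.
    by rewrite -(lnM eps0 L0); have := ltW kL; rewrite -(ler_ln e0 kR).
  have : 1 + `|ln D| + `|ln eps| <= (1 - rho) / 2 * l.
    rewrite -ler_pdivrMl ?divr_gt0// invf_div; apply: le_trans Kl.
    by rewrite /K; set Q := _ * (1 + _ + _); move: D0; lra.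
  have := ler_norm (ln D); have := ler_norm (- ln eps); rewrite normrN.
  lra.
apply: (@le_trans _ _ (expR (- (rho * kap * x)) *
   expR (- th * ((tau * c0) `^ alpha * kap `^ (1 - alpha / 2) * x)))).
  rewrite ler_wpM2r ?expR_ge0//; apply: le_trans (pow_fact_le D0 k0) _.
  rewrite ler_expR lerN2 -mulrA -klE mulrCA; exact: ler_wpM2l.
rewrite -expRD ler_expR mulNr -opprD lerN2.
have -> : rho * kap * x + th * ((tau * c0) `^ alpha * kap `^ (1 - alpha / 2) * x) =
  (rho * kap + th * (tau * c0) `^ alpha * kap `^ (1 - alpha / 2)) * x by ring.
rewrite ler_wpM2r ?(ltW x0)//; apply: le_trans hE _.
apply: le_trans (ler_wpM2l (ltW rho0) (tradeoff kap0 tau0 th0)) _.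
rewrite mulrDr lerD2l.
have c1 : 0 <= th * (tau * c0) `^ alpha * kap `^ (1 - alpha / 2).
  by apply: mulr_ge0; [apply: mulr_ge0; [exact: ltW|exact: powR_ge0]|exact: powR_ge0].
by rewrite -[leRHS]mul1r ler_wpM2r// ltW.
Qed.

End LightScale.

(** * Exceptional events *)

Lemma near_ln_ge (R : realType) (M : R) : \forall n \near \oo, M <= ln n%:R.
Proof.
near=> n.
have nM : expR M <= n%:R by near: n; exact: nbhs_infty_ger.
have n0 : 0 < n%:R :> R by exact: lt_le_trans (expR_gt0 _) nM.
by rewrite -(expRK M) ler_ln ?posrE// expR_gt0.
Unshelve. all: by end_near. Qed.

Lemma log_scales_near (R : realType) (K eta : R) : 0 < eta -> eta < 1 ->
  \forall n \near \oo, let x := ln n%:R in let l := ln x in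
    [/\ K <= x, K <= l, K <= x / l & (1 - eta) * l <= ln (x / l)].
Proof.
move=> e0 e1; pose M := 1 + `|K| + (2 / eta) ^+ 2 + `|K| / (1 - eta).
have e1' : 0 < 1 - eta by rewrite subr_gt0.
have M1 : 0 <= `|K| / (1 - eta) by rewrite divr_ge0// ltW.
have M2 : 0 <= (2 / eta) ^+ 2 by exact: sqr_ge0.
near=> n.
have xM : expR M <= ln n%:R by near: n; exact: near_ln_ge.
move: xM; set x := ln n%:R; set l := ln x => xM; cbv zeta.
have x0 : 0 < x by exact: lt_le_trans (expR_gt0 _) xM.
have lM : M <= l by rewrite -(expRK M) ler_ln ?posrE// expR_gt0.
have KK := ler_norm K; have K0 := normr_ge0 K.
have l0 : 0 < l by apply: lt_le_trans lM; rewrite /M; move: M1 M2 K0; lra.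
have Kl : K <= l by apply: le_trans lM; rewrite /M; move: M1 M2 K0 KK; lra.
have lx : l <= x.
  by rewrite -[leRHS]lnK ?posrE// -/l; apply: le_trans (expR_ge1Dx _); rewrite lerDr.
have lnL : ln (x / l) = l - ln l by rewrite (ln_div x0 l0).
have lnl : ln l <= eta * l.
  have hsl : 2 / eta <= Num.sqrt l.
    rewrite -[leLHS]ger0_norm ?divr_ge0 ?(ltW e0)// -sqrtr_sqr ler_sqrt ?(ltW l0)//.
    by apply: le_trans lM; rewrite /M; move: M1 K0; lra.
  have s0 : 0 < Num.sqrt l by rewrite sqrtr_gt0.
  have E : ln l = 2 * ln (Num.sqrt l).
    by rewrite mulr_natl -lnXn// sqr_sqrtr// ltW.
  have h1 := ln_sublinear s0.
  have h2 : 2 * Num.sqrt l <= eta * Num.sqrt l * Num.sqrt l.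
    have : 2 <= Num.sqrt l * eta by rewrite -(ler_pdivrMr _ _ e0).
    by rewrite (mulrC eta) => h2; apply: ler_wpM2r => //; exact: ltW.
  have h3 : eta * Num.sqrt l * Num.sqrt l = eta * l.
    by rewrite -mulrA -expr2 sqr_sqrtr// ltW.
  by move: E h1 h2 h3; lra.
have lnLl : (1 - eta) * l <= ln (x / l) by rewrite lnL; lra.
have KL : K <= x / l.
  rewrite -[leRHS]lnK ?posrE ?divr_gt0//; apply: le_trans (expR_ge1Dx _).
  have : K <= (1 - eta) * l.
    rewrite mulrC -ler_pdivrMr//; apply: le_trans lM.
    apply: (@le_trans _ _ (`|K| / (1 - eta))); first by rewrite ler_wpM2r// invr_ge0 ltW.
    by rewrite /M; move: M2 K0; lra.
  by move: lnLl; rewrite -/x -/l; lra.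
by split; [exact: le_trans lx|..].
Unshelve. all: by end_near. Qed.

Section FailureProbabilities.
Context (R : realType) (d : R) (mu : probability R R) (disp : measure_display)
  (T : measurableType disp) (P : probability T R) (n : nat)
  (G : 'I_n -> 'I_n -> {RV P >-> bool}) (Y : 'I_n -> 'I_n -> {RV P >-> R}).
Hypothesis d0 : 0 < d.
Hypothesis dn : d <= n%:R.
Hypothesis hG : erdos_renyi (d / n%:R) G.
Hypothesis hY : symmetric_iid mu Y.
Hypothesis hGY : independent_families (fun ij : 'I_n * 'I_n => G ij.1 ij.2)
                                      (fun ij : 'I_n * 'I_n => Y ij.1 ij.2).

Let n0 : 0 < n%:R :> R. Proof. exact: lt_le_trans d0 dn. Qed.
Let g w : rel 'I_n := fun i j => G i j w.

(** For a set of [s] vertices the exponent is at least [q - 1] times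
    [s * (ln n - ln s + 1)], and this is at least [ln n] for all [s] up to [n]. *)
Lemma degenerate_fail (q A : nat) : (A.+2 <= q)%N -> 2 + ln d <= ln q%:R ->
  outer_le P [set w | exists2 s, (0 < s <= n)%N & dense_spot (g w) s (q * s) 0]
    (expR (- (A%:R * ln n%:R))).
Proof.
move=> Aq dq; set x := ln n%:R.
have n1 : 1 <= n%:R :> R by rewrite ler1n -(@ltr0n R).
have x0 : 0 <= x by rewrite ln_ge0.
have q0 : 0 < q%:R :> R by rewrite ltr0n (leq_trans _ Aq).
have hs (s : 'I_n.+1) : (0 < s)%N ->
    outer_le P [set w | dense_spot (g w) s (q * s) 0]
      (expR (- ((q%:R - 1) * x))).
  move=> s0; apply: outer_le_sub (dense_spot_bound d0 dn hG hY hGY s (q * s) 0) _ _ => //.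
  rewrite expr0 fact0 divr1 mulr1.
  have sR : 0 < s%:R :> R by rewrite ltr0n.
  have sn : s%:R <= n%:R :> R by rewrite ler_nat -ltnS.
  have y0 : 0 < s%:R ^+ 2 * d / n%:R :> R by rewrite divr_gt0// mulr_gt0// exprn_gt0.
  have lny : ln (s%:R ^+ 2 * d / n%:R) = 2 * ln s%:R + ln d - x.
    rewrite (ln_div (mulr_gt0 (exprn_gt0 2 sR) d0) n0).
    by rewrite (lnM (exprn_gt0 2 sR) d0) lnXn// mulr_natl.
  have qs0 : (0 < q * s)%N by rewrite muln_gt0 s0 (leq_trans _ Aq).
  apply: le_trans (ler_pM _ _ (pow_fact_le n0 s0) (pow_fact_le y0 qs0)) _.
  - by rewrite divr_ge0// exprn_ge0.
  - by rewrite divr_ge0// exprn_ge0// ltW.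
  rewrite -expRD ler_expR -opprD lerN2 lny natrM (lnM q0 sR) -/x.
  have lns : ln s%:R <= x by rewrite ler_ln ?posrE.
  have ls0 : 0 <= ln s%:R :> R by rewrite ln_ge0// ler1n.
  have ls1 : ln s%:R <= s%:R - 1 :> R.
    have s11 : 1 + (s%:R - 1) = s%:R :> R by ring.
    by rewrite -{1}s11; apply: le_ln1Dx; move: sR; lra.
  have s1 : 1 <= s%:R :> R by rewrite ler1n.
  have q1 : 1 <= q%:R :> R by rewrite ler1n (leq_trans _ Aq).
  have h1 : x <= s%:R * (x - ln s%:R + 1).
    have : 0 <= (s%:R - 1) * (x - ln s%:R) by rewrite mulr_ge0 ?subr_ge0.
    by move: ls1 ls0 s1 lns; nra.
  have h2 : (q%:R - 1) * x <= (q%:R - 1) * (s%:R * (x - ln s%:R + 1)).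
    by rewrite ler_wpM2l// subr_ge0.
  apply: le_trans h2 _.
  have h3 : 0 <= s%:R * q%:R * (ln q%:R - (2 + ln d)).
    by rewrite !mulr_ge0 ?subr_ge0// ltW.
  rewrite -subr_ge0; apply: le_trans h3 _.
  by rewrite le_eqVlt; apply/orP; left; apply/eqP; ring.
apply: outer_le_sub (outer_le_exists hs) _ _.
  move=> w [s /andP[s0 sn] h].
  by exists (Ordinal (sn : (s < n.+1)%N)).
rewrite big_mkcond big_ord_recl /= add0r sumr_const card_ord -[leLHS]mulr_natl.
rewrite -{1}(lnK n0) -expRD ler_expR -/x.
have : A.+2%:R <= q%:R :> R by rewrite ler_nat.
rewrite -addn2 natrD => Aq'.
have : (A%:R + 2) * x <= q%:R * x by rewrite ler_wpM2r.
lra.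
Qed.

(** A set of bounded size with as many inner edges as a tree costs [n]; each
    further inner edge gains a factor [1 / n], and the [b] outgoing edges gain [1 / b`!]. *)
Lemma crossing_fail (K' a b : nat) (A B : R) :
  1 <= B -> K'%:R ^+ 2 * d <= B -> K'%:R * d <= B -> (0 < b)%N ->
  A + 2 <= a%:R -> (A + 2) * ln n%:R <= b%:R * (ln b%:R - 1 - ln B) ->
  outer_le P [set w | exists2 s, (0 < s <= K')%N &
      dense_spot (g w) s (s.-1 + a) 0 \/ dense_spot (g w) s s.-1 b]
    (2 * K'%:R * B ^+ (K' + a) * expR (- ((A + 1) * ln n%:R))).
Proof.
move=> B1 KB1 KB2 b0 Aa Ab; set x := ln n%:R.
have n1 : 1 <= n%:R :> R by rewrite ler1n -(@ltr0n R).
have x0 : 0 <= x by rewrite ln_ge0.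
have B0 : 0 < B by exact: lt_le_trans B1.
have sB (s : nat) : (s <= K')%N -> s%:R ^+ 2 * d <= B.
  move=> sK; apply: le_trans KB1; rewrite ler_wpM2r ?(ltW d0)//.
  by rewrite lerXn2r ?nnegrE// ler_nat.
have invf (j : nat) (y : R) : 0 <= y -> y / j`!%:R <= y.
  by move=> y0; rewrite ler_pdivrMr ?ltr0n ?fact_gt0// ler_peMr// ler1n fact_gt0.
(* [n ^ s] choices of vertices against [s - 1 + j] edges *)
have tree (s j : nat) : (0 < s <= K')%N ->
    n%:R ^+ s / s`!%:R * ((s%:R ^+ 2 * d / n%:R) ^+ (s.-1 + j) / (s.-1 + j)`!%:R)
    <= B ^+ (K' + j) * expR ((1 - j%:R) * x).
  move=> /andP[s0 sK].
  have y0 : 0 <= s%:R ^+ 2 * d / n%:R :> R.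
    by rewrite divr_ge0 ?mulr_ge0 ?sqr_ge0 ?(ltW d0)// ltW.
  apply: (@le_trans _ _ (n%:R ^+ s * (B / n%:R) ^+ (s.-1 + j))).
    apply: ler_pM; rewrite ?divr_ge0 ?exprn_ge0 ?(ltW n0)//.
      exact/invf/exprn_ge0/ltW.
    apply: le_trans (invf _ _ (exprn_ge0 _ y0)) _.
    apply: lerXn2r; rewrite ?nnegrE//; first by rewrite divr_ge0 ?ltW.
    by apply: ler_wpM2r; [rewrite invr_ge0 ltW|exact: sB].
  have -> : n%:R ^+ s * (B / n%:R) ^+ (s.-1 + j) =
      B ^+ (s.-1 + j) * expR ((1 - j%:R) * x).
    rewrite exprMn exprVn mulrCA; congr (_ * _).
    rewrite -{1 2}(lnK n0) -/x -!expRM_natl -expRN -expRD; congr expR.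
    by rewrite -{1}(prednK s0) -natr1 natrD; ring.
  rewrite ler_wpM2r ?expR_ge0//; apply: ler_weXn2l => //.
  by rewrite leq_add2r (leq_trans (leq_pred _)).
have hs (s : 'I_K'.+1) : (0 < s)%N ->
    outer_le P [set w | dense_spot (g w) s (s.-1 + a) 0 \/ dense_spot (g w) s s.-1 b]
      (B ^+ (K' + a) * expR (- ((A + 1) * x)) + B ^+ (K' + a) * expR (- ((A + 1) * x))).
  move=> s0; have sK : (0 < s <= K')%N by rewrite s0 -ltnS ltn_ord.
  apply: outer_leU.
    apply: outer_le_sub (dense_spot_bound d0 dn hG hY hGY s (s.-1 + a) 0) _ _ => //.
    rewrite expr0 fact0 divr1 mulr1; apply: le_trans (tree _ _ sK) _.
    apply: ler_wpM2l; first by rewrite exprn_ge0// ltW.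
    rewrite ler_expR -mulNr; apply: ler_wpM2r => //.
    by move: Aa; lra.
  apply: outer_le_sub (dense_spot_bound d0 dn hG hY hGY s s.-1 b) _ _ => //.
  rewrite [n%:R ^+ s / _ * _]mulrA; have := tree s 0%N sK; rewrite addn0 subr0 mul1r => ht.
  have sR : 0 < s%:R * d :> R by rewrite mulr_gt0// ltr0n.
  have sB' : s%:R * d <= B.
    apply: le_trans KB2; rewrite ler_wpM2r ?(ltW d0)// ler_nat.
    by case/andP: sK.
  apply: (@le_trans _ _ (B ^+ (K' + a) * expR x * expR (- (b%:R * (ln b%:R - 1 - ln B))))).
    apply: ler_pM.
    - apply: mulr_ge0; first by rewrite divr_ge0 ?exprn_ge0 ?(ltW n0).
      apply: divr_ge0 => //; apply: exprn_ge0.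
      by rewrite divr_ge0 ?(ltW n0)// mulr_ge0 ?sqr_ge0 ?(ltW d0).
    - by rewrite divr_ge0// exprn_ge0// ltW.
    - apply: le_trans ht _; rewrite addn0 ler_wpM2r ?expR_ge0//.
      by apply: ler_weXn2l => //; rewrite leq_addr.
    - apply: le_trans (pow_fact_le sR b0) _; rewrite ler_expR lerN2 ler_wpM2l//.
      by rewrite lerD2l lerN2 ler_ln ?posrE.
  rewrite -mulrA ler_wpM2l ?exprn_ge0 ?(ltW B0)// -expRD ler_expR.
  by move: Ab; rewrite -/x; lra.
apply: outer_le_sub (outer_le_exists hs) _ _.
  move=> w [s /andP[s0 sn] h].
  by exists (Ordinal (sn : (s < K'.+1)%N)).
rewrite big_mkcond big_ord_recl /= add0r sumr_const card_ord -[leLHS]mulr_natl.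
by rewrite le_eqVlt; apply/orP; left; apply/eqP; ring.
Qed.

Section Rows.
Variables alpha D0 theta : R.
Hypothesis alpha2 : 2 < alpha.
Hypothesis D00 : 0 < D0.
Hypothesis tail : forall r, 0 <= r ->
  fine (mu [set y | r <= `|y| `^ alpha]) <= D0 * expR (- r).
Hypothesis theta0 : 0 < theta.
Hypothesis theta1 : theta < 1.

Definition row_rate : R := d * D0 * (1 - expR (- (1 - theta)))^-1 * expR theta.

Lemma row_rate_gt0 : 0 < row_rate.
Proof.
rewrite !mulr_gt0 ?expR_gt0// invr_gt0 subr_gt0 expR_lt1.
by move: theta1; lra.
Qed.

(** The factor [2 ^ k] in the hypothesis pays for the sum over [k]. *)
Lemma rows_union (m : nat) (t c : R) : 0 < t -> 0 <= c ->
  (forall k, (0 < k <= m)%N -> (2 * row_rate) ^+ k / k`!%:R *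
     expR (- theta * (k%:R * (t / k%:R) `^ (alpha / 2))) <= c) ->
  outer_le P [set w | exists v, (#|[set u | g w v u]%SET| <= m)%N /\
     t <= \sum_u (if G v u w then `|Y v u w| else 0) ^+ 2] (n%:R * c).
Proof.
move=> t0 c0 hk.
have hs (k : 'I_m.+1) : (0 < k)%N ->
    outer_le P (row_event G Y k t) (n%:R * (2^-1 ^+ k * c)).
  move=> k0.
  apply: outer_le_sub (row_bound d0 dn hG hY hGY alpha2 D00 tail theta0 theta1 k0 (ltW t0)) _ _ => //.
  rewrite ler_wpM2l ?(ltW n0)//.
  have km : (0 < k <= m)%N by rewrite k0 -ltnS ltn_ord.
  have h2 : 0 <= 2^-1 ^+ k :> R by rewrite exprn_ge0// invr_ge0.
  apply: le_trans (ler_wpM2l h2 (hk _ km)).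
  by rewrite (mulrA (2^-1 ^+ k)) (mulrA (2^-1 ^+ k)) -exprMn mulKf.
apply: outer_le_sub (outer_le_exists hs) _ _.
  move=> w [v [vm row]].
  exists (Ordinal (vm : (_ < m.+1)%N)) => /=; last by exists v.
  rewrite lt0n; apply: contraTneq row => /eqP; rewrite cards_eq0 => /eqP no.
  rewrite big1 ?leNgt ?t0// => u _.
  have : u \notin [set u | g w v u]%SET by rewrite no inE.
  by rewrite inE /g => /negbTE ->; rewrite expr0n.
rewrite -mulr_sumr ler_wpM2l ?(ltW n0)// -mulr_suml ler_piMl//.
rewrite big_mkcond big_ord_recl /= add0r.
have := @sum_expr_le R 2^-1 m.+1; rewrite big_ord_recl /= expr0.
have -> : (1 - 2^-1)^-1 = 2 :> R by field.
by move=> h; rewrite -(lerD2l 1); apply: h; lra.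
Qed.

End Rows.
End FailureProbabilities.

(** A hub has at least [eps * L - 1] neighbours, of which at most [K'] lie in the
    exceptional set; [r] hubs then force [b] outgoing edges, enough to beat any
    prescribed power [A] of [n] once [r] is large. *)
Lemma many_hubs_exponent (R : realType) (eps A B : R) (r K' : nat) :
  0 < eps -> 0 <= A -> 1 <= B -> 8 * (A + 2) <= eps * r%:R ->
  exists Kc : R, forall x l : R, 0 < l -> Kc <= l -> Kc <= x / l ->
    l / 2 <= ln (x / l) ->
    let b := (r * (Num.truncn (eps * (x / l)) - K'))%N in
    [/\ (K' <= Num.truncn (eps * (x / l)))%N, (0 < b)%N &
        (A + 2) * x <= b%:R * (ln b%:R - 1 - ln B)].
Proof.
move=> eps0 A0 B1 rA.
have B0 : 0 < B by exact: lt_le_trans B1.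
have lB : 0 <= ln B by exact: ln_ge0.
have le := normr_ge0 (ln (eps / 2)).
have K'1 : 0 < K'%:R + 1 :> R by rewrite ltr_wpDl.
have Q0 : 0 < 2 * (K'%:R + 1) / eps by rewrite divr_gt0// mulr_gt0.
exists (2 * (K'%:R + 1) / eps + 4 * (1 + ln B + `|ln (eps / 2)|)) => x l l0 lK LK lnL b.
set L := x / l in LK lnL b *.
have LQ : 2 * (K'%:R + 1) / eps <= L by move: LK lB le; lra.
have L0 : 0 < L by exact: lt_le_trans LQ.
have eL : 2 * (K'%:R + 1) <= eps * L by rewrite (mulrC eps) -ler_pdivrMr.
have tr := truncnS_gt (eps * L).
have K'm : (K' <= Num.truncn (eps * L))%N.
  by rewrite -ltnS -(@ltr_nat R); apply: le_lt_trans tr; move: eL K'1; lra.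
set m := Num.truncn (eps * L) in tr K'm b *.
have m'L : eps / 2 * L <= (m - K')%:R.
  by rewrite natrB//; move: tr eL; rewrite -natr1; lra.
have m'0 : 0 < (m - K')%:R :> R by apply: lt_le_trans m'L; rewrite mulr_gt0// divr_gt0.
have r0 : 0 < r%:R :> R.
  by rewrite -(pmulr_rgt0 _ eps0); apply: lt_le_trans rA; move: A0; lra.
have bE : b%:R = r%:R * (m - K')%:R :> R by rewrite /b natrM.
have b0 : 0 < b%:R :> R by rewrite bE mulr_gt0.
have bL : r%:R * (eps / 2 * L) <= b%:R by rewrite bE ler_wpM2l// ltW.
have b0n : (0 < b)%N by rewrite -(@ltr0n R).
split => //.
have xE : x = L * l by rewrite /L; field; rewrite gt_eqF.
have lnb : l / 4 <= ln b%:R - 1 - ln B.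
  have e20 : 0 < eps / 2 by rewrite divr_gt0.
  have : ln (eps / 2) + ln L <= ln b%:R.
    rewrite -(lnM e20 L0) (ler_ln (mulr_gt0 e20 L0) b0).
    apply: le_trans bL; apply: ler_peMl; first by rewrite ltW// mulr_gt0.
    by rewrite ler1n -(@ltr0n R).
  have := ler_norm (- ln (eps / 2)); rewrite normrN.
  by move: lK Q0 lnL lB; lra.
rewrite xE; apply: (@le_trans _ _ (r%:R * (eps / 2 * L) * (l / 4))).
  have Ll : 0 <= L * l by rewrite mulr_ge0// ltW.
  have -> : r%:R * (eps / 2 * L) * (l / 4) = eps * r%:R / 8 * (L * l) by field.
  by apply: ler_wpM2r => //; rewrite ler_pdivlMr// mulrC.
have l40 : 0 <= l / 4 by rewrite divr_ge0// ltW.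
apply: ler_pM => //.
by rewrite mulr_ge0// ltW// mulr_gt0// divr_gt0.
Qed.

Section GoodOutcome.
Context (R : realType) (d : R) (mu : probability R R) (disp : measure_display)
  (T : measurableType disp) (P : probability T R) (n : nat)
  (G : 'I_n -> 'I_n -> {RV P >-> bool}) (Y : 'I_n -> 'I_n -> {RV P >-> R}).
Hypothesis hG : erdos_renyi (d / n%:R) G.
Hypothesis hY : symmetric_iid mu Y.

Lemma sparse_matrix_sym w i j :
  sparse_matrix G Y w i j = sparse_matrix G Y w j i.
Proof.
case: hG => _ sG _ _; case: hY => _ sY _ _.
by rewrite !mxE sG sY.
Qed.

Lemma measurable_sparse_lambda1 c : (0 < n)%N ->
  measurable [set w | c <= lambda1 (sparse_matrix G Y w)].
Proof.
move=> n0; apply: measurable_lambda1_ge => // [|i j]; first exact: sparse_matrix_sym.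
rewrite (_ : (fun w => _) = (fun w => (if G i j w then 1 else 0) * Y i j w)).
  apply: measurable_funM => //.
  apply: measurable_fun_if => //.
by apply/funext => w; rewrite !mxE; case: (G i j w).
Qed.

Lemma lambda1_good (w : T) (q K m : nat) (rho sigma M : R) :
  let g : rel 'I_n := fun i j => G i j w in
  let row v := \sum_u (if G v u w then `|Y v u w| else 0) ^+ 2 in
  let H := [set v | m <= #|[set u | g v u]|]%N%SET in
  0 < rho -> 0 < sigma -> 0 <= M ->
  (forall B : {set 'I_n}, B != finset.set0 ->
     exists2 v, v \in B & (#|[set u in B | g v u]%SET| <= q)%N) ->
  (forall v, row v <= rho ^+ 2) ->
  (forall v, v \notin H -> row v <= sigma ^+ 2) ->
  (forall v, (#|[set u | crossing_edge g H v u]%SET| <= K)%N) ->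
  (forall i j, G i j w -> `|Y i j w| <= M) ->
  lambda1 (sparse_matrix G Y w) <= rho + sigma * q.+1%:R + K%:R * M.
Proof.
move=> g row H rho0 sigma0 M0 degen hrow hlow hcross hM.
case: hG => irr sG _ _; case: hY => _ sY _ _.
apply: lambda1_le.
  by rewrite addr_ge0// ?mulr_ge0// addr_ge0 ?mulr_ge0// ltW.
move=> x; apply: (@le_trans _ _ (\sum_i \sum_j
    (if G i j w then `|Y i j w| else 0) * `|x i| * `|x j|)).
  apply: ler_sum => i _; apply: ler_sum => j _; rewrite !mxE.
  case: (G i j w); last by rewrite !mul0r.
  by rewrite mul1r -!normrM ler_norm.
apply: le_trans (@qform_stars_bound R n
  (fun i j => if G i j w then `|Y i j w| else 0) g H q K rho sigma M
  (fun i => `|x i|) _ _ _ _ _ _ _ _ _ _ _ _ _ _) _ => //.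
- by move=> i j; case: ifP.
- by move=> i j; rewrite sG sY.
- by move=> i j; rewrite /g sG.
- by move=> i; rewrite /g irr.
- by move=> i j /negbTE; rewrite /g => ->.
- by move=> i j; case: ifP => // /hM.
by under eq_bigr do rewrite real_normK ?num_real//.
Qed.

End GoodOutcome.

(** * The upper tail *)

Lemma nat_ge (R : realType) (y : R) : exists k : nat, y <= k%:R.
Proof. by exists (Num.truncn y).+1; exact/ltW/truncnS_gt. Qed.

(** Outside five events of small probability [lambda1_good] applies; its first
    term is [tau * lambda_light] with [tau] just below [1 + delta], and each of
    the other two is at most a quarter of the remaining slack. *)
Theorem upper_tail (R : realType) (d alpha : R) (mu : probability R R) (delta E : R) :
  0 < d -> 2 < alpha -> weibull_law alpha mu -> 0 < delta ->
  0 <= E -> E < (1 + delta) ^+ 2 - 1 ->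
  exists K eta : R, [/\ 0 < eta, eta < 1 &
  forall (disp : measure_display) (T : measurableType disp) (P : probability T R)
    (n : nat) (G : 'I_n -> 'I_n -> {RV P >-> bool}) (Y : 'I_n -> 'I_n -> {RV P >-> R}),
  d <= n%:R -> erdos_renyi (d / n%:R) G -> symmetric_iid mu Y ->
  independent_families (fun ij : 'I_n * 'I_n => G ij.1 ij.2)
                       (fun ij : 'I_n * 'I_n => Y ij.1 ij.2) ->
  let x := ln n%:R in let l := ln x in
  K <= x -> K <= l -> K <= x / l -> (1 - eta) * l <= ln (x / l) ->
  (P [set w | ((1 + delta) * lambda_light alpha n
                 <= lambda1 (sparse_matrix G Y w))%R]
     <= (expR (- (E * x)))%:E)%E].
Proof.
move=> d0 alpha2 hmu delta0 E0 hE.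
have alpha0 : 0 < alpha by move: alpha2; clear; lra.
have c00 := light_const_gt0 alpha2; set c0 := light_const alpha in c00.
have gam0 := gam_gt0 alpha2; set gam := 2^-1 - alpha^-1 in gam0.
have [D0 D00 tail] := weibull_tail alpha0 hmu.
(* the loss [xi] in the exponent is split between [rho], [tau] and [th] *)
pose xi := ((1 + delta) ^+ 2 - 1 - E) / 2.
have xi0 : 0 < xi by rewrite divr_gt0//; move: hE; clear; lra.
have del2 : 0 < (1 + delta) ^+ 2 by rewrite exprn_gt0//; move: delta0; clear; lra.
pose u := xi / (4 * (1 + delta) ^+ 2).
have u0 : 0 < u by rewrite divr_gt0// mulr_gt0.
have u1 : u < 1 by rewrite ltr_pdivrMr ?mulr_gt0// /xi; move: E0 del2; lra.
pose rho := 1 - u.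
have rho0 : 0 < rho by rewrite subr_gt0.
have rho1 : rho < 1 by rewrite /rho; move: u0; clear; lra.
pose tau := (1 + delta) * rho.
have tau0 : 0 < tau by rewrite mulr_gt0//; move: delta0; clear; lra.
pose th := rho `^ (alpha / 2).
have th0 : 0 < th by exact: powR_gt0.
have th1 : th < 1.
  have -> : 1 = 1 `^ (alpha / 2) :> R by rewrite powR1.
  by rewrite /th gt0_ltr_powR ?divr_gt0 ?nnegrE// ltW.
have thE : th `^ (2 / alpha) = rho.
  rewrite /th -powRrM.
  have -> : alpha / 2 * (2 / alpha) = 1 by field; rewrite gt_eqF.
  by rewrite powRr1// ltW.
pose E2 := E + 1 + xi.
have hE2 : E2 <= rho * (th `^ (2 / alpha) * tau ^+ 2).
  rewrite thE /tau.
  have -> : rho * (rho * ((1 + delta) * rho) ^+ 2) = (1 + delta) ^+ 2 * rho ^+ 4 by ring.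
  have r4 : 1 - 4 * u <= rho ^+ 4.
    have h : 0 <= u ^+ 2 * (6 - 4 * u + u ^+ 2).
      by rewrite mulr_ge0 ?sqr_ge0// addr_ge0 ?sqr_ge0//; move: u1; clear; lra.
    have -> : rho ^+ 4 = 1 - 4 * u + u ^+ 2 * (6 - 4 * u + u ^+ 2).
      by rewrite /rho; ring.
    by move: h; clear; lra.
  apply: le_trans (ler_wpM2l (ltW del2) r4).
  have -> : (1 + delta) ^+ 2 * (1 - 4 * u) = (1 + delta) ^+ 2 - xi.
    by rewrite /u; field; rewrite gt_eqF//; move: delta0; clear; lra.
  by rewrite /E2 /xi; lra.
pose D := 2 * row_rate d D0 th.
have D1 : 0 < D by rewrite mulr_gt0// row_rate_gt0.
have [K1 K10 main] := row_exponent alpha2 D1 tau0 th0 rho0 rho1 hE2.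
(* [A] is the exponent asked of all the exceptional events, [q] the degeneracy,
   [slack] the part of [1 + delta] left to the edges outside the stars *)
pose A := (Num.truncn (E + xi)).+1.
have AE : E + xi <= A%:R by exact/ltW/truncnS_gt.
have [q1 hq1] := nat_ge (expR (2 + ln d)).
pose q := (A.+2 + q1)%N.
have Aq : (A.+2 <= q)%N by rewrite leq_addr.
have dq : 2 + ln d <= ln q%:R.
  have q00 : 0 < q%:R :> R by rewrite ltr0n.
  rewrite -ler_expR lnK ?posrE//; apply: le_trans hq1 _.
  by rewrite ler_nat leq_addl.
pose slack := (1 + delta) * (1 - rho).
have slack0 : 0 < slack by rewrite mulr_gt0 ?subr_gt0//; move: delta0; clear; lra.
have q20 : 0 < (q.*2).+1%:R :> R by rewrite ltr0n.
pose eps' := slack / (4 * (q.*2).+1%:R).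
have eps'0 : 0 < eps' by rewrite divr_gt0// mulr_gt0.
have [eps0 eps00 low] := low_row_exponent alpha2 (A%:R + 1) D1 eps'0 th0.
(* [a] excess edges or [r] hubs are too many for a connected set; [Kc] bounds
   the crossing degrees and [K'] the sizes of the sets to be considered *)
pose a := A.+2.
have [r hr] := nat_ge (8 * (A%:R + 2) / eps0).
pose Kc := (r.*2 + a)%N; pose K' := (Kc.*2.+1)%N.
pose B := 1 + K'%:R ^+ 2 * d + K'%:R * d.
have KB1 : 0 <= K'%:R ^+ 2 * d by rewrite mulr_ge0 ?sqr_ge0// ltW.
have KB2 : 0 <= K'%:R * d by rewrite mulr_ge0// ltW.
have B1 : 1 <= B by rewrite /B; move: KB1 KB2; clear; lra.
have A0 : 0 <= A%:R :> R by [].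
have rA : 8 * (A%:R + 2) <= eps0 * r%:R by rewrite (mulrC eps0) -ler_pdivrMr.
have [K2 hubs] := many_hubs_exponent K' eps00 A0 B1 rA.
pose W := 4 * Kc%:R * (A%:R + 2) `^ alpha^-1 / (slack * c0).
have A20 : 0 < A%:R + 2 :> R by move: A0; clear; lra.
have W0 : 0 <= W.
  have sc : 0 < slack * c0 by exact: mulr_gt0.
  by apply: divr_ge0 (ltW sc); rewrite mulr_ge0 ?powR_ge0.
pose Q := 3 + 2 * K'%:R * B ^+ (K' + a) + d * D0.
have dD0 : 0 < d * D0 by exact: mulr_gt0.
have BK : 0 <= 2 * K'%:R * B ^+ (K' + a).
  by rewrite !mulr_ge0// exprn_ge0// (le_trans _ B1).
have Q0 : 0 < Q by rewrite /Q; move: dD0 BK; clear; lra.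
pose K := 1 + D + K1 + `|K2| + W `^ gam^-1 + `|ln Q| / xi.
exists K, ((1 - rho) / 2); split; [by rewrite divr_gt0// subr_gt0|by move: rho0; lra|].
move=> disp T P n G Y dn hG hY hGY x l Kx Kl KL lnL.
have W1 : 0 <= W `^ gam^-1 by exact: powR_ge0.
have lQ : 0 <= `|ln Q| / xi by rewrite divr_ge0// ltW.
have K2n := ler_norm K2; have K20 := normr_ge0 K2.
have KK1 : K1 <= K by rewrite /K; move: D1 W1 lQ K20; clear; lra.
have KK2 : K2 <= K by rewrite /K; move: D1 K10 W1 lQ K2n; clear; lra.
have KD : D <= K by rewrite /K; move: K10 W1 lQ K20; clear; lra.
have K11 : 1 <= K by rewrite /K; move: D1 K10 W1 lQ K20; clear; lra.
have KW : W `^ gam^-1 <= K by rewrite /K; move: D1 K10 lQ K20; clear; lra.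
have KQ : `|ln Q| / xi <= K by rewrite /K; move: D1 K10 W1 K20; clear; lra.
have x0 : 0 < x by apply: lt_le_trans Kx; move: K11; clear; lra.
have l0 : 0 < l by apply: lt_le_trans Kl; move: K11; clear; lra.
have L0 : 0 < x / l by exact: divr_gt0.
have n0 : 0 < n%:R :> R by exact: lt_le_trans d0 dn.
have nx : n%:R = expR x by rewrite lnK.
have lnL' : (1 + rho) / 2 * l <= ln (x / l).
  by apply: le_trans lnL; rewrite le_eqVlt; apply/orP; left; apply/eqP; field.
have lnL2 : l / 2 <= ln (x / l).
  apply: le_trans lnL'; have : 0 <= rho * l by rewrite mulr_ge0// ltW.
  by move: (rho) (l); clear; move=> v1 v2; lra.
pose lam := lambda_light alpha n.
have lamE : lam = c0 * (x `^ alpha^-1 * (x / l) `^ gam).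
  exact: (lambda_lightE alpha2 (erefl x) (erefl l) x0 l0).
have lam0 : 0 < lam.
  by rewrite lamE; apply: mulr_gt0 => //; rewrite mulr_gt0// powR_gt0.
pose g w : rel 'I_n := fun i j => G i j w.
pose row w v := \sum_u (if G v u w then `|Y v u w| else 0) ^+ 2.
pose m := Num.truncn (eps0 * (x / l)).
have [K'm b0 hb] := hubs x l l0 (le_trans KK2 Kl) (le_trans KK2 KL) lnL2.
set b := (r * _)%N in b0 hb.
pose M := ((A%:R + 2) * x) `^ alpha^-1.
have Ax0 : 0 <= (A%:R + 2) * x by rewrite mulr_ge0// ltW.
have M0 : 0 <= M by exact: powR_ge0.
have KM : Kc%:R * M <= slack / 4 * lam.
  rewrite /M powRM ?(ltW A20) ?(ltW x0)// lamE.
  have WL : W <= (x / l) `^ gam.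
    have -> : W = (W `^ gam^-1) `^ gam by rewrite -powRrM mulVf ?gt_eqF// powRr1.
    apply: ge0_ler_powR; rewrite ?nnegrE// ?(ltW L0) ?(ltW gam0)//.
    exact: le_trans KW KL.
  have -> : Kc%:R * ((A%:R + 2) `^ alpha^-1 * x `^ alpha^-1) =
      W * (slack / 4 * (c0 * x `^ alpha^-1)).
    by rewrite /W; field; rewrite !gt_eqF.
  have -> : slack / 4 * (c0 * (x `^ alpha^-1 * (x / l) `^ gam)) =
      (x / l) `^ gam * (slack / 4 * (c0 * x `^ alpha^-1)) by ring.
  have cst : 0 <= slack / 4 * (c0 * x `^ alpha^-1).
    apply: mulr_ge0; first by rewrite divr_ge0 ?ltW.
    by apply: mulr_ge0; [exact: ltW|exact: powR_ge0].
  move: WL cst; move: (_ `^ gam) (slack / 4 * _) => v1 v2 h1 h2.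
  exact: (ler_wpM2r h2 h1).
(* a long row, a row of low degree and non-negligible norm, a dense set, many
   crossing edges at a vertex, a huge label *)
have f1 : outer_le P [set w | exists v, (#|[set u | g w v u]%SET| <= n)%N /\
    (tau * lam) ^+ 2 <= row w v] (n%:R * expR (- (E2 * x))).
  apply: (rows_union d0 dn hG hY hGY alpha2 D00 tail th0 th1) => //.
  - by rewrite exprn_gt0// mulr_gt0.
  - move=> k /andP[k0 _]; exact: (main x l lam k (le_trans KK1 Kx) (le_trans KK1 Kl) k0 lnL' lamE).
have f2 : outer_le P [set w | exists v, (#|[set u | g w v u]%SET| <= m)%N /\
    (eps' * lam) ^+ 2 <= row w v] (n%:R * expR (- ((A%:R + 1) * x))).
  apply: (rows_union d0 dn hG hY hGY alpha2 D00 tail th0 th1) => //.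
  - by rewrite exprn_gt0// mulr_gt0.
  - move=> k /andP[k0 km]; have kL : k%:R <= eps0 * (x / l).
      apply: (@le_trans _ _ m%:R); first by rewrite ler_nat.
      by rewrite truncn_le// mulr_ge0// ltW.
    exact: (low x l lam k (le_trans KD Kx) l0 k0 kL lamE).
have f3 := degenerate_fail d0 dn hG hY hGY Aq dq.
have f4 : outer_le P [set w | exists2 s, (0 < s <= K')%N &
      dense_spot (g w) s (s.-1 + a) 0 \/ dense_spot (g w) s s.-1 b]
    (2 * K'%:R * B ^+ (K' + a) * expR (- ((A%:R + 1) * x))).
  apply: (crossing_fail d0 dn hG hY hGY) => //.
  - by rewrite /B; move: KB2; clear; lra.
  - by rewrite /B; move: KB1; clear; lra.
  - by rewrite -natrD ler_nat addn2.
have f5 := max_weight_bound d0 dn hG hY hGY Ax0 D00 (tail _ Ax0).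
have f := outer_leU (outer_leU (outer_leU (outer_leU f1 f2) f3) f4) f5.
apply: outer_le_measurable.
  by apply: (measurable_sparse_lambda1 hG hY); rewrite -(@ltr0n R).
apply: outer_le_sub f _ _.
  move=> w /= hw; apply: contrapT => /not_orP[/not_orP[/not_orP[/not_orP[n1 n2] n3] n4] n5].
  have irr i : g w i i = false by case: hG => h _ _ _; exact: h.
  have symg : symmetric (g w) by move=> i j; case: hG => _ sG _ _; exact: sG.
  have rows v : row w v <= (tau * lam) ^+ 2.
    rewrite leNgt; apply/negP => h; apply: n1; exists v; split; last exact: ltW.
    by rewrite (leq_trans (max_card _))// card_ord.
  have degen : forall Bs : {set 'I_n}, Bs != finset.set0 ->
     exists2 v, v \in Bs & (#|[set u in Bs | g w v u]%SET| <= q.*2)%N.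
    by case: (degenerate_or_dense q symg irr).
  have mm : ((m - K') + Kc.*2.+1 <= m)%N by rewrite subnK.
  have cross : forall v, (#|[set u | crossing_edge (g w)
      [set v | m <= #|[set u | g w v u]%SET|]%N%SET v u]%SET| <= Kc)%N.
    by case: (crossing_or_dense (a := a) symg irr mm (leqnn Kc)).
  have := lambda1_good hG hY (m := m) (M := M) _ _ M0 degen rows _ cross _.
  move=> /(_ (eps' * lam) (mulr_gt0 tau0 lam0) (mulr_gt0 eps'0 lam0)) bound.
  have : (1 + delta) * lam <= tau * lam + eps' * lam * (q.*2).+1%:R + Kc%:R * M.
    apply: le_trans hw _; apply: bound.
      move=> v; rewrite inE -ltnNge => vm.
      rewrite leNgt; apply/negP => h; apply: n2; exists v; split; last exact: ltW.
      exact: ltnW.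
    move=> i j Gij; rewrite leNgt; apply/negP => h; apply: n5; exists i, j.
    split=> //.
    have -> : (A%:R + 2) * x = M `^ alpha by rewrite /M -powRrM mulVf ?gt_eqF// powRr1.
    by apply: ge0_ler_powR; rewrite ?nnegrE// ltW.
  have -> : eps' * lam * (q.*2).+1%:R = slack / 4 * lam.
    by rewrite /eps'; field; rewrite gt_eqF.
  have sl : 0 < slack * lam by rewrite mulr_gt0.
  have -> : (1 + delta) * lam = tau * lam + slack * lam by rewrite /tau /slack; ring.
  by move: KM sl; clear; lra.
(* all five bounds are below a constant times [n ^ - (E + xi)] *)
have ex (p : R) : E + xi <= p -> expR (- (p * x)) <= expR (- ((E + xi) * x)).
  by move=> h; rewrite ler_expR lerN2 ler_wpM2r// ltW.
have e1 : n%:R * expR (- (E2 * x)) = expR (- ((E + xi) * x)).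
  by rewrite nx -expRD /E2; congr expR; ring.
have e2 : n%:R * expR (- ((A%:R + 1) * x)) = expR (- (A%:R * x)).
  by rewrite nx -expRD; congr expR; ring.
have e5 : n%:R ^+ 2 * (d / n%:R * (D0 * expR (- ((A%:R + 2) * x)))) =
    d * D0 * expR (- ((A%:R + 1) * x)).
  have -> : expR (- ((A%:R + 1) * x)) = n%:R * expR (- ((A%:R + 2) * x)).
    by rewrite nx -expRD; congr expR; ring.
  by field; rewrite gt_eqF.
rewrite e1 e2 e5 -/x.
have h1 := ex _ AE.
have h2 : expR (- ((A%:R + 1) * x)) <= expR (- ((E + xi) * x)).
  by apply: ex; move: AE; clear; lra.
set e := expR (- ((E + xi) * x)) in h1 h2 *.
have h3 := ler_wpM2l BK h2.
have h4 := ler_wpM2l (ltW dD0) h2.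
apply: (@le_trans _ _ (Q * e)).
  rewrite /Q; move: h1 h3 h4; clear.
  by move: (expR (- (A%:R * x))) (_ * B ^+ _) (d * D0) (expR _) => v1 v2 v3 v4; lra.
rewrite -[Q]lnK ?posrE// -expRD ler_expR.
have : ln Q <= xi * x.
  rewrite mulrC -ler_pdivrMr//; apply: le_trans (le_trans KQ Kx).
  by rewrite ler_wpM2r ?invr_ge0 ?ler_norm// ltW.
by move: (ln Q) (xi) => v1 v2 h; move: h; clear; lra.
Qed.

(** * The lower tail *)

Lemma disjoint_union_lower (R : realType) (disp : measure_display)
    (T : measurableType disp) (P : probability T R) (I : finType) (A : {set I})
    (D : I -> set T) (S : set T) (c : R) :
  (forall i, measurable (D i)) -> measurable S ->
  (forall i j, i \in A -> j \in A -> i != j -> D i `&` D j = set0) ->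
  (forall i, i \in A -> D i `<=` S) -> (forall i, i \in A -> (c%:E <= P (D i))%E) ->
  ((#|A|%:R * c)%:E <= P S)%E.
Proof.
move=> mD mS disj DS cD.
have h (s : seq I) : uniq s -> {subset s <= A} ->
    measurable (\big[setU/set0]_(i <- s) D i) /\
    (((size s)%:R * c)%:E <= P (\big[setU/set0]_(i <- s) D i))%E.
  elim: s => [_ _|a s IH /= /andP[as_ us] sA].
    by rewrite big_nil mul0r measure0.
  have sA' : {subset s <= A} by move=> i is_; apply: sA; rewrite inE is_ orbT.
  have [mIH {}IH] := IH us sA'.
  rewrite big_cons; split; first exact: measurableU.
  rewrite measureU//.
    by rewrite -natr1 mulrDl mul1r addrC EFinD leeD// cD// sA ?mem_head.
  rewrite -subset0 => w [Da]; rewrite -bigcup_seq => -[i /= is_ Di].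
  have ai : a != i by apply: contraNneq as_ => ->.
  have : (D a `&` D i) w by [].
  by rewrite disj// sA ?mem_head// inE is_ orbT.
have sE : {subset enum A <= A} by move=> i; rewrite mem_enum.
have [mE hE] := h (enum A) (enum_uniq _) sE.
rewrite cardE; apply: le_trans hE _; apply: le_measure; rewrite ?inE//.
by rewrite -bigcup_seq => w [i /= /sE iA Di]; exact: DS Di.
Qed.

Lemma probD_ge (R : realType) (disp : measure_display)
    (T : measurableType disp) (P : probability T R) (A B : set T) (a b : R) :
  measurable A -> measurable B -> (a%:E <= P A)%E -> outer_le P (A `&` B) b ->
  ((a - b)%:E <= P (A `\` B))%E.
Proof.
move=> mA mB aA /(outer_le_measurable (measurableI _ _ mA mB)) bAB.
rewrite measureD//; last by rewrite ltey_eq fin_num_measure.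
by rewrite EFinB leeB.
Qed.

Section StarLower.
Context (R : realType) (d : R) (mu : probability R R) (disp : measure_display)
  (T : measurableType disp) (P : probability T R) (n : nat)
  (G : 'I_n -> 'I_n -> {RV P >-> bool}) (Y : 'I_n -> 'I_n -> {RV P >-> R}).
Hypothesis d0 : 0 < d.
Hypothesis dn : d <= n%:R.
Hypothesis hG : erdos_renyi (d / n%:R) G.
Hypothesis hY : symmetric_iid mu Y.
Hypothesis hGY : independent_families (fun ij : 'I_n * 'I_n => G ij.1 ij.2)
                                      (fun ij : 'I_n * 'I_n => Y ij.1 ij.2).
Variables (k : nat) (y : R).
Implicit Types (v u : 'I_n) (S : {set 'I_n}).

Let n0 : 0 < n%:R :> R. Proof. exact: lt_le_trans d0 dn. Qed.
Let p := d / n%:R.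
Let p0 : 0 <= p. Proof. by rewrite divr_ge0// ltW. Qed.
Let big_label := [set z : R | y <= z].
Let q := fine (mu big_label).
Let q0 : 0 <= q. Proof. exact: fine_ge0. Qed.

Let measurable_big_label : measurable big_label.
Proof.
by rewrite (_ : big_label = `[y, +oo[%classic) //;
  apply/seteqP; split => x /=; rewrite in_itv/= andbT.
Qed.

(** Separating centres from leaves makes the pairs of distinct stars distinct
    edges, all oriented from centre to leaf. *)
Definition centres : {set 'I_n} := [set v : 'I_n | (v < n./2)%N]%SET.
Definition leaves : {set 'I_n} := (~: centres)%SET.
Definition star_pairs (v : 'I_n) (S : {set 'I_n}) := [set (v, u) | u in S]%SET.
Definition star_event v S := edge_event G Y (star_pairs v S) (fun=> big_label).

(** What has to be excluded for the events [clean_star] to be disjoint (a further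
    leaf of the same centre, a star at another centre) and for a star to be seen
    by [lambda1] (an edge between two leaves, whose label could be negative). *)
Definition star_spoiled v S : set T :=
  \bigcup_(u in [set` leaves :\: S]) star_event v [set u]%SET `|`
  (\bigcup_(e in [set` [set e in finset.setX S S | (e.1 < e.2)%N]%SET])
      edge_event G Y [set e]%SET (fun=> setT) `|`
   \bigcup_(c in [set` [set c : 'I_n * {set 'I_n} | [&& c.1 \in centres, c.1 != v,
                          c.2 \subset leaves & #|c.2| == k]]%SET]) star_event c.1 c.2).

Definition clean_star v S : set T := star_event v S `\` star_spoiled v S.

Lemma measurable_star_event v S : measurable (star_event v S).
Proof. exact: measurable_edge_event. Qed.

Lemma measurable_star_spoiled v S : measurable (star_spoiled v S).
Proof.
apply: measurableU.
  by apply: fin_bigcup_measurable => // u _; exact: measurable_star_event.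
apply: measurableU; apply: fin_bigcup_measurable => // c _.
  exact: measurable_edge_event.
exact: measurable_star_event.
Qed.

Lemma card_star_pairs v S : #|star_pairs v S| = #|S|.
Proof. by rewrite card_imset// => a b [->]. Qed.

Lemma star_pairsP v S e : v \in centres -> S \subset leaves ->
  e \in star_pairs v S -> [/\ e.1 = v, e.2 \in S, e.1 \in centres & e.2 \notin centres].
Proof.
move=> vC SL /imsetP[u uS ->]; split=> //=.
by have := fintype.subsetP SL _ uS; rewrite inE.
Qed.

Lemma prob_star_event v S : v \in centres -> S \subset leaves ->
  P (star_event v S) = ((p * q) ^+ #|S|)%:E.
Proof.
move=> vC SL.
have oX : oriented (star_pairs v S).
  apply/orientedP => i j /(star_pairsP vC SL)[_ _ /= iC jC]; apply/negP.
  by move=> /(star_pairsP vC SL)[_ _ /=]; rewrite (negbTE jC).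
rewrite (prob_edge_event d0 dn hG hY hGY)//.
by rewrite prodr_const card_star_pairs.
Qed.

(** Each of the three ways of spoiling a star costs a conditional probability of
    at most [1/4]. *)
Lemma clean_star_prob v S : v \in centres -> S \subset leaves -> #|S| = k ->
  d * q <= 4^-1 -> k%:R ^+ 2 * d / n%:R <= 4^-1 ->
  n%:R * ((d * q) ^+ k / k`!%:R) <= 4^-1 ->
  (((p * q) ^+ k / 4)%:E <= P (clean_star v S))%E.
Proof.
move=> vC SL Sk e1 e2 e3.
have pq0 : 0 <= (p * q) ^+ k by rewrite exprn_ge0// mulr_ge0.
have nE : n%:R * p = d by rewrite /p mulrC divfK// gt_eqF.
have extra : outer_le P (star_event v S `&`
    \bigcup_(u in [set` leaves :\: S]) star_event v [set u]%SET)
    (n%:R * ((p * q) ^+ k * (p * q))).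
  have h u : u \in leaves :\: S ->
      outer_le P (star_event v (u |: S)%SET) ((p * q) ^+ k * (p * q)).
    move=> /finset.setDP[uL uS]; exists (star_event v (u |: S)%SET).
    split => //; first exact: measurable_star_event.
    have uSL : (u |: S)%SET \subset leaves by rewrite finset.subUset finset.sub1set uL.
    by rewrite prob_star_event// cardsU1 uS Sk add1n exprSr.
  apply: outer_le_sub (outer_le_exists_cst (N := n%:R) _ _ h) _ _ => //.
  - by rewrite mulr_ge0// mulr_ge0.
  - by rewrite -[X in _ <= X%:R](card_ord n) ler_nat max_card.
  move=> w [ES [u /= uS Eu]]; exists u => // e /imsetP[u' + ->].
  rewrite !inE => /orP[/eqP ->|u'S]; first by apply: Eu; rewrite imset_f ?inE.
  by apply: ES; rewrite imset_f.
have inner : outer_le P (star_event v S `&`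
   \bigcup_(e in [set` [set e in finset.setX S S | (e.1 < e.2)%N]%SET])
      edge_event G Y [set e]%SET (fun=> setT))
    (k%:R ^+ 2 * ((p * q) ^+ k * p)).
  pose B (e e' : 'I_n * 'I_n) := if e' == e then [set: R] else big_label.
  have h e : e \in [set e in finset.setX S S | (e.1 < e.2)%N]%SET ->
      outer_le P (edge_event G Y (e |: star_pairs v S)%SET (B e)) ((p * q) ^+ k * p).
    case: e => i j; rewrite !inE /= => /andP[/andP[iS jS] ij].
    have iC : i \notin centres by have := fintype.subsetP SL _ iS; rewrite inE.
    have jC : j \notin centres by have := fintype.subsetP SL _ jS; rewrite inE.
    have eX : (i, j) \notin star_pairs v S.
      by apply/negP => /(star_pairsP vC SL)[_ _ /=]; rewrite (negbTE iC).
    have oX : oriented ((i, j) |: star_pairs v S)%SET.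
      apply/orientedP => a b; rewrite !inE => /orP[/eqP[-> ->]|abX].
        rewrite negb_or; apply/andP; split.
          by apply/negP => /eqP[ji _]; rewrite ji ltnn in ij.
        by apply/negP => /(star_pairsP vC SL)[_ _ /=]; rewrite (negbTE jC).
      have [_ _ /= aC bC] := star_pairsP vC SL abX.
      rewrite negb_or; apply/andP; split.
        by apply/negP => /eqP[_ aj]; rewrite aj (negbTE jC) in aC.
      by apply/negP => /(star_pairsP vC SL)[_ _ /=]; rewrite (negbTE bC).
    have mB e : measurable (B (i, j) e) by rewrite /B; case: ifP.
    exists (edge_event G Y ((i, j) |: star_pairs v S)%SET (B (i, j))).
    split => //; first exact: measurable_edge_event.
    rewrite (prob_edge_event d0 dn hG hY hGY)// big_setU1//= /B eqxx.
    rewrite probability_setT mulr1 mulrC lee_fin -/p ler_wpM2r//.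
    rewrite -Sk -(card_star_pairs v) -prodr_const; apply: ler_prod => e' e'X.
    have -> : (e' == (i, j)) = false by apply: contraNF eX => /eqP <-.
    by rewrite mulr_ge0//= -/p.
  apply: outer_le_sub (outer_le_exists_cst (N := k%:R ^+ 2) _ _ h) _ _ => //.
  - by rewrite mulr_ge0.
  - rewrite -natrX -mulnn -{1 2}Sk -cardsX ler_nat; apply: subset_leq_card.
    by apply/fintype.subsetP => e; rewrite !inE => /andP[].
  move=> w [ES [e /= eS Ee]]; exists e => // e'.
  rewrite !inE => /orP[/eqP ->|e'S].
    by rewrite /B eqxx; apply: Ee; rewrite inE.
  by have [Ge Be] := ES _ e'S; split => //; rewrite /B; case: ifP.
have other : outer_le P (star_event v S `&`
   \bigcup_(c in [set` [set c : 'I_n * {set 'I_n} | [&& c.1 \in centres, c.1 != v,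
        c.2 \subset leaves & #|c.2| == k]]%SET]) star_event c.1 c.2)
    (n%:R * (n%:R ^+ k / k`!%:R) * ((p * q) ^+ k * (p * q) ^+ k)).
  have h (c : 'I_n * {set 'I_n}) : c \in [set c : 'I_n * {set 'I_n} | [&& c.1 \in centres, c.1 != v,
        c.2 \subset leaves & #|c.2| == k]]%SET ->
      outer_le P (edge_event G Y (star_pairs v S :|: star_pairs c.1 c.2)%SET (fun=> big_label))
        ((p * q) ^+ k * (p * q) ^+ k).
    case: c => v' S'; rewrite inE /= => /and4P[v'C v'v S'L /eqP S'k].
    have oX : oriented (star_pairs v S :|: star_pairs v' S')%SET.
      apply/orientedP => i j; rewrite !inE => ijX.
      have {ijX}jC : j \notin centres.
        by case/orP: ijX => [/(star_pairsP vC SL)|/(star_pairsP v'C S'L)] [].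
      apply/negP => /orP[/(star_pairsP vC SL)|/(star_pairsP v'C S'L)] [_ _ /=].
        by rewrite (negbTE jC).
      by rewrite (negbTE jC).
    have cX : #|(star_pairs v S :|: star_pairs v' S')%SET| = (k + k)%N.
      rewrite cardsU (_ : _ :&: _ = finset.set0).
        by rewrite cards0 subn0 !card_star_pairs Sk S'k.
      apply/setP => e; rewrite !inE; apply/negP => /andP[].
      move=> /(star_pairsP vC SL)[ev _ _ _] /(star_pairsP v'C S'L)[ev' _ _ _].
      by rewrite -ev -ev' eqxx in v'v.
    exists (edge_event G Y (star_pairs v S :|: star_pairs v' S')%SET (fun=> big_label)).
    split => //; first exact: measurable_edge_event.
    by rewrite (prob_edge_event d0 dn hG hY hGY)// prodr_const cX exprD.
  apply: outer_le_sub (outer_le_exists_cst (N := n%:R * (n%:R ^+ k / k`!%:R)) _ _ h) _ _ => //.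
  - by rewrite mulr_ge0.
  - apply: (@le_trans _ _ (n%:R * 'C(n, k)%:R)); last by rewrite ler_wpM2l ?bin_le_pow ?(ltW n0).
    rewrite -natrM ler_nat.
    have -> : (n * 'C(n, k) = #|finset.setX [set: 'I_n]%SET [set S : {set 'I_n} | #|S| == k]%SET|)%N.
      by rewrite cardsX cardsT card_ord card_draws card_ord.
    apply: subset_leq_card; apply/fintype.subsetP => c.
    by rewrite !inE => /and4P[_ _ _ ->].
  move=> w [ES [c /= cS Ec]]; exists c => // e.
  by rewrite inE => /orP[/ES|/Ec].
have sp : outer_le P (star_event v S `&` star_spoiled v S) ((p * q) ^+ k * (3 / 4)).
  apply: outer_le_sub (outer_leU extra (outer_leU inner other)) _ _.
    by move=> w [ES [h|[h|h]]]; [left|right; left|right; right].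
  have -> : n%:R * ((p * q) ^+ k * (p * q)) = (p * q) ^+ k * (d * q).
    by rewrite -[in RHS]nE; ring.
  have -> : k%:R ^+ 2 * ((p * q) ^+ k * p) = (p * q) ^+ k * (k%:R ^+ 2 * d / n%:R).
    by rewrite /p; ring.
  have -> : n%:R * (n%:R ^+ k / k`!%:R) * ((p * q) ^+ k * (p * q) ^+ k) =
     (p * q) ^+ k * (n%:R * ((d * q) ^+ k / k`!%:R)).
    have -> : (d * q) ^+ k = n%:R ^+ k * (p * q) ^+ k by rewrite -exprMn mulrA nE.
    by move: (k`!%:R^-1) (n%:R ^+ k) ((p * q) ^+ k) => a b c; ring.
  rewrite -!mulrDr ler_wpM2l//; move: e1 e2 e3; lra.
have := probD_ge (measurable_star_event v S) (measurable_star_spoiled v S) _ sp.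
move=> /(_ ((p * q) ^+ k)); rewrite prob_star_event// Sk => /(_ (lexx _)).
by apply: le_trans; rewrite lee_fin; move: ((p * q) ^+ k) => z; lra.
Qed.

Lemma clean_star_disjoint v v' S S' :
  v \in centres -> S \subset leaves -> #|S| = k ->
  v' \in centres -> S' \subset leaves -> #|S'| = k ->
  (v, S) != (v', S') -> clean_star v S `&` clean_star v' S' = set0.
Proof.
move=> vC SL Sk v'C S'L S'k; rewrite -subset0 => ne w [[ES nsp] [ES' _]].
have [vv'|vv'] := eqVneq v v'; last first.
  by apply: nsp; right; right; exists (v', S') => //=; rewrite inE v'C eq_sym vv' S'L S'k eqxx.
have [SS'|/subsetPn[u uS' uS]] := boolP (S' \subset S).
  have : S' == S by rewrite eqEcard SS' Sk S'k leqnn.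
  by move/eqP => SE; rewrite vv' SE eqxx in ne.
apply: nsp; left; exists u => /=; first by rewrite inE uS (fintype.subsetP S'L).
move=> e /imsetP[u'']; rewrite inE => /eqP -> ->; rewrite vv'.
by apply: ES'; rewrite imset_f.
Qed.

(** The vector with weight [sqrt k] at the centre and [1] at the leaves of a
    clean star detects its [l^2] norm, as no edge joins two leaves. *)
Lemma clean_star_lambda1 v S w : v \in centres -> S \subset leaves -> #|S| = k ->
  (0 < k)%N -> clean_star v S w ->
  Num.sqrt k%:R * y <= lambda1 (sparse_matrix G Y w).
Proof.
move=> vC SL Sk k0 [ES nsp].
have kR : 0 < k%:R :> R by rewrite ltr0n.
have sk0 : 0 < Num.sqrt k%:R :> R by rewrite sqrtr_gt0.
have vS : v \notin S by apply/negP => /(fintype.subsetP SL); rewrite inE vC.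
case: (hG) => irr sG _ _; case: (hY) => _ sY _ _.
pose Z := sparse_matrix G Y w.
have ZE i j : Z i j = (G i j w)%:R * Y i j w by rewrite !mxE.
have Zsym := sparse_matrix_sym hG hY w; rewrite -/Z in Zsym.
have Zstar u : u \in S -> y <= Z v u.
  move=> uS; have [] := ES (v, u); first by rewrite imset_f.
  by rewrite ZE /= => ->; rewrite mul1r.
have Zleaf i j : i \in S -> j \in S -> Z i j = 0.
  move=> iS jS; rewrite ZE; suff -> : G i j w = false by rewrite mul0r.
  apply/negP => gij.
  have no a b : a \in S -> b \in S -> (a < b)%N -> G a b w -> False.
    move=> aS bS ab gab; apply: nsp; right; left; exists (a, b) => /=.
      by rewrite !inE aS bS ab.
    by move=> e; rewrite inE => /eqP ->.
  case: (ltngtP i j) => [ij|ji|/val_inj ij]; first exact: no gij.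
    by rewrite sG in gij; exact: no gij.
  by rewrite ij irr in gij.
pose x i : R := if i == v then Num.sqrt k%:R else (i \in S)%:R.
have x_v : x v = Num.sqrt k%:R by rewrite /x eqxx.
have xS u : u \in S -> x u = 1.
  by rewrite /x; case: eqP => [->|_ ->]//; rewrite (negbTE vS).
have sumx (F : 'I_n -> R) : \sum_i F i * x i = F v * Num.sqrt k%:R + \sum_(i in S) F i.
  rewrite (bigD1 v)//= x_v; congr (_ + _).
  rewrite big_mkcond [RHS]big_mkcond; apply: eq_bigr => i _ /=.
  rewrite /x; case: eqP => [->|_] /=; first by rewrite (negbTE vS).
  by case: ifP; rewrite ?mulr1 ?mulr0.
have sq : \sum_i x i ^+ 2 = 2 * k%:R.
  under eq_bigr do rewrite expr2; rewrite sumx x_v -expr2 sqr_sqrtr ?(ltW kR)//.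
  rewrite (eq_bigr (fun=> 1)) => [|u /xS//]; rewrite sumr_const Sk.
  by rewrite mulr_natl mulr2n.
have Zvv : Z v v = 0 by rewrite ZE irr mul0r.
have qE : qform Z x = 2 * (Num.sqrt k%:R * \sum_(u in S) Z v u).
  rewrite /qform; under eq_bigr do rewrite sumx.
  under eq_bigr do rewrite mulrAC -mulr_suml -mulrDl.
  rewrite sumx Zvv mul0r add0r.
  have -> : \sum_(i in S) (Z i v * Num.sqrt k%:R + \sum_(j in S) Z i j) =
     Num.sqrt k%:R * \sum_(u in S) Z v u.
    rewrite mulr_sumr; apply: eq_bigr => i iS.
    by rewrite big1 ?addr0 1?Zsym 1?mulrC// => j jS; exact: Zleaf.
  by rewrite mulrC mulr_natl mulr2n.
have := qform_le_lambda1 x Zsym; rewrite sq qE.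
have : k%:R * y <= \sum_(u in S) Z v u.
  by rewrite mulr_natl -Sk -sumr_const; apply: ler_sum.
move=> h1 h2; rewrite -(ler_pM2r kR).
have h3 := ler_wpM2l (ltW sk0) h1.
rewrite -(ler_pM2l (ltr0n R 2)) (_ : 2 * (Num.sqrt k%:R * y * k%:R) = 2 * (Num.sqrt k%:R * (k%:R * y))); last by ring.
apply: (@le_trans _ _ (2 * (Num.sqrt k%:R * \sum_(u in S) Z v u))).
  by rewrite ler_pM2l.
by apply: le_trans h2 _; rewrite mulrCA.
Qed.

Lemma card_centres : #|centres| = n./2.
Proof.
rewrite -sum1_card (eq_bigl (fun v : 'I_n => (v < n./2)%N)) => [|v]; last by rewrite inE.
have hn : (n./2 <= n)%N by rewrite -{2}(half_bit_double n false) -?doubleE; lia.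
by rewrite -(big_ord_widen _ (fun=> 1%N) hn) sum1_card card_ord.
Qed.

Lemma card_leaves : #|leaves| = (n - n./2)%N.
Proof. by have := cardsC centres; rewrite card_centres card_ord -/leaves; lia. Qed.

Lemma star_lower : (0 < k)%N ->
  d * q <= 4^-1 -> k%:R ^+ 2 * d / n%:R <= 4^-1 ->
  n%:R * ((d * q) ^+ k / k`!%:R) <= 4^-1 ->
  (((n./2)%:R * 'C(n - n./2, k)%:R * ((p * q) ^+ k / 4))%:E <=
     P [set w | (Num.sqrt k%:R * y <= lambda1 (sparse_matrix G Y w))%R])%E.
Proof.
move=> k0 e1 e2 e3.
pose C := finset.setX centres [set S : {set 'I_n} | (S \subset leaves) && (#|S| == k)]%SET.
have CP c : c \in C -> [/\ c.1 \in centres, c.2 \subset leaves & #|c.2| = k].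
  by rewrite !inE => /andP[-> /andP[-> /eqP]].
have -> : (n./2)%:R * 'C(n - n./2, k)%:R = #|C|%:R :> R.
  by rewrite -natrM cardsX card_centres cards_draws card_leaves.
apply: (@disjoint_union_lower _ _ _ _ _ C (fun c => clean_star c.1 c.2)).
- by move=> c; apply: measurableD; [exact: measurable_star_event|exact: measurable_star_spoiled].
- by apply: (measurable_sparse_lambda1 hG hY); rewrite -(@ltr0n R).
- move=> [v S] [v' S'] /CP[/= h1 h2 h3] /CP[/= h4 h5 h6] ne.
  exact: clean_star_disjoint.
- by move=> c /CP[h1 h2 h3] w; exact: clean_star_lambda1.
- by move=> c /CP[h1 h2 h3]; exact: clean_star_prob.
Qed.

End StarLower.

Lemma bin_ge_pow (R : realType) (N k : nat) (z : R) : (0 < k)%N -> 0 <= z ->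
  z + k%:R <= N%:R -> (z / k%:R) ^+ k <= 'C(N, k)%:R.
Proof.
move=> k0 z0 zN; have kR : 0 < k%:R :> R by rewrite ltr0n.
have f0 : 0 < k`!%:R :> R by rewrite ltr0n fact_gt0.
have kN : (k <= N)%N by rewrite -(ler_nat R); move: zN z0; lra.
rewrite -(ler_pM2r f0) -natrM bin_ffact.
apply: (@le_trans _ _ (z ^+ k)).
  rewrite exprMn -[leRHS]mulr1 -mulrA ler_wpM2l ?exprn_ge0//.
  rewrite exprVn mulrC ler_pdivrMr ?exprn_gt0// mul1r -natrX ler_nat.
  rewrite -ffactnn.
  have -> : (k ^ k = \prod_(i < k) k)%N by rewrite prod_nat_const card_ord.
  by rewrite ffact_prod; apply: leq_prod => i _; exact: leq_subr.
have -> : z ^+ k = \prod_(i < k) z by rewrite prodr_const card_ord.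
rewrite ffact_prod natr_prod; apply: ler_prod => i _; rewrite z0 /=.
have ik : (i <= k)%N by exact: ltnW.
rewrite natrB; last exact: leq_trans kN.
have : i%:R <= k%:R :> R by rewrite ler_nat.
by move: zN; lra.
Qed.

Lemma expRN_le_inv (R : realType) (z : R) : 0 < z -> expR (- z) <= z^-1.
Proof.
move=> z0; rewrite expRN lef_pV2 ?posrE ?expR_gt0//.
by apply: le_trans (expR_ge1Dx z); lra.
Qed.

(** With [kap = tau ^ 2 * (alpha - 2) / alpha] the two costs sum to [tau ^ 2],
    which is the case of equality in [tradeoff] for [th = 1]. *)
Lemma optimal_star_cost (R : realType) (alpha tau : R) : 2 < alpha -> 0 < tau ->
  (tau * light_const alpha) `^ alpha *
    (tau ^+ 2 * ((alpha - 2) / alpha)) `^ (1 - alpha / 2) = tau ^+ 2 * (2 / alpha).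
Proof.
move=> alpha2 tau0; have c00 := light_const_gt0 alpha2.
have alpha0 : 0 < alpha by move: alpha2; lra.
have a2 : 0 < alpha - 2 by rewrite subr_gt0.
have aa : 0 < (alpha - 2) / alpha by exact: divr_gt0.
have ta : 0 < 2 / alpha by exact: divr_gt0.
have t2 : 0 < tau ^+ 2 by exact: exprn_gt0.
have tc : 0 < tau * light_const alpha by exact: mulr_gt0.
have tk : 0 < tau ^+ 2 * ((alpha - 2) / alpha) by exact: mulr_gt0.
rewrite -[LHS]lnK ?posrE; last by apply: mulr_gt0; exact: powR_gt0.
rewrite -[RHS]lnK ?posrE; last exact: mulr_gt0.
congr expR; rewrite (lnM (powR_gt0 _ tc) (powR_gt0 _ tk)) !ln_powR.
rewrite (lnM tau0 c00) (lnM t2 aa) (lnM t2 ta) lnXn// (ln_div a2 alpha0).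
rewrite (ln_div (ltr0n R 2) alpha0) (ln_light_const alpha2) -[ln tau *+ 2]mulr_natl.
by field; rewrite gt_eqF.
Qed.

Lemma leq_double_uphalf n : (n <= (n - n./2) * 2)%N.
Proof. by have := odd_double_half n; case: (odd n); lia. Qed.

Lemma leq_quadruple_half n : (2 <= n)%N -> (n <= n./2 * 4)%N.
Proof. by have := odd_double_half n; case: (odd n); lia. Qed.

Lemma sum_ge_terms (R : realType) (z1 z2 z3 z4 z5 z6 z7 z8 : R) :
  0 <= z1 -> 0 <= z2 -> 0 <= z3 -> 0 <= z4 -> 0 <= z5 -> 0 <= z6 -> 0 <= z7 ->
  0 <= z8 -> let z := 8 + z1 + z2 + z3 + z4 + z5 + z6 + z7 + z8 in
  8 <= z /\ z1 <= z /\ z2 <= z /\ z3 <= z /\ z4 <= z /\ z5 <= z /\ z6 <= z /\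
  z7 <= z /\ z8 <= z.
Proof. cbv zeta; move=> *; do !split; lra. Qed.

(** Take [k] just above the optimal number [kap * L] of labels, each at least
    [y = tau * lambda_light / sqrt k].  The conditions of [star_lower] hold since
    [y] tends to infinity and since, by [row_exponent] with [th = 1], the expected
    number of such stars tends to zero. *)
Theorem lower_tail (R : realType) (d alpha : R) (mu : probability R R) (delta E : R) :
  0 < d -> 2 < alpha -> weibull_law alpha mu -> 0 < delta ->
  (1 + delta) ^+ 2 - 1 < E ->
  exists K eta : R, [/\ 0 < eta, eta < 1 &
  forall (disp : measure_display) (T : measurableType disp) (P : probability T R)
    (n : nat) (G : 'I_n -> 'I_n -> {RV P >-> bool}) (Y : 'I_n -> 'I_n -> {RV P >-> R}),
  d <= n%:R -> erdos_renyi (d / n%:R) G -> symmetric_iid mu Y ->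
  independent_families (fun ij : 'I_n * 'I_n => G ij.1 ij.2)
                       (fun ij : 'I_n * 'I_n => Y ij.1 ij.2) ->
  let x := ln n%:R in let l := ln x in
  K <= x -> K <= l -> K <= x / l -> (1 - eta) * l <= ln (x / l) ->
  ((expR (- (E * x)))%:E <=
   P [set w | ((1 + delta) * lambda_light alpha n
                 <= lambda1 (sparse_matrix G Y w))%R])%E].
Proof.
move=> d0 alpha2 [C1 [C2 [C10 C20 weib]]] delta0 hE.
have alpha0 : 0 < alpha by move: alpha2; clear; lra.
have c00 := light_const_gt0 alpha2; set c0 := light_const alpha in c00.
pose tau := 1 + delta; rewrite -/tau in hE *.
have tau1 : 1 < tau by rewrite /tau; move: delta0; clear; lra.
have tau0 : 0 < tau by exact: lt_trans tau1.
have t21 : 1 < tau ^+ 2 by rewrite exprn_egt1.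
have t20 : 0 < tau ^+ 2 by exact: exprn_gt0.
pose kap := tau ^+ 2 * ((alpha - 2) / alpha).
have kap0 : 0 < kap by rewrite mulr_gt0// divr_gt0// subr_gt0.
have kapE : kap + tau ^+ 2 * (2 / alpha) = tau ^+ 2.
  by rewrite /kap; field; rewrite gt_eqF.
have kap1 : 0 < kap + 1 by rewrite addr_gt0.
have tc0 : 0 < tau * c0 by exact: mulr_gt0.
have opt := optimal_star_cost alpha2 tau0; rewrite -/c0 -/kap in opt.
pose cy := (tau * c0) `^ alpha * (kap + 1) `^ (1 - alpha / 2) / (kap + 1).
have cy0 : 0 < cy.
  by apply: divr_gt0 => //; apply: mulr_gt0; exact: powR_gt0.
pose E' := (1 + tau ^+ 2) / 2.
have E'1 : 0 < E' - 1 by rewrite /E'; move: t21; clear; lra.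
pose rho := E' / tau ^+ 2.
have rho0 : 0 < rho by rewrite divr_gt0//; move: E'1; clear; lra.
have rho1 : rho < 1 by rewrite ltr_pdivrMr// mul1r /E'; move: t21; clear; lra.
have hE' : E' <= rho * (1 `^ (2 / alpha) * tau ^+ 2).
  by rewrite powR1 mul1r /rho divfK// gt_eqF.
pose D := d * (C2 / 2).
have D1 : 0 < D by rewrite mulr_gt0// divr_gt0.
have [K1 K10 row] := row_exponent alpha2 D1 tau0 (@ltr01 R) rho0 rho1 hE'.
pose xi := E + 1 - tau ^+ 2.
have xi0 : 0 < xi by rewrite /xi; move: hE; clear; lra.
pose c' := `|ln (kap + 1) - ln (d * C1 / 8)|.
have c'0 : 0 <= c' by exact: normr_ge0.
(* each summand makes one of the error terms below negligible *)
pose K := 8 + K1 + 2 / cy + 2 * d * C2 / cy + 24 * (kap + 1) ^+ 2 * d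
  + 8 * (kap + 1) + 4 / (E' - 1) + 36 / xi + 3 * (c' * (kap + 1)) / xi.
have k2 : 0 <= 2 / cy by rewrite divr_ge0// ltW.
have k3 : 0 <= 2 * d * C2 / cy.
  by apply: divr_ge0 (ltW cy0); apply: mulr_ge0 (ltW C20); rewrite mulr_ge0// ltW.
have k4 : 0 <= 24 * (kap + 1) ^+ 2 * d.
  by apply: mulr_ge0 (ltW d0); apply: mulr_ge0 => //; exact: sqr_ge0.
have k5 : 0 <= 8 * (kap + 1) by rewrite mulr_ge0// ltW.
have k6 : 0 <= 4 / (E' - 1) by rewrite divr_ge0// ltW.
have k7 : 0 <= 36 / xi by rewrite divr_ge0// ltW.
have k8 : 0 <= 3 * (c' * (kap + 1)) / xi.
  by rewrite divr_ge0 ?mulr_ge0// ltW.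
have k1 := ltW K10.
have [b0 [b1 [b2 [b3 [b4 [b5 [b6 [b7 b8]]]]]]]] := sum_ge_terms k1 k2 k3 k4 k5 k6 k7 k8.
rewrite -/K in b0 b1 b2 b3 b4 b5 b6 b7 b8.
clearbody K.
exists K, ((1 - rho) / 2); split.
- by rewrite divr_gt0// subr_gt0.
- by move: rho0; clear; lra.
move=> disp T P n G Y dn hG hY hGY x l Kx Kl KL lnL.
have x8 : 8 <= x by exact: le_trans Kx.
have l8 : 8 <= l by exact: le_trans Kl.
have L8 : 8 <= x / l by exact: le_trans KL.
have x0 : 0 < x by exact: lt_le_trans x8.
have l0 : 0 < l by exact: lt_le_trans l8.
have L0 : 0 < x / l by exact: lt_le_trans L8.
have n0 : 0 < n%:R :> R by exact: lt_le_trans d0 dn.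
have nx : n%:R = expR x by rewrite lnK.
have lnL' : (1 + rho) / 2 * l <= ln (x / l).
  by apply: le_trans lnL; rewrite le_eqVlt; apply/orP; left; apply/eqP; field.
pose lam := lambda_light alpha n.
have lamE := lambda_lightE alpha2 (erefl x) (erefl l) x0 l0; rewrite -/lam -/c0 in lamE.
pose L := x / l; rewrite -/L in L0 L8 KL.
pose k := (Num.truncn (kap * L)).+1.
have k0 : (0 < k)%N by [].
have kR : 0 < k%:R :> R by rewrite ltr0n.
have kge : kap * L <= k%:R by exact/ltW/truncnS_gt.
have kle1 : k%:R <= kap * L + 1.
  by rewrite -natr1 lerD2r truncn_le// mulr_ge0// ltW.
have kle : k%:R <= (kap + 1) * L.
  by rewrite mulrDl; move: kle1 L8; clear; lra.
have lL : l * L = x by rewrite /L mulrC divfK// gt_eqF.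
have Lx : L <= x by rewrite -lL ler_peMl ?(ltW L0)//; move: l8; clear; lra.
have kx : k%:R <= (kap + 1) * x by apply: le_trans kle _; rewrite ler_wpM2l// ltW.
pose t := tau * lam; pose y := t / Num.sqrt k%:R.
have lam0 : 0 < lam.
  rewrite lamE; apply: mulr_gt0 => //.
  by apply: mulr_gt0; apply: powR_gt0.
have t0 : 0 < t by exact: mulr_gt0.
have sk0 : 0 < Num.sqrt k%:R :> R by rewrite sqrtr_gt0.
have y0 : 0 < y by exact: divr_gt0.
have sky : Num.sqrt k%:R * y = t by rewrite /y mulrC divfK// gt_eqF.
have ya : y `^ alpha = (t ^+ 2 / k%:R) `^ (alpha / 2).
  have -> : t ^+ 2 / k%:R = y ^+ 2.
    by rewrite /y expr_div_n sqr_sqrtr// ltW.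
  by rewrite -powR_mulrn ?(ltW y0)// -powRrM; congr (_ `^ _); field.
have ec : k%:R * y `^ alpha = (tau * c0) `^ alpha * (k%:R / L) `^ (1 - alpha / 2) * x.
  by rewrite ya /t lamE; exact: even_cost.
have a12 : alpha / 2 - 1 >= 0 by move: alpha2; clear; lra.
have anti (u v : R) : 0 < u -> u <= v -> v `^ (1 - alpha / 2) <= u `^ (1 - alpha / 2).
  move=> u0 uv; have v0 : 0 < v by exact: lt_le_trans uv.
  have -> : 1 - alpha / 2 = - (alpha / 2 - 1) by ring.
  rewrite !powRN lef_pV2 ?posrE ?powR_gt0//.
  by apply: ge0_ler_powR; rewrite ?nnegrE// ltW.
have tcp : 0 <= (tau * c0) `^ alpha by exact: powR_ge0.
have kL0 : 0 < k%:R / L by exact: divr_gt0.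
have cost : k%:R * y `^ alpha <= tau ^+ 2 * (2 / alpha) * x.
  rewrite ec -opt; apply: ler_wpM2r; first exact: ltW.
  by apply: ler_wpM2l => //; apply: anti => //; rewrite ler_pdivlMr.
have ylow : cy * l <= y `^ alpha.
  rewrite -(ler_pM2l kR) ec.
  apply: (@le_trans _ _ ((tau * c0) `^ alpha * (kap + 1) `^ (1 - alpha / 2) * x)).
    have -> : k%:R * (cy * l) = (tau * c0) `^ alpha * (kap + 1) `^ (1 - alpha / 2)
        * (k%:R * l / (kap + 1)) by rewrite /cy; field; rewrite gt_eqF.
    apply: ler_wpM2l; first by apply: mulr_ge0 => //; exact: powR_ge0.
    rewrite ler_pdivrMr//.
    have -> : x * (kap + 1) = (kap + 1) * L * l by rewrite -[in LHS]lL; ring.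
    exact: (ler_wpM2r (ltW l0) kle).
  apply: ler_wpM2r; first exact: ltW.
  by apply: ler_wpM2l => //; apply: anti => //; rewrite ler_pdivrMr.
have cyl : 2 <= cy * l.
  by rewrite mulrC -ler_pdivrMr//; exact: le_trans b2 Kl.
have y1 : 1 < y.
  rewrite ltNge; apply/negP => yle1.
  have : y `^ alpha <= 1.
    have -> : 1 = 1 `^ alpha :> R by rewrite powR1.
    by apply: ge0_ler_powR; rewrite ?nnegrE// ltW.
  by move: ylow cyl; clear; lra.
pose q := fine (mu [set z | y <= z]).
have [qlo qup _ _] := weib y y1.
have qE : mu [set z | (y <= z)%R] = q%:E.
  rewrite /q fineK// fin_num_measure//.
  rewrite (_ : [set z | y <= z] = `[y, +oo[%classic)//.
  by apply/seteqP; split => z /=; rewrite in_itv/= andbT.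
rewrite qE lee_fin in qlo; rewrite qE lee_fin in qup.
have q0 : 0 <= q by exact: fine_ge0.
have e1 : d * q <= 4^-1.
  apply: (@le_trans _ _ (d * (C2 / 2 * (cy * l)^-1))).
    apply: (ler_wpM2l (ltW d0)); apply: le_trans qup _.
    apply: ler_wpM2l; first by rewrite divr_ge0// ltW.
    apply: (@le_trans _ _ (expR (- (cy * l)))); first by rewrite ler_expR lerN2.
    by apply: expRN_le_inv; rewrite mulr_gt0.
  have -> : d * (C2 / 2 * (cy * l)^-1) = (2 * d * C2 / cy) / (4 * l).
    by field; rewrite !gt_eqF.
  rewrite ler_pdivrMr ?mulr_gt0// mulrA mulVf// mul1r.
  exact: le_trans b3 Kl.
have e2 : k%:R ^+ 2 * d / n%:R <= 4^-1.
  have nx3 : x ^+ 3 / 6 <= n%:R.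
    by rewrite nx; apply: le_trans (pow_fact_le_expR 3 (ltW x0)).
  have x36 : 0 < x ^+ 3 / 6 by rewrite divr_gt0// exprn_gt0.
  rewrite ler_pdivrMr//; apply: (@le_trans _ _ (4^-1 * (x ^+ 3 / 6))); last first.
    by rewrite ler_wpM2l.
  apply: (@le_trans _ _ (((kap + 1) * x) ^+ 2 * d)).
    rewrite ler_wpM2r ?(ltW d0)// lerXn2r ?nnegrE ?(ltW kR)//.
    by rewrite mulr_ge0// ltW.
  have -> : ((kap + 1) * x) ^+ 2 * d = 24 * (kap + 1) ^+ 2 * d * (x ^+ 2 / 24) by field.
  have -> : 4^-1 * (x ^+ 3 / 6) = x * (x ^+ 2 / 24) by field.
  apply: ler_wpM2r; first by rewrite divr_ge0// sqr_ge0.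
  exact: le_trans b4 Kx.
have e3 : n%:R * ((d * q) ^+ k / k`!%:R) <= 4^-1.
  have hr := row x l lam k (le_trans b1 Kx) (le_trans b1 Kl) k0 lnL' lamE.
  rewrite -/t -ya mulNr mul1r in hr.
  have dq : (d * q) ^+ k / k`!%:R <= D ^+ k / k`!%:R * expR (- (k%:R * y `^ alpha)).
    have -> : expR (- (k%:R * y `^ alpha)) = expR (- y `^ alpha) ^+ k.
      by rewrite -expRM_natl mulrN.
    rewrite [leRHS]mulrAC -exprMn; apply: ler_wpM2r; first by rewrite invr_ge0.
    have De0 : 0 <= D * expR (- y `^ alpha) by rewrite mulr_ge0 ?expR_ge0// ltW.
    apply: lerXn2r; rewrite ?nnegrE//; first by rewrite mulr_ge0// ltW.
    by rewrite /D -mulrA; apply: ler_wpM2l => //; exact: ltW.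
  apply: (@le_trans _ _ (n%:R * expR (- (E' * x)))).
    by apply: (ler_wpM2l (ltW n0)); exact: (le_trans dq hr).
  rewrite nx -expRD.
  have -> : x + - (E' * x) = - ((E' - 1) * x) by ring.
  have Ex : 4 <= (E' - 1) * x by rewrite mulrC -ler_pdivrMr//; exact: le_trans b6 Kx.
  apply: le_trans (expRN_le_inv _) _; first by rewrite mulr_gt0.
  by rewrite lef_pV2 ?posrE// mulr_gt0.
have main := star_lower d0 dn hG hY hGY k0 e1 e2 e3.
rewrite sky -/q in main; apply: le_trans main; rewrite lee_fin.
have n8 : n%:R / 4 + k%:R <= (n - n./2)%:R :> R.
  have nx2 : x ^+ 2 / 2 <= n%:R.
    by rewrite nx; apply: le_trans (pow_fact_le_expR 2 (ltW x0)).
  have kn : k%:R <= n%:R / 4 :> R.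
    apply: le_trans kx _; rewrite ler_pdivlMr//; apply: le_trans nx2.
    have h := ler_wpM2r (ltW x0) (le_trans b5 Kx).
    by move: h; rewrite expr2; clear; lra.
  have : n%:R / 2 <= (n - n./2)%:R :> R.
    rewrite ler_pdivrMr// -natrM ler_nat.
    exact: leq_double_uphalf.
  by move: kn; clear; lra.
have hC : (n%:R / 4 / k%:R) ^+ k <= 'C(n - n./2, k)%:R :> R.
  by apply: bin_ge_pow => //; rewrite divr_ge0// ltW.
have hn : n%:R / 4 <= (n./2)%:R :> R.
  rewrite ler_pdivrMr// -natrM ler_nat.
  have n2 : (2 <= n)%N.
    rewrite -(ler_nat R) nx; apply: le_trans (expR_ge1Dx x).
    by move: x8; clear; lra.
  exact: leq_quadruple_half.
pose z := d * C1 / 8.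
have z0 : 0 < z by rewrite divr_gt0// mulr_gt0.
(* [16] collects the [1/4] from the number of centres and the [1/4] from the
   clean stars, [8] in [z] the [1/4] from the leaves and the [1/2] in the tail *)
apply: (@le_trans _ _ (n%:R / 16 * (z / k%:R * expR (- y `^ alpha)) ^+ k)); last first.
  have -> : n%:R / 16 * (z / k%:R * expR (- y `^ alpha)) ^+ k =
     n%:R / 4 * (n%:R / 4 / k%:R) ^+ k *
     ((d / n%:R * (C1 / 2 * expR (- y `^ alpha))) ^+ k / 4).
    have -> : z / k%:R * expR (- y `^ alpha) =
       n%:R / 4 / k%:R * (d / n%:R * (C1 / 2 * expR (- y `^ alpha))).
      by rewrite /z; field; rewrite !gt_eqF.
    by rewrite exprMn; move: (_ ^+ k) (_ ^+ k) => v1 v2; field.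
  have dn0 : 0 <= d / n%:R by rewrite divr_ge0// ltW.
  have n40 : 0 <= n%:R / 4 :> R by rewrite divr_ge0// ltW.
  have nk0 : 0 <= (n%:R / 4 / k%:R) ^+ k :> R by apply: exprn_ge0; exact: divr_ge0.
  have lo0 : 0 <= d / n%:R * (C1 / 2 * expR (- y `^ alpha)).
    by apply: mulr_ge0 => //; apply: mulr_ge0 (expR_ge0 _); apply: divr_ge0 => //; exact: ltW.
  apply: ler_pM; first exact: mulr_ge0.
  - by rewrite divr_ge0// exprn_ge0.
  - exact: (ler_pM n40 nk0 hn hC).
  apply: ler_wpM2r => //; apply: lerXn2r; rewrite ?nnegrE//.
    exact: mulr_ge0.
  exact: ler_wpM2l.
have -> : n%:R / 16 * (z / k%:R * expR (- y `^ alpha)) ^+ k =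
    expR (x - ln 16 + k%:R * (ln z - ln k%:R - y `^ alpha)).
  by rewrite !expRD expRN expRM_natl !expRD !expRN !lnK ?posrE// -nx.
rewrite ler_expR.
have ln16 : ln 16 <= 16 :> R by apply/ltW/ln_sublinear.
have lnk : ln k%:R <= ln (kap + 1) + l.
  by rewrite -(lnM kap1 x0) (ler_ln kR (mulr_gt0 kap1 x0)).
have c'z : ln (kap + 1) - ln z <= c' by exact: ler_norm.
have kc : k%:R * (ln (kap + 1) - ln z) <= xi * x / 3.
  apply: (@le_trans _ _ ((kap + 1) * L * c')).
    apply: (@le_trans _ _ (k%:R * c')); first by rewrite ler_wpM2l// ltW.
    exact: ler_wpM2r.
  have h : 3 * (c' * (kap + 1)) <= xi * l.
    by rewrite (mulrC xi) -ler_pdivrMr//; exact: (le_trans b8 Kl).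
  have := ler_wpM2r (ltW L0) h.
  have -> : xi * l * L = xi * x by rewrite -mulrA lL.
  have -> : 3 * (c' * (kap + 1)) * L = 3 * ((kap + 1) * L * c') by ring.
  by move: (xi * x) (_ * c') => v1 v2; clear; lra.
have lx : l <= xi * x / 36.
  have h : 36 <= xi * L by rewrite mulrC -ler_pdivrMr//; exact: le_trans b7 KL.
  have := ler_wpM2l (ltW l0) h.
  have -> : l * (xi * L) = xi * x by rewrite mulrCA lL.
  by clear; lra.
have kl : k%:R * l <= kap * x + l.
  apply: le_trans (ler_wpM2r (ltW l0) kle1) _.
  by rewrite mulrDl mul1r -mulrA (mulrC L) lL.
have xx : 36 <= xi * x by rewrite mulrC -ler_pdivrMr//; exact: le_trans b7 Kx.
have klnk := ler_wpM2l (ltW kR) lnk.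
have kapx : kap * x + tau ^+ 2 * (2 / alpha) * x = tau ^+ 2 * x.
  by rewrite -mulrDl kapE.
have -> : k%:R * (ln z - ln k%:R - y `^ alpha) =
    - (k%:R * (ln k%:R - ln (kap + 1) - l)) - k%:R * (ln (kap + 1) - ln z)
    - k%:R * l - k%:R * y `^ alpha by ring.
have klnk' : k%:R * (ln k%:R - ln (kap + 1) - l) <= 0.
  by rewrite pmulr_rle0//; move: lnk; clear; lra.
have xiE : xi * x = E * x + x - tau ^+ 2 * x by rewrite /xi; ring.
move: klnk' kc kl cost kapx xx lx ln16 xiE; clear.
move: (_ * (ln k%:R - _ - l)) (_ * (_ - ln z)) (_ * l) (_ * y `^ alpha) => v1 v2 v3 v4.
move: (xi * x) (E * x) (tau ^+ 2 * x) (_ * (2 / alpha) * x) (kap * x) (ln 16) => *; lra.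
Qed.

(** * The logarithmic limit *)

(** Two-sided power bounds [n ^ - (c +- e)] give the logarithmic limit. *)
Lemma log_limit (R : realType) (f : nat -> \bar R) (c : R) :
  (forall e, 0 < e -> \forall n \near \oo,
     ((expR (- ((c + e) * ln n%:R)))%:E <= f n)%E /\
     (f n <= (expR (- ((c - e) * ln n%:R)))%:E)%E) ->
  (- (lne (f n) / (ln n%:R)%:E))%E @[n --> \oo] --> c%:E.
Proof.
move=> bounds.
have near_val e : 0 < e -> \forall n \near \oo,
    exists2 r : R, (- (lne (f n) / (ln n%:R)%:E))%E = r%:E & `|c - r| <= e.
  move=> e0; near=> n.
  have x1 : 1 <= ln n%:R :> R by near: n; exact: near_ln_ge.
  have x0 : 0 < ln n%:R :> R by exact: lt_le_trans x1.
  have [lo up] : ((expR (- ((c + e) * ln n%:R)))%:E <= f n)%E /\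
     (f n <= (expR (- ((c - e) * ln n%:R)))%:E)%E by near: n; exact: bounds.
  have fin : f n \is a fin_num.
    by rewrite fin_numElt (lt_le_trans _ lo) ?ltNyr// (le_lt_trans up) ?ltry.
  move: lo up; rewrite -(fineK fin) !lee_fin; set r := fine (f n) => lo up.
  have r0 : 0 < r by exact: lt_le_trans (expR_gt0 _) lo.
  exists (- (ln r / ln n%:R)).
    by rewrite lne_EFin// inver gt_eqF// -EFinM -EFinN.
  have l1 : - ((c + e) * ln n%:R) <= ln r.
    by rewrite -[leLHS]expRK ler_ln ?posrE ?expR_gt0.
  have l2 : ln r <= - ((c - e) * ln n%:R).
    by rewrite -[leRHS]expRK ler_ln ?posrE ?expR_gt0.
  have l3 : - (c + e) <= ln r / ln n%:R by rewrite ler_pdivlMr// mulNr.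
  have l4 : ln r / ln n%:R <= - (c - e) by rewrite ler_pdivrMr// mulNr.
  by rewrite ler_norml; apply/andP; split; move: l3 l4; lra.
apply/fine_cvgP; split.
  near=> n; have [r -> _] : exists2 r : R, (- (lne (f n) / (ln n%:R)%:E))%E = r%:E & `|c - r| <= 1.
    by near: n; exact: near_val.
  by [].
apply/cvgrPdist_le => e e0; near=> n.
have [r /= -> //] : exists2 r : R, (- (lne (f n) / (ln n%:R)%:E))%E = r%:E & `|c - r| <= e.
by near: n; exact: near_val.
Unshelve. all: by end_near. Qed.

Theorem theorem1p1 (R : realType) (d alpha : R) (hd : 0 < d) (halpha : 2 < alpha)
  (mu : probability R R) (hmu : weibull_law alpha mu)
  (disp : nat -> measure_display) (T : forall n, measurableType (disp n))
  (P : forall n, probability (T n) R)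
  (G : forall n, 'I_n -> 'I_n -> {RV (P n) >-> bool})
  (Y : forall n, 'I_n -> 'I_n -> {RV (P n) >-> R})
  (hG : forall n, d <= n%:R -> erdos_renyi (d / n%:R) (@G n))
  (hY : forall n, d <= n%:R -> symmetric_iid mu (@Y n))
  (hGY : forall n, d <= n%:R ->
    independent_families (fun ij : 'I_n * 'I_n => G n ij.1 ij.2)
                         (fun ij : 'I_n * 'I_n => Y n ij.1 ij.2))
  (delta : R) (hdelta : 0 < delta) :
  (- (lne (P n [set w | ((1 + delta) * lambda_light alpha n
                          <= lambda1 (sparse_matrix (@G n) (@Y n) w))%R])
      / (ln n%:R)%:E))%E @[n --> \oo] --> ((1 + delta) ^+ 2 - 1)%:E.
Proof.
apply: log_limit => e e0; set c := (1 + delta) ^+ 2 - 1.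
have c0 : 0 < c.
  by rewrite subr_gt0 exprn_egt1// ltrDl.
have [Kl [etal [etal0 etal1 lower]]] :=
  lower_tail hd halpha hmu hdelta (ltr_pwDr e0 (lexx c) : c < c + e).
pose E := Num.max 0 (c - e).
have E0 : 0 <= E by rewrite le_max lexx.
have Ec : E < c by rewrite gt_max c0 gtrDl oppr_lt0.
have [Ku [etau [etau0 etau1 upper]]] := upper_tail hd halpha hmu hdelta E0 Ec.
near=> n.
have dn : d <= n%:R by near: n; exact: nbhs_infty_ger.
have [l1 l2 l3 l4] : let x := ln n%:R in let l := ln x in
    [/\ Kl <= x, Kl <= l, Kl <= x / l & (1 - etal) * l <= ln (x / l)].
  by near: n; exact: log_scales_near.
have [u1 u2 u3 u4] : let x := ln n%:R in let l := ln x in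
    [/\ Ku <= x, Ku <= l, Ku <= x / l & (1 - etau) * l <= ln (x / l)].
  by near: n; exact: log_scales_near.
have x1 : 0 <= ln n%:R :> R by near: n; exact: near_ln_ge.
split; first exact: (lower _ _ _ _ _ _ dn (hG n dn) (hY n dn) (hGY n dn) l1 l2 l3 l4).
apply: le_trans (upper _ _ _ _ _ _ dn (hG n dn) (hY n dn) (hGY n dn) u1 u2 u3 u4) _.
by rewrite lee_fin ler_expR lerN2 ler_wpM2r// le_max lexx orbT.
Unshelve. all: by end_near. Qed.
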